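(* Let $(X,d,\mu)$ be a space of homogeneous type satisfying: there are $\epsilon_0>0$ and a constant $C(c,K)$ with $c^{j\epsilon_0}\mu(B(x,t))\le\mu(B(x,c^jt))\le C(c,K)^j\mu(B(x,t))$ for all $t>0$, $x\in X$, $j\in\mathbb N$. Let $T_K$ be a Calderón–Zygmund operator which is bounded on $L^2(X)$. If $b\in BMO(X)$, then the commutator $[M_b,T_K]=M_bT_K-T_KM_b$ is bounded on $L^p(X)$ for all $1<p<\infty$.
   Context: Space of homogeneous type: a locally compact Hausdorff space $X$ with a positive regular Borel measure $\mu$ and a family of basic open sets $\{B(x,r):x\in X,r>0\}$ such that for some constants $c>1,K>1$: (1) $x\in B(x,r)$; (2) $B(x,r_1)\subset B(x,r_2)$ if $0<r_1\le r_2$; (3) $0<\mu(B(x,r))<\infty$; (4) $X=\bigcup_{r>0}B(x,r)$; (5) $\mu(B(x,cr))\le K\mu(B(x,r))$; (6) if $B(x_1,r_1)\cap B(x_2,r_2)\neq\emptyset$ and $r_1\ge r_2$ then $B(x_2,r_2)\subset B(x_1,cr_1)$. Also $\mu(\{x\})=0$ for all $x$. Writing $(X,d,\mu)$ means the structure is given by a quasi-metric $d$, $B(x,r)=\{y:d(x,y)<r\}$. $M_b$ is multiplication by $b$. $BMO(X)$: $f\in L^1_{\rm loc}(X)$ with $\|f\|_*=\sup_B\frac1{\mu(B)}\int_B|f-m_B(f)|\,d\mu<\infty$ over all balls $B$, $m_B(f)$ being the mean of $f$ on $B$. Let $\lambda(x,y)=\mu(B(x,d(x,y)))$. A standard kernel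 is $K:X\times X\setminus\{x=y\}\to\mathbb C$ such that for some $\epsilon>0$, $0<C<\infty$: $|K(x,y)|\le C/\lambda(x,y)$ for $x\ne y$, and $|K(x,y)-K(x',y)|+|K(y,x)-K(y,x')|\le (d(x,x')/d(x,y))^\epsilon C/\lambda(x,y)$ whenever $d(x,y)\ge c\,d(x,x')$. $\Lambda_\delta$ is the space of Hölder continuous functions of order $\delta$ on $X$ with bounded support, $\Lambda_\delta'$ its dual. A Calderón–Zygmund (singular integral) operator $T_K$ is a continuous linear $T:\Lambda_\delta\to\Lambda_\delta'$, for some $\delta>0$, associated to a standard kernel $K$: $K$ is locally integrable off the diagonal and $\langle Tf,g\rangle=\iint K(x,y)f(y)g(x)\,d\mu(y)\,d\mu(x)$ for $f,g\in\Lambda_\delta$ with supports separated by a positive distance.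
   Formalization: The order δ of Λ_δ is assumed to be one for which Λ_δ contains cut-off functions between a bounded set and any set at positive distance (true for all small δ); for large δ, e.g. δ>1 on R, Λ_δ={0} and T determines no operator on L^2. *)

(* Defs.v *)
From HB Require Import structures.
From mathcomp Require Import all_boot all_order all_algebra.
From mathcomp Require Import all_classical all_reals all_analysis.
From mathcomp Require Import complex.

Set Implicit Arguments.
Unset Strict Implicit.
Unset Printing Implicit Defensive.

Import Order.TTheory GRing.Theory Num.Theory.
Import numFieldNormedType.Exports.

Local Open Scope classical_set_scope.
Local Open Scope ring_scope.
Local Open Scope complex_scope.

Notation borel X := (g_sigma_algebraType (@open X)).

Local Notation normc := Normc.normc.

(* b f need not lie in L^2 when b is unbounded: M_b S - S M_b is a densely
   defined operator, with domain commutator_domain when S acts on L^2 *)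
Definition commutator (R : realType) (T : Type) (b : T -> R[i])
    (S : (T -> R[i]) -> T -> R[i]) (f : T -> R[i]) : T -> R[i] :=
  fun x => b x * S f x - S (fun y => b y * f y) x.

Section ComplexIntegration.
Context (R : realType) (disp : measure_display) (T : measurableType disp).
Implicit Types (D : set T) (f g : T -> R[i]).

Definition cmeasurable D f :=
  measurable_fun D (fun x => complex.Re (f x)) /\
  measurable_fun D (fun x => complex.Im (f x)).

Variable mu : {measure set T -> \bar R}.

Definition cintegrable D f :=
  mu.-integrable D (fun x => (complex.Re (f x))%:E) /\
  mu.-integrable D (fun x => (complex.Im (f x))%:E).

Definition cintegral D f : R[i] :=
  (Rintegral mu D (fun x => complex.Re (f x))) +i*
  (Rintegral mu D (fun x => complex.Im (f x))).

Definition Lp_norm (p : R) f : \bar R :=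
  Lnorm mu p%:E (fun x => (normc (f x))%:E).

Definition in_Lp (p : R) f :=
  cmeasurable [set: T] f /\ (Lp_norm p f < +oo)%E.

(* S acts on representatives; linearity is required almost everywhere and,
   with the norm bound, makes S compatible with almost everywhere equality *)
Definition bounded_operator (p : R) (S : (T -> R[i]) -> T -> R[i]) :=
  [/\ forall f, in_Lp p f -> in_Lp p (S f),
      forall (a : R[i]) f g, in_Lp p f -> in_Lp p g ->
        {ae mu, forall x, S (fun y => a * f y + g y) x = a * S f x + S g x} &
      exists C : R, forall f, in_Lp p f ->
        (Lp_norm p (S f) <= C%:E * Lp_norm p f)%E].

(* an operator S with domain D is bounded on L^p when it is defined on a dense
   subspace of L^p and satisfies a norm estimate there, i.e. when it extends
   uniquely to a bounded operator on L^p *)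
Definition bounded_on_Lp (p : R) (D : set (T -> R[i]))
    (S : (T -> R[i]) -> T -> R[i]) :=
  (forall f, in_Lp p f -> forall e : R, 0 < e ->
    exists g, [/\ D g, in_Lp p g &
      (Lp_norm p (fun x => f x - g x)%R < e%:E)%E]) /\
  (exists C : R, forall f, D f -> in_Lp p f ->
    in_Lp p (S f) /\ (Lp_norm p (S f) <= C%:E * Lp_norm p f)%E).

Definition commutator_domain (b : T -> R[i]) : set (T -> R[i]) :=
  [set f | in_Lp 2 f /\ in_Lp 2 (fun x => b x * f x)].

End ComplexIntegration.

Section HomogeneousType.
Context (R : realType) (X : ptopologicalType).
Variable mu : {measure set (borel X) -> \bar R}.

Definition regular_measure :=
  forall A : set X, measurable (A : set (borel X)) ->
    mu A = ereal_inf [set mu U | U in [set U : set X | open U /\ A `<=` U]] /\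
    mu A = ereal_sup [set mu C | C in [set C : set X | compact C /\ C `<=` A]].

Record homogeneous_type (B : X -> R -> set X) (c K : R) : Prop := {
  hom_hausdorff : hausdorff_space X;
  hom_locally_compact : locally_compact [set: X];
  hom_regular : regular_measure;
  hom_basis : basis [set U | exists (x : X) (r : R), 0 < r /\ U = B x r];
  hom_c : 1 < c;
  hom_K : 1 < K;
  hom_center : forall (x : X) (r : R), 0 < r -> B x r x;
  hom_nested : forall (x : X) (r1 r2 : R), 0 < r1 -> r1 <= r2 -> B x r1 `<=` B x r2;
  hom_pos_fin : forall (x : X) (r : R), 0 < r -> (0 < mu (B x r) < +oo)%E;
  hom_cover : forall x, [set: X] = \bigcup_(r in [set r : R | 0 < r]) B x r;
  hom_doubling : forall (x : X) (r : R), 0 < r ->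
    (mu (B x (c * r)%R) <= K%:E * mu (B x r))%E;
  hom_engulfing : forall (x1 x2 : X) (r1 r2 : R), 0 < r1 -> 0 < r2 -> r2 <= r1 ->
    B x1 r1 `&` B x2 r2 !=set0 -> B x2 r2 `<=` B x1 (c * r1);
  hom_atomless : forall x, mu [set x] = 0%E
}.

Definition ball_growth (B : X -> R -> set X) (c : R) :=
  exists eps0 C : R, 0 < eps0 /\ forall (x : X) (t : R) (j : nat), 0 < t ->
    ((c `^ (j%:R * eps0))%:E * mu (B x t) <= mu (B x (c ^+ j * t)%R) /\
     mu (B x (c ^+ j * t)%R) <= (C ^+ j)%:E * mu (B x t))%E.

Variable d : X -> X -> R.

Definition quasi_metric :=
  [/\ forall x y, 0 <= d x y,
      forall x y, d x y = 0 <-> x = y,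
      forall x y, d x y = d y x &
      exists A : R, forall x y z, d x z <= A * (d x y + d y z)].

Definition qball (x : X) (r : R) : set X := [set y | d x y < r].

Definition mean (A : set X) (f : X -> R[i]) : R[i] :=
  ((fine (mu A))^-1)%:C * cintegral mu A f.

Definition mean_oscillation (f : X -> R[i]) (A : set X) : \bar R :=
  (((fine (mu A))^-1)%:E *
    \int[mu]_(x in (A : set (borel X))) (normc (f x - mean A f))%:E)%E.

Definition bmo_norm (f : X -> R[i]) : \bar R :=
  ereal_sup [set mean_oscillation f (qball x.1 x.2) |
             x in [set x : X * R | 0 < x.2]].

(* balls need not be relatively compact, so local integrability is integrability
   over balls, without which the means are not defined *)
Definition BMO : set (X -> R[i]) :=
  [set f | (forall (x : X) (r : R), 0 < r -> cintegrable mu (qball x r) f) /\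
           (bmo_norm f < +oo)%E].

Definition lambda (x y : X) : R := fine (mu (qball x (d x y))).

(* kernels are total functions whose values on the diagonal play no role *)
Definition standard_kernel (c : R) (k : X -> X -> R[i]) :=
  exists eps C : R, [/\ 0 < eps, 0 < C,
    forall x y, x <> y -> normc (k x y) <= C / lambda x y &
    forall x x' y, x <> y -> c * d x x' <= d x y ->
      normc (k x y - k x' y) + normc (k y x - k y x')
        <= (d x x' / d x y) `^ eps * (C / lambda x y)].

Definition locally_integrable_off_diagonal (k : X -> X -> R[i]) :=
  cmeasurable [set z : borel X * borel X | z.1 <> z.2]
    (fun z => k z.1 z.2) /\
  forall A B : set X, compact A -> compact B -> A `&` B = set0 ->
    (\int[mu]_(x in (A : set (borel X)))
       \int[mu]_(y in (B : set (borel X))) (normc (k x y))%:E < +oo)%E.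

Definition qbounded (A : set X) := exists x r, A `<=` qball x r.

Definition separated (A B : set X) :=
  exists2 eta : R, 0 < eta & forall x y, A x -> B y -> eta <= d x y.

Definition nonzero (f : X -> R[i]) : set X := [set x | f x <> 0].

Definition holder_norm_le (delta M : R) (f : X -> R[i]) :=
  (forall x, normc (f x) <= M) /\
  (forall x y, normc (f x - f y) <= M * d x y `^ delta).

(* the space Lambda_delta; Holder functions of bounded support are bounded *)
Definition Holder (delta : R) : set (X -> R[i]) :=
  [set f | (exists M, holder_norm_le delta M f) /\ qbounded (nonzero f)].

(* delta is an admissible order of Holder continuity: Lambda_delta contains
   cut-off functions.  This always holds for small delta, but for large delta
   Lambda_delta may be trivial (e.g. delta > 1 on R^n), and an operator on it
   then carries no information *)
Definition admissible (delta : R) :=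
  forall A B : set X, qbounded A -> separated A B ->
    exists2 phi, Holder delta phi &
      (forall x, A x -> phi x = 1) /\ (forall x, B x -> phi x = 0).

(* T f g stands for the (bilinear) pairing <T f, g>; continuity is with respect
   to the inductive limit topology given by the Holder norms on the functions
   supported in a fixed ball *)
Definition continuous_operator (delta : R)
    (T : (X -> R[i]) -> (X -> R[i]) -> R[i]) :=
  [/\ forall (a : R[i]) f1 f2 g,
        Holder delta f1 -> Holder delta f2 -> Holder delta g ->
        T (fun x => a * f1 x + f2 x) g = a * T f1 g + T f2 g,
      forall (a : R[i]) f g1 g2,
        Holder delta f -> Holder delta g1 -> Holder delta g2 ->
        T f (fun x => a * g1 x + g2 x) = a * T f g1 + T f g2 &
      forall x0 r, exists C : R, forall f g M N,
        holder_norm_le delta M f -> nonzero f `<=` qball x0 r ->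
        holder_norm_le delta N g -> nonzero g `<=` qball x0 r ->
        normc (T f g) <= C * M * N].

Definition associated (delta : R) (k : X -> X -> R[i])
    (T : (X -> R[i]) -> (X -> R[i]) -> R[i]) :=
  locally_integrable_off_diagonal k /\
  forall f g, Holder delta f -> Holder delta g ->
    separated (nonzero f) (nonzero g) ->
    T f g = cintegral mu [set: X] (fun x =>
              cintegral mu [set: X] (fun y => k x y * f y * g x)).

Definition calderon_zygmund (c delta : R) (k : X -> X -> R[i])
    (T : (X -> R[i]) -> (X -> R[i]) -> R[i]) :=
  [/\ 0 < delta /\ admissible delta, standard_kernel c k,
      continuous_operator delta T & associated delta k T].

(* T is bounded on L^2, and T2 is its extension to L^2 *)
Definition bounded_on_L2 (delta : R)
    (T : (X -> R[i]) -> (X -> R[i]) -> R[i])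
    (T2 : (X -> R[i]) -> X -> R[i]) :=
  bounded_operator mu 2 T2 /\
  forall f g, Holder delta f -> Holder delta g ->
    T f g = cintegral mu [set: X] (fun x => T2 f x * g x).

End HomogeneousType.

(* Main.v *)
(* The sharp-function proof of the commutator theorem of Coifman, Rochberg and
   Weiss.  Let Omega u l be the union of the balls on which the mean of u exceeds
   l, i.e. a superlevel set of the maximal function.  If on every ball meeting the
   complement of E' l the function F differs from some constant by at most g l in
   the mean, with g small, then a good-lambda inequality bounds the norm of F in
   L^p by the p-th moment of the distribution l |-> mu (E' l), provided that F
   lies a priori in some L^p0 with 1 < p0 <= p.  Balls need not form a
   neighbourhood base at their centre, so Whitney coverings are replaced by
   finite disjoint families of balls of nearly maximal radius among those with
   large mean; these exist since by the growth condition the measure of balls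
   tends to infinity with the radius.

   The pairing of T f with Hölder functions of separated support determines T2 f
   off the support of f as an integral against the kernel, by density of Hölder
   functions in L^2.  The Calderon-Zygmund decomposition then gives the weak type
   (1,1) bound, interpolation gives L^p for p < 2, and the sharp-function bound
   gives p > 2.  For bounded b it also bounds the commutator: on a ball of mean
   beta, [b,T] f = (b - beta) T f - T ((b - beta) f), both terms are controlled by
   Hölder's inequality and the John-Nirenberg inequality for b, and the constant
   depends on b only through its mean oscillations.  For general b and f one
   truncates both and passes to the limit with Fatou's lemma. *)
Require Import Defs.
From HB Require Import structures.
From mathcomp Require Import all_boot all_order all_algebra.
From mathcomp Require Import all_classical all_reals all_analysis.
From mathcomp Require Import measurable_realfun complex ring lra.

Set Implicit Arguments.
Unset Strict Implicit.
Unset Printing Implicit Defensive.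

Import Order.TTheory GRing.Theory Num.Theory.
Import numFieldNormedType.Exports.

Local Open Scope classical_set_scope.
Local Open Scope ring_scope.
Local Open Scope complex_scope.
Local Notation normc := Normc.normc.
Local Notation separated := Defs.separated.
Local Notation above u l := [set x | (l < u x)%R].
Local Notation below u l := [set x | (u x <= l)%R].

(** * Integrals of nonnegative functions and finite unions *)

(** Three devices shape the estimates. Distribution functions are sampled along a geometric sequence
    of levels [s / a ^+ n], so layer-cake integrals become series and nothing has to be measurable
    in the level; every bound is uniform in the top level [s], which is then sent to infinity.
    Inequalities of Hölder or Cauchy-Schwarz type are used as pointwise inequalities with a free
    parameter, integrated and then specialised, so no roots of integrals appear. Covering arguments
    are run only on compact subsets, where finite subcovers exist, and inner regularity makes the
    set left over as small as needed. The good-lambda argument absorbs a term into the left-hand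
    side and so needs a quantity known to be finite beforehand. This is why the operator is first
    bounded on L^p for some exponents, and why the commutator is first treated for bounded [b],
    where a finite but useless bound is immediate. Functions are handled as representatives, and the
    operator is linear only almost everywhere; splittings of an argument are therefore always
    followed by an almost-everywhere comparison. *)

Section FiniteUnions.
Context (T : Type).

Definition unions (I : eqType) (s : seq I) (F : I -> set T) : set T :=
  [set x | exists2 i, i \in s & F i x].

Lemma unions_nil (I : eqType) (F : I -> set T) : unions [::] F = set0.
Proof. by apply/seteqP; split=> [x [j]|//]; rewrite in_nil. Qed.

Lemma unions_cons (I : eqType) i (s : seq I) (F : I -> set T) :
  unions (i :: s) F = F i `|` unions s F.
Proof.
apply/seteqP; split => [x [j]|x [Fx|[j js Fj]]].
- by rewrite inE => /predU1P[-> Fi|js Fj]; [left|right; exists j].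
- by exists i => //; rewrite mem_head.
- by exists j => //; rewrite in_cons js orbT.
Qed.

(** Disjointness is by position in the list, so a nonempty member cannot occur twice;
    [disjoint_family_uniq] relies on this. *)
Definition disjoint_family (I : eqType) (F : I -> set T) (s : seq I) :=
  pairwise (fun i j => `[< F i `&` F j = set0 >]) s.

Lemma disjoint_familyP (I : eqType) (F : I -> set T) i s :
  disjoint_family F (i :: s) ->
  F i `&` unions s F = set0 /\ disjoint_family F s.
Proof.
rewrite /disjoint_family pairwise_cons => /andP[/allP dj ps]; split => //.
apply/seteqP; split=> [x [Fi [j js Fj]]|//].
by have /asboolP ij := dj _ js; rewrite -ij.
Qed.

End FiniteUnions.

Section NonnegativeIntegral.
Context d (T : measurableType d) (R : realType) (mu : {measure set T -> \bar R}).
Implicit Types (A B : set T) (u v : T -> R).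

Lemma measurable_gt u (l : R) : measurable_fun setT u -> measurable [set x | l < u x].
Proof.
move=> mfu; rewrite -[X in measurable X]setTI.
exact: (measurable_fun_ltr (@measurable_cst _ _ _ _ setT l) mfu measurableT
  (Y := [set true])).
Qed.

Lemma measurable_le u (l : R) : measurable_fun setT u -> measurable [set x | u x <= l].
Proof.
move=> mfu; rewrite -[X in measurable X]setTI.
exact: (measurable_fun_ler mfu (@measurable_cst _ _ _ _ setT l) measurableT
  (Y := [set true])).
Qed.

Definition nint A u : \bar R := (\int[mu]_(x in A) (u x)%:E)%E.

Lemma nint_ge0 A u : (forall x, A x -> 0 <= u x) -> (0 <= nint A u)%E.
Proof. by move=> u0; apply: integral_ge0 => x Ax; rewrite lee_fin u0. Qed.

(** Nothing is assumed measurable: the integral of a nonnegative function is a supremum over the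
    simple functions below it, and the functions competing on the left also compete on the right. *)
Lemma nint_le A B u v : (forall x, A x -> 0 <= u x) ->
  (forall x, B x -> 0 <= v x) -> (forall x, A x -> B x /\ u x <= v x) ->
  (nint A u <= nint B v)%E.
Proof.
move=> u0 v0 uv; rewrite /nint integral_mkcond [leRHS]integral_mkcond.
have E0 (C : set T) (w : T -> R) : (forall x, C x -> 0 <= w x) ->
    forall x, (0 <= ((fun x => (w x)%:E) \_ C) x)%E.
  by move=> w0 x; rewrite patchE; case: ifPn => // /set_mem Cx; rewrite lee_fin w0.
rewrite ge0_integralTE; last exact: E0.
rewrite ge0_integralTE; last exact: E0.
apply: ereal_sup_le => _ [h hu <-]; exists h => //= x.
apply: le_trans (hu x) _; rewrite !patchE.
case: ifPn => [/set_mem /uv [Bx uvx]|_]; first by rewrite mem_set // lee_fin.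
by case: ifPn => // /set_mem Bx; rewrite lee_fin v0.
Qed.

Lemma nint_le_fun A u v : (forall x, A x -> 0 <= u x <= v x) ->
  (nint A u <= nint A v)%E.
Proof.
move=> uv; apply: nint_le => x Ax; have /andP[u0 uvx] := uv _ Ax => //.
exact: le_trans uvx.
Qed.

Lemma nint_le_set A B u : (forall x, 0 <= u x) -> A `<=` B ->
  (nint A u <= nint B u)%E.
Proof. by move=> u0 AB; apply: nint_le => // x Ax; split => //; apply: AB. Qed.

Lemma eq_nint A u v : (forall x, A x -> u x = v x) -> nint A u = nint A v.
Proof.
by move=> uv; apply: eq_integral => x /set_mem Ax; rewrite uv.
Qed.

Lemma nintD A u v : measurable A -> measurable_fun setT u ->
  measurable_fun setT v -> (forall x, 0 <= u x) -> (forall x, 0 <= v x) ->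
  nint A (fun x => u x + v x) = (nint A u + nint A v)%E.
Proof.
move=> mA mfu mfv u0 v0; rewrite /nint -ge0_integralD //.
- by move=> x _; rewrite lee_fin.
- by apply/measurable_EFinP; apply: measurable_funTS.
- by move=> x _; rewrite lee_fin.
- by apply/measurable_EFinP; apply: measurable_funTS.
Qed.

Lemma nintZ A (k : R) u : measurable A -> measurable_fun setT u ->
  (forall x, 0 <= u x) -> 0 <= k ->
  nint A (fun x => k * u x) = (k%:E * nint A u)%E.
Proof.
move=> mA mfu u0 k0; rewrite /nint -ge0_integralZl_EFin //.
- by move=> x _; rewrite lee_fin.
- by apply/measurable_EFinP; apply: measurable_funTS.
Qed.

Lemma nint_cst A (k : R) : measurable A -> nint A (fun=> k) = (k%:E * mu A)%E.
Proof. by move=> ?; rewrite /nint integral_cst. Qed.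

Lemma nint0 A : nint A (fun=> 0) = 0%E.
Proof. by rewrite /nint integral0. Qed.

Lemma nint_indic A B u : nint A (fun x => u x * \1_B x) = nint (A `&` B) u.
Proof.
rewrite /nint [RHS]integral_mkcondr; apply: eq_integral => x _.
by rewrite patchE indicE; case: ifPn => xB; rewrite ?mulr1 ?mulr0.
Qed.

Lemma nint_ae_le A u v : measurable A -> measurable_fun setT u ->
  measurable_fun setT v -> (forall x, 0 <= u x) -> (forall x, 0 <= v x) ->
  {ae mu, forall x, A x -> u x <= v x} -> (nint A u <= nint A v)%E.
Proof.
move=> mA mfu mfv u0 v0 uv; apply: ae_ge0_le_integral => //.
- by move=> x _; rewrite lee_fin.
- by apply/measurable_EFinP; apply: measurable_funTS.
- by move=> x _; rewrite lee_fin.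
- by apply/measurable_EFinP; apply: measurable_funTS.
Qed.

Lemma nint_setU_le A B u : measurable A -> measurable B ->
  measurable_fun setT u -> (forall x, 0 <= u x) ->
  (nint (A `|` B) u <= nint A u + nint B u)%E.
Proof.
move=> mA mB mfu u0.
have E C : nint C u = nint setT (fun x => u x * \1_C x) by rewrite nint_indic setTI.
rewrite !E -nintD //.
- apply: nint_le_fun => x _; apply/andP; split; first by rewrite mulr_ge0.
  rewrite -mulrDr; apply: ler_wpM2l => //; rewrite !indicE in_setU.
  by case: (x \in A); case: (x \in B); rewrite /= ?mulr1n ?mulr0n; lra.
- by apply: measurable_funM => //; apply: measurable_indic.
- by apply: measurable_funM => //; apply: measurable_indic.
- by move=> x; rewrite mulr_ge0.
- by move=> x; rewrite mulr_ge0.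
Qed.

Lemma nint_setU A B u : measurable A -> measurable B ->
  measurable_fun setT u -> (forall x, 0 <= u x) -> A `&` B = set0 ->
  nint (A `|` B) u = (nint A u + nint B u)%E.
Proof.
move=> mA mB mfu u0 AB; rewrite /nint ge0_integral_setU //.
- by apply/measurable_EFinP; apply: measurable_funTS.
- by move=> x _; rewrite lee_fin.
- by apply/disj_setPS; rewrite AB.
Qed.

Lemma chebyshev A u (l : R) : measurable A -> measurable_fun setT u ->
  (forall x, 0 <= u x) -> 0 <= l ->
  (l%:E * mu (A `&` [set x | (l < u x)%R]) <= nint A u)%E.
Proof.
move=> mA mfu u0 l0; rewrite -nint_cst; last first.
  by apply: measurableI => //; exact: measurable_gt.
apply: nint_le => //= x [Ax lu]; split => //; exact: ltW.
Qed.

Lemma measurable_unions (I : eqType) (s : seq I) (F : I -> set T) :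
  (forall i, i \in s -> measurable (F i)) -> measurable (unions s F).
Proof.
elim: s => [|i s IH] mF; first by rewrite unions_nil.
rewrite unions_cons; apply: measurableU; first by apply: mF; rewrite mem_head.
by apply: IH => j js; apply: mF; rewrite in_cons js orbT.
Qed.

Lemma nint_unions_le (I : eqType) (s : seq I) (F : I -> set T) u :
  (forall i, i \in s -> measurable (F i)) -> measurable_fun setT u ->
  (forall x, 0 <= u x) ->
  (nint (unions s F) u <= \sum_(i <- s) nint (F i) u)%E.
Proof.
move=> + mfu u0; elim: s => [|i s IH] mF.
  by rewrite unions_nil big_nil /nint integral_set0.
rewrite unions_cons big_cons.
have mFs : forall j, j \in s -> measurable (F j).
  by move=> j js; apply: mF; rewrite in_cons js orbT.
apply: le_trans (leeD2l _ (IH mFs)); apply: nint_setU_le => //.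
- by apply: mF; rewrite mem_head.
- exact: measurable_unions.
Qed.

Lemma measure_unions_le (I : eqType) (s : seq I) (F : I -> set T) :
  (forall i, i \in s -> measurable (F i)) ->
  (mu (unions s F) <= \sum_(i <- s) mu (F i))%E.
Proof.
move=> mF; have := @nint_unions_le I s F (fun=> 1%R) mF.
rewrite nint_cst ?mul1e; last exact: measurable_unions.
have -> : (\sum_(i <- s) nint (F i) (fun=> 1%R) = \sum_(i <- s) mu (F i))%E.
  by rewrite !big_seq; apply: eq_bigr => i iS; rewrite nint_cst ?mul1e //; apply: mF.
by apply => //; exact: measurable_cst.
Qed.

Lemma nint_unions (I : eqType) (s : seq I) (F : I -> set T) u :
  (forall i, i \in s -> measurable (F i)) -> measurable_fun setT u ->
  (forall x, 0 <= u x) -> disjoint_family F s ->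
  (nint (unions s F) u = \sum_(i <- s) nint (F i) u)%E.
Proof.
move=> + mfu u0; elim: s => [|i s IH] mF.
  by rewrite unions_nil big_nil /nint integral_set0.
move=> /disjoint_familyP [dj dF]; rewrite unions_cons big_cons.
have mFs : forall j, j \in s -> measurable (F j).
  by move=> j js; apply: mF; rewrite in_cons js orbT.
rewrite nint_setU ?IH //.
- by apply: mF; rewrite mem_head.
- exact: measurable_unions.
Qed.

Lemma measure_unions (I : eqType) (s : seq I) (F : I -> set T) :
  (forall i, i \in s -> measurable (F i)) -> disjoint_family F s ->
  (mu (unions s F) = \sum_(i <- s) mu (F i))%E.
Proof.
move=> mF dj; have := @nint_unions I s F (fun=> 1%R) mF.
rewrite nint_cst ?mul1e; last exact: measurable_unions.
have -> : (\sum_(i <- s) nint (F i) (fun=> 1%R) = \sum_(i <- s) mu (F i))%E.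
  by rewrite !big_seq; apply: eq_bigr => i iS; rewrite nint_cst ?mul1e //; apply: mF.
by apply => //; exact: measurable_cst.
Qed.

Lemma nint_series A (u : nat -> T -> R) (v : T -> R) :
  measurable A -> (forall n, measurable_fun setT (u n)) ->
  (forall n x, 0 <= u n x) ->
  (forall x, A x -> ((v x)%:E <= \sum_(0 <= n <oo) (u n x)%:E)%E) ->
  measurable_fun setT v -> (forall x, 0 <= v x) ->
  (nint A v <= \sum_(0 <= n <oo) nint A (u n))%E.
Proof.
move=> mA mfu u0 vu mfv v0; rewrite /nint -integral_nneseries //; last 2 first.
- by move=> n; apply/measurable_EFinP; apply: measurable_funTS.
- by move=> n x _; rewrite lee_fin.
apply: ge0_le_integral => //.
- by move=> x _; rewrite lee_fin.
- by apply/measurable_EFinP; apply: measurable_funTS.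
- apply: ge0_emeasurable_sum => //.
  + by move=> n x _ _; rewrite lee_fin.
  + by move=> n _; apply/measurable_EFinP; apply: measurable_funTS.
Qed.

End NonnegativeIntegral.

Arguments nint {d T R} mu A%classic u%R.

(** * Geometric sequences of levels *)

Section Levels.
Context (R : realType).
Implicit Types (a p q s t x y : R).

Lemma le_powR_base p x y : 0 <= p -> 0 <= x -> x <= y -> x `^ p <= y `^ p.
Proof.
by move=> p0 x0 xy; apply: ge0_ler_powR => //; rewrite nnegrE // (le_trans x0).
Qed.

Lemma lt_powR_base p x y : 0 < p -> 0 <= x -> x < y -> x `^ p < y `^ p.
Proof.
move=> p0 x0 xy; apply: gt0_ltr_powR => //; rewrite nnegrE //.
exact/ltW/(le_lt_trans x0).
Qed.

Lemma powR_gt1 a p : 1 < a -> 0 < p -> 1 < a `^ p.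
Proof. by move=> a1 p0; have := lt_powR_base p0 ler01 a1; rewrite powR1. Qed.

Lemma powRV x p : 0 <= x -> x^-1 `^ p = (x `^ p)^-1.
Proof. by move=> x0; rewrite -powR_inv1 // powRAC powR_inv1 // powR_ge0. Qed.

Lemma powR_div x y p : 0 <= x -> 0 <= y -> (x / y) `^ p = x `^ p / y `^ p.
Proof. by move=> x0 y0; rewrite powRM ?invr_ge0 // powRV. Qed.

Lemma bernoulli_ineq a n : 1 <= a -> 1 + n%:R * (a - 1) <= a ^+ n.
Proof.
move=> a1; elim: n => [|n IH]; first by rewrite mul0r addr0 expr0.
rewrite exprS; have a0 : 0 <= a by lra.
apply: le_trans (ler_wpM2l a0 IH); rewrite -natr1.
have n0 : 0 <= n%:R :> R by []. 
have : 0 <= n%:R * (a - 1) ^+ 2 by rewrite mulr_ge0 ?sqr_ge0.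
nra.
Qed.

Lemma expr_unbounded a x : 1 < a -> exists n, x < a ^+ n.
Proof.
move=> a1; exists (Num.truncn (`|x| / (a - 1))).+1.
set n := (Num.truncn _).+1.
have hn : `|x| / (a - 1) < n%:R.
  have /andP[_ //] : (n.-1%:R <= `|x| / (a - 1) < n%:R).
  by rewrite /n; apply: truncn_itv; rewrite divr_ge0 // subr_ge0 ltW.
apply: lt_le_trans (bernoulli_ineq n (ltW a1)).
move: hn; rewrite ltr_pdivrMr ?subr_gt0 // => hn.
have := ler_norm x; lra.
Qed.

(** Levels decrease geometrically from the top level [s]. *)
Definition level s a n : R := s / a ^+ n.

Lemma level_gt0 s a n : 0 < s -> 1 < a -> 0 < level s a n.
Proof. by move=> s0 a1; rewrite divr_gt0 // exprn_gt0 //; lra. Qed.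

Lemma level0 s a : level s a 0 = s.
Proof. by rewrite /level expr0 divr1. Qed.

Lemma levelS s a n : level s a n.+1 = level (s / a) a n.
Proof. by rewrite /level exprS invfM mulrA. Qed.

Lemma levelSr s a n : 1 < a -> level s a n = a * level s a n.+1.
Proof.
move=> a1; rewrite /level exprS invfM mulrCA [a * _]mulrA divff ?mul1r //.
by rewrite gt_eqF //; lra.
Qed.

Lemma level_powR s a n p : 0 < s -> 1 < a ->
  level s a n `^ p = level (s `^ p) (a `^ p) n.
Proof.
move=> s0 a1; rewrite /level powR_div ?exprn_ge0 ?(ltW s0) //; last lra.
congr (_ * _); congr (_^-1); elim: n => [|n IH]; first by rewrite !expr0 powR1.
rewrite !exprS powRM ?IH //; first lra.
by rewrite exprn_ge0 //; lra.
Qed.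

(** The least [n] whose level is below [x] works: by minimality the previous level, which is [a]
    times this one, is at least [x]. For [n = 0] that is the hypothesis on [x]. *)
Lemma level_between s a x : 0 < s -> 1 < a -> 0 < x -> x <= a * s ->
  exists n, level s a n < x /\ x <= a * level s a n.
Proof.
move=> s0 a1 x0 xs; have ex : exists n, level s a n < x.
  have [n hn] := expr_unbounded (s / x) a1; exists n.
  rewrite /level ltr_pdivrMr ?exprn_gt0 //; last lra.
  by rewrite mulrC -ltr_pdivrMr.
case: (ex_minnP ex) => -[|n] hn hmin; first by exists 0%N; rewrite level0 in hn *.
exists n.+1; split => //; rewrite -levelSr //.
by rewrite leNgt; apply/negP => /hmin; rewrite ltnn.
Qed.

(* The terms with [level s a i >= x] vanish and the others decay geometrically. *)
Lemma sum_levels_below a q : 1 < a -> 0 < q -> exists2 C, 0 < C &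
  forall s x n, 0 < s -> 0 <= x ->
  \sum_(i < n) (level s a i) `^ q * (level s a i < x)%R%:R <= C * x `^ q.
Proof.
move=> a1 q0; pose r := a `^ q; have r1 : 1 < r by apply: powR_gt1.
pose C := r / (r - 1); have C0 : 0 < C by rewrite divr_gt0 //; lra.
have Ceq : C = 1 + C / r.
  by rewrite /C; field; apply/andP; split; rewrite gt_eqF //; lra.
exists C => // s x n s0 x0.
(* The minimum is what makes the induction close. Passing from [s] to [s / a] divides the bound by
   [r] when [s < x], and since [C = 1 + C / r] this pays for the new term. *)
suff : \sum_(i < n) (level s a i) `^ q * (level s a i < x)%R%:R <=
    C * (Num.min x s) `^ q.
  move=> /le_trans; apply; apply: ler_wpM2l; first exact: ltW.
  by apply: le_powR_base; [exact: ltW|rewrite le_min x0 ltW|rewrite ge_min lexx].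
elim: n s s0 => [|n IH] s s0.
  by rewrite big_ord0 mulr_ge0 ?powR_ge0 // ltW.
have sa0 : 0 < s / a by rewrite divr_gt0 //; lra.
rewrite big_ord_recl level0 (eq_bigr (fun i : 'I_n =>
  level (s / a) a i `^ q * (level (s / a) a i < x)%R%:R)); last first.
  by move=> i _; rewrite lift0 levelS.
have {}IH := IH _ sa0.
have sas : s / a <= s by rewrite ler_pdivrMr; [nra|lra].
have [sx|xs] := ltP s x.
- rewrite mulr1; move: IH; rewrite (min_idPr _); last by apply: le_trans sas _; exact: ltW.
  have -> : (s / a) `^ q = s `^ q / r.
    by rewrite powR_div //; lra.
  rewrite {2}Ceq; lra.
- rewrite mulr0 add0r; apply: le_trans IH _.
  apply: ler_wpM2l; first exact: ltW.
  apply: le_powR_base; [exact: ltW|by rewrite le_min x0 ltW|].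
  by rewrite ge_min lexx.
Qed.

(** With a negative exponent the terms grow with [i], until the levels drop below [x] and the terms
    vanish; the last nonzero one, at a level at least [x], dominates. *)
Lemma sum_levels_above a q : 1 < a -> 0 < q -> exists2 C, 0 < C &
  forall s x n, 0 < s -> 0 < x ->
  \sum_(i < n) (level s a i) `^ (- q) * (x <= level s a i)%R%:R <= C * x `^ (- q).
Proof.
move=> a1 q0; pose r := a `^ q; have r1 : 1 < r by apply: powR_gt1.
pose C := r / (r - 1); have C0 : 0 < C by rewrite divr_gt0 //; lra.
have Ceq : C = 1 + C / r.
  by rewrite /C; field; apply/andP; split; rewrite gt_eqF //; lra.
exists C => // s x n s0 x0.
pose L i := level s a i `^ q.
have L0 i : 0 < L i by rewrite powR_gt0 // level_gt0.
have LS i : L i = r * L i.+1.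
  by rewrite /L (levelSr _ _ a1) powRM ?ltW ?level_gt0 //; lra.
have X0 : 0 < x `^ q by rewrite powR_gt0.
(* The second bound, in terms of the next level, is the one that propagates while levels stay above
   [x]; the first is read off at the last such level. *)
suff [//] : \sum_(i < n) (level s a i) `^ (- q) * (x <= level s a i)%R%:R
     <= C * x `^ (- q) /\
  \sum_(i < n) (level s a i) `^ (- q) * (x <= level s a i)%R%:R <= C / r * (L n)^-1.
elim: n => [|n [IH1 IH2]].
  rewrite big_ord0 powRN !mulr_ge0 ?invr_ge0 ?(ltW C0) ?(ltW X0) ?(ltW (L0 _)) //; lra.
rewrite big_ord_recr /=.
have rL : r^-1 * (L n.+1)^-1 = (L n)^-1 by rewrite [in RHS]LS invfM.
have [xl|lx] := leP x (level s a n).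
- rewrite mulr1 -/(L n) powRN -/(L n).
  have key : \sum_(i < n) level s a i `^ (- q) * (x <= level s a i)%R%:R + (L n)^-1
     <= C * (L n)^-1.
    by rewrite [in X in _ <= X]Ceq mulrDl mul1r addrC lerD2l.
  split; last by rewrite -mulrA rL.
  apply: (le_trans key); apply: ler_wpM2l; first exact: ltW.
  rewrite powRN lef_pV2 ?posrE //.
  by apply: le_powR_base => //; exact: ltW.
- rewrite mulr0 addr0; split => //; apply: (le_trans IH2).
  have -> : C / r / L n.+1 = C / L n by rewrite -mulrA rL.
  have c1 : C / r <= C by lra.
  by apply: ler_wpM2r c1; rewrite invr_ge0 ltW.
Qed.

End Levels.

Lemma nneseries_le_bound (R : realType) (u : nat -> \bar R) (M : \bar R) :
  (forall n, (0 <= u n)%E) -> (forall n, (\sum_(0 <= i < n) u i <= M)%E) ->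
  (\sum_(0 <= n <oo) u n <= M)%E.
Proof.
move=> u0 uM; apply: lime_le; first exact: is_cvg_nneseries.
by apply: nearW => n; exact: uM.
Qed.

Lemma indic_bool (R : realType) (T : Type) (P : pred T) x :
  \1_[set x | P x] x = (P x)%:R :> R.
Proof. by rewrite indicE; congr (nat_of_bool _)%:R; apply/idP/idP; rewrite inE. Qed.

(** * Layer-cake sums *)

Section LayerSums.
Context d (T : measurableType d) (R : realType) (mu : {measure set T -> \bar R}).
Implicit Types (A : set T) (u v h : T -> R) (E : R -> set T).
Local Notation nint A u := (nint mu A%classic u%R).

Lemma nint_sum (I : Type) (r : seq I) (u : I -> T -> R) A : measurable A ->
  (forall i, measurable_fun setT (u i)) -> (forall i x, 0 <= u i x) ->
  nint A (fun x => \sum_(i <- r) u i x) = (\sum_(i <- r) nint A (u i))%E.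
Proof.
move=> mA mfu u0; elim: r => [|i r IH].
  by rewrite big_nil -[RHS](nint0 mu A); apply: eq_nint => x _; rewrite big_nil.
rewrite big_cons -IH -nintD //.
- by apply: eq_nint => x _; rewrite big_cons.
- exact: measurable_sum.
- by move=> x; apply: sumr_ge0.
Qed.

Lemma nint_series_le A (u : nat -> T -> R) v : measurable A ->
  (forall n, measurable_fun setT (u n)) -> (forall n x, 0 <= u n x) ->
  (forall n x, \sum_(i < n) u i x <= v x) ->
  (\sum_(0 <= n <oo) nint A (u n) <= nint A v)%E.
Proof.
move=> mA mfu u0 uv; apply: nneseries_le_bound => n; first exact: nint_ge0.
rewrite -nint_sum //; apply: nint_le_fun => x _; rewrite sumr_ge0 //=.
by rewrite big_mkord.
Qed.

Lemma nint_exhaust h u (M : \bar R) : measurable_fun setT h ->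
  measurable_fun setT u -> (forall x, 0 <= u x) ->
  (forall n, (nint [set x | (h x <= n%:R)%R] u <= M)%E) -> (nint setT u <= M)%E.
Proof.
move=> mh mfu u0 hM.
have -> : [set: T] = \bigcup_n [set x | h x <= n%:R].
  apply/seteqP; split => x // _; exists (Num.truncn `|h x|).+1 => //=.
  apply: le_trans (ler_norm _) _; apply: ltW.
  by have /andP[] := truncn_itv (normr_ge0 (h x)).
have cv : nint [set x | h x <= n%:R] u @[n --> \oo] -->
    nint (\bigcup_n [set x | h x <= n%:R]) u.
  apply: ge0_nondecreasing_set_cvg_integral.
  - move=> m n mn; apply/subsetPset => x /= /le_trans; apply.
    by rewrite ler_nat.
  - by move=> n; apply: measurable_le.
  - by move=> n; apply/measurable_EFinP; apply: measurable_funTS.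
  - by move=> n x _; rewrite lee_fin.
rewrite -(cvg_lim _ cv) //; apply: lime_le; first by apply/cvg_ex; eexists; exact: cv.
by apply: nearW => n.
Qed.

(* A discrete layer-cake sum: for decreasing [E] it is comparable to the integral
   of l ^ (p - 1) mu (E l) over 0 < l < s. *)
Definition layer a p s E : \bar R :=
  (\sum_(0 <= n <oo) (level s a n `^ p)%:E * mu (E (level s a n)))%E.

Lemma layer_ge0 a p s E : (0 <= layer a p s E)%E.
Proof.
by apply: nneseries_ge0 => n _ _; rewrite mule_ge0 // lee_fin powR_ge0.
Qed.

(** Pointwise, [h x] exceeds some level [l] and is at most [a * l], so the single term of that
    level, times [a ^ p], already dominates [h x ^ p]. This requires [h x] below the top of the
    sequence, hence the restriction to [h <= n] and the passage to the limit by [nint_exhaust]. *)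
Lemma nint_powR_le_layer a p h (M : \bar R) : 1 < a -> 0 < p ->
  measurable_fun setT h -> (forall x, 0 <= h x) ->
  (forall s, 0 < s -> (layer a p s (fun l => [set x | (l < h x)%R]) <= M)%E) ->
  (nint setT (fun x => h x `^ p) <= (a `^ p)%:E * M)%E.
Proof.
move=> a1 p0 mh h0 hM.
have mhp : measurable_fun setT (fun x => h x `^ p).
  by apply: (measurableT_comp (measurable_powR p)).
apply: (nint_exhaust mh) => // [x|n]; first exact: powR_ge0.
pose s := n.+1%:R : R; have s0 : 0 < s by rewrite ltr0n.
pose L i := [set x | level s a i < h x].
have mL i : measurable (L i) by apply: measurable_gt.
pose u i x := a `^ p * (level s a i `^ p * \1_(L i) x) : R.
have u0 i x : 0 <= u i x by rewrite !mulr_ge0 ?powR_ge0.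
have mfu i : measurable_fun setT (u i).
  by do 2!apply: measurable_funM => //; apply: measurable_indic.
have le1 : (nint [set x | (h x <= n%:R)%R] (fun x => h x `^ p) <=
    \sum_(0 <= i <oo) nint [set x | (h x <= n%:R)%R] (u i))%E.
  apply: nint_series => // [|x /= hn|x]; last exact: powR_ge0.
  - exact: measurable_le.
  have [hx0|hx0] := eqVneq (h x) 0.
    rewrite hx0 powR0 ?gt_eqF //; apply: nneseries_ge0 => i _ _.
    by rewrite lee_fin.
  have hgt : 0 < h x by rewrite lt_neqAle eq_sym hx0 h0.
  have hs : h x <= a * s.
    apply: (le_trans hn); apply: (@le_trans _ _ s); first by rewrite ler_nat.
    by rewrite ler_peMl ?ltW.
  have [k [k1 k2]] := level_between s0 a1 hgt hs.
  have := @nneseries_lim_ge R (fun i => (u i x)%:E) xpredT 0 k.+1.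
  move=> /(_ (fun i _ _ => _)) H; apply: le_trans (H _); last by move=> i; rewrite lee_fin.
  rewrite big_nat_recr //=; apply: le_trans (_ : ((u k x)%:E <= _)%E); last first.
    by apply: leeDr; apply: sume_ge0 => i _; rewrite lee_fin.
  have a0 : 0 <= a by lra.
  rewrite lee_fin /u indicE mem_set // mulr1 -powRM //; last exact/ltW/level_gt0.
  by apply: le_powR_base => //; exact: ltW.
apply: (le_trans le1); apply: le_trans (lee_wpmul2l _ (hM s s0)); last first.
  by rewrite lee_fin powR_ge0.
rewrite /layer -nneseriesZl; last by move=> i _; rewrite mule_ge0 // lee_fin powR_ge0.
apply: lee_nneseries => i _; first by move=> _; exact: nint_ge0.
apply: (@le_trans _ _ (nint setT (u i))); first exact: nint_le_set.
rewrite nintZ //; last 3 first.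
- by apply: measurable_funM => //; apply: measurable_indic.
- by move=> x; rewrite mulr_ge0 ?powR_ge0.
- exact: powR_ge0.
by rewrite nint_indic setTI nint_cst.
Qed.

(** Exchange sum and integral: at a point, the levels below [u x] contribute [u x] times a sum of
    [l ^ (p - 1)], which is comparable to [u x ^ (p - 1)]. *)
Lemma layer_sum_above a p : 1 < a -> 1 < p -> exists2 C : R, 0 < C &
  forall u s, 0 < s -> measurable_fun setT u -> (forall x, 0 <= u x) ->
  (\sum_(0 <= n <oo) (level s a n `^ (p - 1))%:E *
     nint [set x | (level s a n < u x)%R] u <=
   C%:E * nint setT (fun x => u x `^ p))%E.
Proof.
move=> a1 p1; have q0 : 0 < p - 1 by lra.
have [C C0 HC] := sum_levels_below a1 q0; exists C => // u s s0 mfu u0.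
have mup : measurable_fun setT (fun x => u x `^ p).
  by apply: (measurableT_comp (measurable_powR p)).
rewrite -nintZ // => [|x|]; [|exact: powR_ge0|exact: ltW].
pose w n x := level s a n `^ (p - 1) * (u x * \1_[set x | level s a n < u x] x).
have mL n : measurable [set x | level s a n < u x] by exact: measurable_gt.
rewrite (eq_eseriesr (g := fun n => nint setT (w n))); last first.
  move=> n _; rewrite nintZ ?nint_indic ?setTI //.
  - by apply: measurable_funM => //; apply: measurable_indic.
  - by move=> x; rewrite mulr_ge0.
  - exact: powR_ge0.
apply: nint_series_le => // [n|n x|n x].
- by do 2!apply: measurable_funM => //; apply: measurable_indic.
- by rewrite !mulr_ge0 // powR_ge0.
- rewrite -[in leRHS](mulr_powRB1 (u0 x)); last lra.
  rewrite mulrCA; apply: le_trans (ler_wpM2l (u0 x) (HC s (u x) n s0 (u0 x))).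
  rewrite mulr_sumr; apply: ler_sum => i _; rewrite /w mulrCA.
  apply: ler_wpM2l => //; apply: ler_wpM2l; first exact: powR_ge0.
  by rewrite indic_bool.
Qed.

(** The companion exchange: the sum of [l ^ (p - 2)] over levels at least [u x] is comparable to
    [u x ^ (p - 2)], because the exponent is negative. *)
Lemma layer_sum_below a p : 1 < a -> 0 < p < 2 -> exists2 C : R, 0 < C &
  forall u s, 0 < s -> measurable_fun setT u -> (forall x, 0 <= u x) ->
  (\sum_(0 <= n <oo) (level s a n `^ (p - 2))%:E *
     nint [set x | (u x <= level s a n)%R] (fun x => u x ^+ 2) <=
   C%:E * nint setT (fun x => u x `^ p))%E.
Proof.
move=> a1 /andP[p0 p2]; have q0 : 0 < 2 - p by lra.
have [C C0 HC] := sum_levels_above a1 q0; exists C => // u s s0 mfu u0.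
have mup : measurable_fun setT (fun x => u x `^ p).
  by apply: (measurableT_comp (measurable_powR p)).
rewrite -nintZ // => [|x|]; [|exact: powR_ge0|exact: ltW].
pose w n x := level s a n `^ (p - 2) * (u x ^+ 2 * \1_[set x | u x <= level s a n] x).
have mL n : measurable [set x | u x <= level s a n] by exact: measurable_le.
have mu2 : measurable_fun setT (fun x => u x ^+ 2) by apply: measurable_funX.
rewrite (eq_eseriesr (g := fun n => nint setT (w n))); last first.
  move=> n _; rewrite nintZ ?nint_indic ?setTI //.
  - by apply: measurable_funM => //; apply: measurable_indic.
  - by move=> x; rewrite mulr_ge0 // sqr_ge0.
  - exact: powR_ge0.
apply: nint_series_le => // [n|n x|n x].
- by do 2!apply: measurable_funM => //; apply: measurable_indic.
- by rewrite !mulr_ge0 // ?powR_ge0 ?sqr_ge0.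
- have [ux0|ux0] := eqVneq (u x) 0.
    rewrite ux0 powR0 ?gt_eqF // mulr0 big1 // => i _.
    by rewrite /w ux0 expr0n mul0r mulr0.
  have up : 0 < u x by rewrite lt_neqAle eq_sym ux0 u0.
  have -> : u x `^ p = u x ^+ 2 * u x `^ (- (2 - p)).
    rewrite -powR_mulrn // -powRD; first by congr (_ `^ _); lra.
    by rewrite ux0 implybT.
  rewrite mulrCA; apply: le_trans (ler_wpM2l (sqr_ge0 _) (HC s (u x) n s0 up)).
  rewrite mulr_sumr; apply: ler_sum => i _; rewrite /w mulrCA opprB.
  apply: ler_wpM2l; first exact: sqr_ge0.
  apply: ler_wpM2l; first exact: powR_ge0.
  by rewrite indic_bool.
Qed.

End LayerSums.

(** * Interpolation and good-lambda inequalities for layer sums *)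

Section LayerInequalities.
Context d (T : measurableType d) (R : realType) (mu : {measure set T -> \bar R}).
Implicit Types (A : set T) (u v h : T -> R) (E : R -> set T).
Local Notation nint A u := (nint mu A%classic u%R).
Local Notation layer := (layer mu).

(** Interpolation between weak types (1,1) and (2,2). The hypothesis is what these give after
    splitting [u] at height [l], so no operator occurs in the statement. *)
Lemma marcinkiewicz (a p C1 C2 : R) : 1 < a -> 1 < p < 2 -> 0 <= C1 -> 0 <= C2 ->
  exists2 C : R, 0 < C & forall E u s, 0 < s -> measurable_fun setT u ->
  (forall x, 0 <= u x) ->
  (forall l : R, 0 < l -> (mu (E l) <= (C1 / l)%:E * nint (above u l) u +
     (C2 / l ^+ 2)%:E * nint (below u l) (fun x => u x ^+ 2))%E) ->
  (layer a p s E <= C%:E * nint setT (fun x => u x `^ p))%E.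
Proof.
move=> a1 /andP[p1 p2] C10 C20.
have [D1 D10 H1] := layer_sum_above mu a1 p1.
have [|D2 D20 H2] := @layer_sum_below _ _ _ mu a p a1; first by apply/andP; split; lra.
exists (C1 * D1 + C2 * D2 + 1) => [|E u s s0 mfu u0 HE].
  by have := mulr_ge0 C10 (ltW D10); have := mulr_ge0 C20 (ltW D20); lra.
set U := nint setT _; have U0 : (0 <= U)%E by apply: nint_ge0 => x _; exact: powR_ge0.
apply: (@le_trans _ _ (C1%:E * (D1%:E * U) + C2%:E * (D2%:E * U))%E); last first.
  rewrite !muleA -!EFinM -ge0_muleDl ?lee_fin ?mulr_ge0 ?(ltW D10) ?(ltW D20) //.
  by rewrite -EFinD; apply: lee_wpmul2r => //; rewrite lee_fin; lra.
have I1 n : (0 <= nint [set x | (level s a n < u x)%R] u)%E by exact: nint_ge0.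
have I2 n : (0 <= nint [set x | (u x <= level s a n)%R] (fun x => u x ^+ 2))%E.
  by apply: nint_ge0 => x _; exact: sqr_ge0.
apply: le_trans (leeD (lee_wpmul2l _ (H1 u s s0 mfu u0))
  (lee_wpmul2l _ (H2 u s s0 mfu u0))); [|by rewrite lee_fin..].
rewrite -nneseriesZl; last by move=> n _; rewrite mule_ge0 // lee_fin powR_ge0.
rewrite -nneseriesZl; last by move=> n _; rewrite mule_ge0 // lee_fin powR_ge0.
rewrite -nneseriesD; last 2 first.
- by move=> n _ _; rewrite !mule_ge0 // lee_fin // powR_ge0.
- by move=> n _ _; rewrite !mule_ge0 // lee_fin // powR_ge0.
apply: lee_nneseries => n; first by move=> *; rewrite mule_ge0 // lee_fin powR_ge0.
move=> _; have := I1 n; have := I2 n; have := level_gt0 n s0 a1.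
move: (level s a n) => L L0 {}I2 {}I1.
have LN : L != 0 by rewrite gt_eqF.
apply: le_trans (lee_wpmul2l _ (HE _ L0)) _; first by rewrite lee_fin powR_ge0.
rewrite ge0_muleDr ?mule_ge0 ?lee_fin ?divr_ge0 ?sqr_ge0 ?(ltW L0) //.
rewrite !muleA -!EFinM powRB ?LN ?implybT // powRB ?LN ?implybT //.
rewrite powRr1 ?(ltW L0) // powR_mulrn ?(ltW L0) //.
by rewrite !mulrA ![_ `^ _ * _]mulrC.
Qed.

(** Interpolation between weak type (1,1) and the trivial bound at infinity. Replacing the levels by
    their halves costs the factor [2 ^ (p - 1)]. *)
Lemma marcinkiewicz_weak1 (a p C1 : R) : 1 < a -> 1 < p -> 0 <= C1 ->
  exists2 C : R, 0 < C & forall E u s, 0 < s -> measurable_fun setT u ->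
  (forall x, 0 <= u x) ->
  (forall l : R, 0 < l -> (mu (E l) <= (C1 / l)%:E * nint (above u (l / 2)) u)%E) ->
  (layer a p s E <= C%:E * nint setT (fun x => u x `^ p))%E.
Proof.
move=> a1 p1 C10; have [D1 D10 H1] := layer_sum_above mu a1 p1.
exists (C1 * (2 `^ (p - 1) * D1) + 1) => [|E u s s0 mfu u0 HE].
  by have := mulr_ge0 C10 (mulr_ge0 (powR_ge0 2 (p - 1)) (ltW D10)); lra.
set U := nint setT _; have U0 : (0 <= U)%E by apply: nint_ge0 => x _; exact: powR_ge0.
apply: (@le_trans _ _ (C1%:E * ((2 `^ (p - 1))%:E * (D1%:E * U)))%E); last first.
  by rewrite !muleA -!EFinM; apply: lee_wpmul2r => //; rewrite lee_fin mulrA; lra.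
have s20 : 0 < s / 2 by lra.
have I1 n : (0 <= nint [set x | (level (s / 2) a n < u x)%R] u)%E by exact: nint_ge0.
apply: le_trans (lee_wpmul2l _ (lee_wpmul2l _ (H1 u _ s20 mfu u0)));
  [|by rewrite lee_fin ?powR_ge0..].
rewrite -nneseriesZl; last by move=> n _; rewrite mule_ge0 // lee_fin powR_ge0.
rewrite -nneseriesZl; last by move=> n _; rewrite !mule_ge0 // lee_fin powR_ge0.
apply: lee_nneseries => n; first by move=> *; rewrite mule_ge0 // lee_fin powR_ge0.
move=> _; have L0 := level_gt0 n s0 a1.
have -> : level (s / 2) a n = level s a n / 2 by rewrite /level mulrAC.
move: (level s a n) L0 => L L0; have LN : L != 0 by rewrite gt_eqF.
apply: le_trans (lee_wpmul2l _ (HE _ L0)) _; first by rewrite lee_fin powR_ge0.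
rewrite !muleA -!EFinM; apply: lee_wpmul2r; first exact: nint_ge0.
rewrite lee_fin -mulrA -powRM //; last by lra.
rewrite [2 * _]mulrC divfK // powRB ?LN ?implybT // powRr1 ?(ltW L0) //.
by rewrite mulrCA.
Qed.

Lemma layer_le (a p s : R) E E' : (forall l : R, 0 < l -> (mu (E l) <= mu (E' l))%E) ->
  0 < s -> 1 < a -> (layer a p s E <= layer a p s E')%E.
Proof.
move=> EE s0 a1; apply: lee_nneseries => n.
  by move=> *; rewrite mule_ge0 // lee_fin powR_ge0.
move=> _; apply: lee_wpmul2l; first by rewrite lee_fin powR_ge0.
exact/EE/level_gt0.
Qed.

Lemma layerU (a p s : R) E E1 E2 :
  (forall l : R, 0 < l -> (mu (E l) <= mu (E1 l) + mu (E2 l))%E) ->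
  0 < s -> 1 < a -> (layer a p s E <= layer a p s E1 + layer a p s E2)%E.
Proof.
move=> EE s0 a1; rewrite /layer -nneseriesD; last 2 first.
- by move=> *; rewrite mule_ge0 // lee_fin powR_ge0.
- by move=> *; rewrite mule_ge0 // lee_fin powR_ge0.
apply: lee_nneseries => n.
  by move=> *; rewrite mule_ge0 // lee_fin powR_ge0.
move=> _; rewrite -ge0_muleDr //; apply: lee_wpmul2l; first by rewrite lee_fin powR_ge0.
exact/EE/level_gt0.
Qed.

(** All levels are at most [s]. The constant depends on [s], which is harmless: the lemma serves
    only to deduce finiteness at exponent [p] from finiteness at [p0]. *)
Lemma layer_exponent (a p p0 s : R) E : 0 < s -> 1 < a -> p0 <= p ->
  (layer a p s E <= (s `^ (p - p0))%:E * layer a p0 s E)%E.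
Proof.
move=> s0 a1 pp; rewrite /layer -nneseriesZl; last first.
  by move=> *; rewrite mule_ge0 // lee_fin powR_ge0.
apply: lee_nneseries => n.
  by move=> *; rewrite mule_ge0 // lee_fin powR_ge0.
move=> _; rewrite muleA -EFinM; apply: lee_wpmul2r => //.
have L0 := level_gt0 n s0 a1; rewrite lee_fin.
have -> : level s a n `^ p = level s a n `^ (p - p0) * level s a n `^ p0.
  by rewrite -powRD ?(gt_eqF L0) ?implybT //; congr (_ `^ _); lra.
apply: ler_wpM2r; first exact: powR_ge0.
apply: le_powR_base; [lra|exact: ltW|].
have a0 : 0 < a by lra.
rewrite /level ler_pdivrMr ?exprn_gt0 //.
by rewrite ler_peMr ?(ltW s0) // exprn_ege1 // ltW.
Qed.

Lemma layer_rescale (a p q g s : R) E : 0 < s -> 1 < a -> 0 < q -> 0 < g ->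
  (layer a p s (fun l => E ((g * l) `^ q)%R) =
   (g `^ (- p))%:E * layer (a `^ q) (p / q) ((g * s) `^ q) E)%E.
Proof.
move=> s0 a1 q0 g0; rewrite /layer -nneseriesZl; last first.
  by move=> *; rewrite mule_ge0 // lee_fin powR_ge0.
apply: eq_eseriesr => n _.
have L0 := level_gt0 n s0 a1.
rewrite -level_powR //; last exact: mulr_gt0.
have -> : level (g * s) a n = g * level s a n by rewrite /level mulrA.
rewrite muleA -EFinM; congr (_%:E * _)%E.
rewrite -powRrM (_ : q * (p / q) = p); last by field; rewrite gt_eqF.
rewrite powRM ?(ltW g0) ?(ltW L0) // mulrA -powRD ?addNr ?powRr0 ?mul1r //.
by rewrite (gt_eqF g0) implybT.
Qed.

(* The hypothesis costs one level, i.e. a factor [a `^ p], which [eta] absorbs;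
   finiteness of the left-hand side allows the absorption. *)
Lemma good_lambda (a p eta s : R) E E' : 1 < a -> 0 < p -> 0 < s -> 0 <= eta ->
  eta * a `^ p <= 2^-1 ->
  (forall l : R, 0 < l -> (mu (E (a * l)%R) <= eta%:E * mu (E l) + mu (E' l))%E) ->
  (layer a p s E < +oo)%E ->
  (layer a p s E <= (2 * a `^ p)%:E * layer a p s E')%E.
Proof.
move=> a1 p0 s0 eta0 etaap HE fin.
have shift F : ((a `^ p)%:E * \sum_(0 <= n <oo)
    ((level s a n.+1 `^ p)%:E * mu (F (level s a n.+1))) <=
    (a `^ p)%:E * layer a p s F)%E.
  apply: lee_wpmul2l; first by rewrite lee_fin powR_ge0.
  have f0 n : (0 <= (level s a n `^ p)%:E * mu (F (level s a n)))%E.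
    by rewrite mule_ge0 // lee_fin powR_ge0.
  rewrite /layer [leRHS]nneseries_recl //.
  have := @nneseries_addn R (fun n => (level s a n `^ p)%:E * mu (F (level s a n)))%E 1 f0.
  under eq_eseriesr do rewrite addn1.
  by move=> e; rewrite [leLHS]e leeDr.
have main : (layer a p s E <= (2^-1)%:E * layer a p s E + (a `^ p)%:E * layer a p s E')%E.
  have step : (layer a p s E <= eta%:E * ((a `^ p)%:E * layer a p s E) +
      (a `^ p)%:E * layer a p s E')%E.
    apply: le_trans (leeD (lee_wpmul2l _ (shift E)) (shift E')); last by rewrite lee_fin.
    have f0 F n : (0 <= (level s a n.+1 `^ p)%:E * mu (F (level s a n.+1)))%E.
      by rewrite mule_ge0 // lee_fin powR_ge0.
    rewrite -!nneseriesZl //; last by move=> *; rewrite mule_ge0 // lee_fin powR_ge0.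
    rewrite -nneseriesD; last 2 first.
    - by move=> *; rewrite !mule_ge0 // ?lee_fin ?powR_ge0.
    - by move=> *; rewrite !mule_ge0 // ?lee_fin ?powR_ge0.
    apply: lee_nneseries => n; first by move=> *; rewrite mule_ge0 // lee_fin powR_ge0.
    move=> _; have L1 := level_gt0 n.+1 s0 a1.
    rewrite [in leLHS](levelSr s n a1); move: (level s a n.+1) L1 => L L1.
    apply: le_trans (lee_wpmul2l _ (HE _ L1)) _; first by rewrite lee_fin powR_ge0.
    rewrite ge0_muleDr ?mule_ge0 ?lee_fin // powRM ?(ltW L1) //; last lra.
    rewrite !muleA -!EFinM.
    by rewrite (_ : a `^ p * L `^ p * eta = eta * a `^ p * L `^ p) // mulrC mulrA.
  apply: (le_trans step); apply: leeD => //; rewrite muleA -EFinM.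
  by apply: lee_wpmul2r; [exact: layer_ge0|rewrite lee_fin].
move: main fin; have := layer_ge0 mu a p s E; have := layer_ge0 mu a p s E'.
case: (layer a p s E) => [x| |] //; case: (layer a p s E') => [y| |] //; last first.
  move=> _ _ _ _; have ap : 0 < a `^ p by apply: powR_gt0; lra.
  by rewrite gt0_muley ?leey // lte_fin mulr_gt0.
rewrite -?EFinM -?EFinD ?lee_fin => y0 x0 h _; rewrite -mulrA.
by move: h; set z := _ * y; lra.
Qed.

End LayerInequalities.

(** * Coverings and the maximal function *)

(** Pointwise [v <= D + D ^ (1 - q) * v ^ q], by comparing [v] with [D]. If the mean of [v ^ q] on
    [A] is at most [D ^ q], the mean of [v] is at most [2 * D]: Hölder's inequality up to a
    factor. *)
Lemma nint_powR_lty_above d (T : measurableType d) (R : realType)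
    (mu : {measure set T -> \bar R}) A (D q : R) (v : T -> R) :
  0 < D -> 1 <= q -> measurable A -> measurable_fun setT v ->
  (forall x, 0 <= v x) ->
  (nint mu A v <= D%:E * mu A + (D `^ (1 - q))%:E * nint mu A (fun x => v x `^ q)%R)%E.
Proof.
move=> D0 q1 mA mv v0.
have mvq : measurable_fun setT (fun x => v x `^ q).
  by apply: (measurableT_comp (measurable_powR q)).
rewrite -nint_cst // -nintZ //; [|by move=> x; exact: powR_ge0|exact: powR_ge0].
rewrite -nintD //; last 3 first.
- by apply: measurable_funM.
- by move=> x; exact: ltW.
- by move=> x; rewrite mulr_ge0 ?powR_ge0.
apply: nint_le_fun => x _; rewrite v0 /=.
have [vD|vD] := leP (v x) D.
  by apply: (le_trans vD); rewrite lerDl mulr_ge0 ?powR_ge0.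
have v_gt0 : 0 < v x by apply: lt_trans vD.
apply: (@le_trans _ _ (D `^ (1 - q) * v x `^ q)); last by rewrite lerDr ltW.
have -> : v x `^ q = v x `^ (q - 1) * v x.
  by rewrite mulrC mulr_powRB1 //; lra.
rewrite mulrA -[leLHS]mul1r; apply: ler_wpM2r => //.
rewrite -[leLHS](powRr0 D) -[X in _ <= X](mulrC) -[1 - q]opprB.
rewrite powRN powRr0 mulrC ler_pdivlMl ?powR_gt0 // mulr1.
by apply: le_powR_base; [lra|exact: ltW|exact: ltW].
Qed.

Section HomogeneousBasics.
Context (R : realType) (X : ptopologicalType).
Context (mu : {measure set (borel X) -> \bar R}) (B : X -> R -> set X) (c K : R).
Hypothesis hX : homogeneous_type mu B c K.
Local Notation nint A u := (nint mu A%classic u%R).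

Lemma c_gt0 : 0 < c. Proof. exact: lt_trans (hom_c hX). Qed.
Lemma K_gt0 : 0 < K. Proof. exact: lt_trans (hom_K hX). Qed.
Lemma c_ge1 : 1 <= c. Proof. exact: ltW (hom_c hX). Qed.

Lemma open_measurable_borel (A : set X) : open A -> measurable (A : set (borel X)).
Proof. by move=> oA; apply: sub_sigma_algebra. Qed.

Lemma compact_measurable_borel (A : set X) :
  compact A -> measurable (A : set (borel X)).
Proof.
move=> /(compact_closed (hom_hausdorff hX)) cA; rewrite -(setCK A).
by apply: measurableC; apply: open_measurable_borel; apply: closed_openC.
Qed.

Lemma open_ball y r : 0 < r -> open (B y r).
Proof. by move=> r0; have [+ _] := hom_basis hX; apply; exists y, r. Qed.

Lemma measurable_qball y r : 0 < r -> measurable (B y r : set (borel X)).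
Proof. by move=> r0; apply: open_measurable_borel; exact: open_ball. Qed.
Hint Extern 0 (measurable (B _ _)) => (exact: measurable_qball) : core.

Definition vol y r := fine (mu (B y r)).

Lemma volE y r : 0 < r -> mu (B y r) = (vol y r)%:E.
Proof.
move=> r0; rewrite fineK //; have /andP[m0 m1] := hom_pos_fin hX y r0.
by rewrite ge0_fin_numE // ltW.
Qed.

Lemma vol_gt0 y r : 0 < r -> 0 < vol y r.
Proof. by move=> r0; rewrite -lte_fin -volE //; case/andP: (hom_pos_fin hX y r0). Qed.

Lemma vol_ge0 y r : 0 < r -> 0 <= vol y r.
Proof. by move=> r0; apply/ltW/vol_gt0. Qed.

Lemma vol_doubling y r : 0 < r -> vol y (c * r) <= K * vol y r.
Proof.
move=> r0; have := hom_doubling hX y r0; rewrite !volE // ?mulr_gt0 ?c_gt0 //.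
Qed.

Lemma le_vol y r z s : 0 < r -> 0 < s -> B y r `<=` B z s -> vol y r <= vol z s.
Proof.
move=> r0 s0 h; rewrite -lee_fin -!volE //.
by apply: le_measure => //; rewrite inE; exact: measurable_qball.
Qed.

Lemma vol_dil n y r : 0 < r -> vol y (c ^+ n * r) <= K ^+ n * vol y r.
Proof.
move=> r0; elim: n => [|n IH]; first by rewrite !expr0 !mul1r.
rewrite !exprS -!mulrA; apply: le_trans (vol_doubling _ _) _.
  by rewrite mulr_gt0 // exprn_gt0 // c_gt0.
by apply: ler_wpM2l => //; exact/ltW/K_gt0.
Qed.

Lemma subset_dil y r : 0 < r -> B y r `<=` B y (c * r).
Proof. by move=> r0; apply: (hom_nested hX) => //; rewrite ler_peMl ?c_ge1 // ltW. Qed.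

(** Reduces a bound on a measure to compact subsets, where coverings by balls can be made finite. *)
Lemma inner_regular (A : set X) (M : \bar R) : measurable (A : set (borel X)) ->
  (forall C, compact C -> C `<=` A -> (mu C <= M)%E) -> (mu A <= M)%E.
Proof.
move=> mA H; have [_ ->] := hom_regular hX mA; apply: ge_ereal_sup.
by move=> _ [C [cC CA] <-]; exact: H.
Qed.

Let bl (i : X * R) := B i.1 i.2.

Lemma exists_max_radius (s : seq (X * R)) : s != [::] ->
  exists2 i, i \in s & forall j, j \in s -> j.2 <= i.2.
Proof.
elim: s => // i [|j s] IH _.
  by exists i; [rewrite mem_head|move=> j; rewrite inE => /eqP ->].
have [//|k ks kmax] := IH.
have [ik|ki] := leP i.2 k.2.
  exists k; first by rewrite in_cons ks orbT.
  by move=> l; rewrite in_cons => /predU1P[->//|]; exact: kmax.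
exists i; first by rewrite mem_head.
move=> l; rewrite in_cons => /predU1P[->//|/kmax/le_trans]; apply.
exact: ltW.
Qed.

(** Greedy selection: keep a ball of largest radius, discard every ball meeting it, and recurse. By
    engulfing, the discarded balls lie in the [c]-dilate of the one kept. *)
Lemma vitali (s : seq (X * R)) : (forall i, i \in s -> 0 < i.2) ->
  exists t : seq (X * R), [/\ {subset t <= s}, disjoint_family bl t &
    forall i, i \in s -> exists2 j, j \in t & bl i `<=` B j.1 (c * j.2)].
Proof.
have [n] := ubnP (size s); elim: n s => // n IH s /ltnSE sn s0.
have [->|sN] := eqVneq s [::]; first by exists [::].
have [j js jmax] := exists_max_radius sN.
pose s1 := [seq i <- s | `[< bl j `&` bl i = set0 >]].
have jj : bl j j.1 by apply: (hom_center hX); exact: s0.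
have s1s : {subset s1 <= s} by move=> i; rewrite mem_filter => /andP[].
have s1n : (size s1 < n)%N.
  apply: leq_trans sn; rewrite size_filter -(count_predC (fun i => `[< bl j `&` bl i = set0 >])).
  rewrite -[ltnLHS]addn0 ltn_add2l -has_count; apply/hasP; exists j => //=.
  by apply/asboolP => h; have : set0 j.1 by rewrite -h.
have [|t [ts dt tc]] := IH s1 s1n; first by move=> i /s1s; exact: s0.
exists (j :: t); split.
- by move=> i; rewrite in_cons => /predU1P[->//|/ts/s1s].
- rewrite /disjoint_family pairwise_cons; apply/andP; split => //; apply/allP => i /ts.
  by rewrite mem_filter => /andP[].
- move=> i iS; have [/asboolP e|/asboolP e] := boolP `[< bl j `&` bl i = set0 >].
    have [|k kt ki] := tc i; first by rewrite mem_filter iS andbT; apply/asboolP.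
    by exists k => //; rewrite in_cons kt orbT.
  exists j; first by rewrite mem_head.
  apply: (hom_engulfing hX); [exact: s0|exact: s0|exact: jmax|].
  exact/set0P/eqP.
Qed.

Lemma vitali_cover (C : set X) (P : X -> R -> Prop) : compact C ->
  (forall x, C x -> exists y r, [/\ 0 < r, B y r x & P y r]) ->
  exists s : seq (X * R),
    [/\ forall i, i \in s -> 0 < i.2 /\ P i.1 i.2,
        disjoint_family bl s & C `<=` unions s (fun i => B i.1 (c * i.2))].
Proof.
move=> cC HP; have := cC; rewrite compact_cover.
move=> /(_ _ [set i : X * R | 0 < i.2 /\ P i.1 i.2] bl).
case=> [i [i0 _]|x /HP [y [r [r0 Bx Pyr]]]|D Dsub Dcov].
- exact: open_ball.
- by exists (y, r).
have D0 i : i \in finmap.enum_fset D -> 0 < i.2 by move=> /Dsub; rewrite inE => -[].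
have [t [tD dt tcov]] := vitali D0.
exists t; split => // [i /tD /Dsub|x /Dcov [i /= iD Bx]]; first by rewrite inE.
by have [j jt ij] := tcov i iD; exists j => //; exact: ij.
Qed.

Lemma measure_unions_dil n (s : seq (X * R)) : (forall i, i \in s -> 0 < i.2) ->
  (mu (unions s (fun i => B i.1 (c ^+ n * i.2))) <=
   (K ^+ n)%:E * \sum_(i <- s) mu (bl i))%E.
Proof.
move=> s0; apply: le_trans (measure_unions_le _ _) _.
  by move=> i /s0 i0; apply: measurable_qball; rewrite mulr_gt0 // exprn_gt0 // c_gt0.
rewrite ge0_sume_distrr; last by move=> i _; exact: measure_ge0.
rewrite !big_seq; apply: lee_sum => i iS; have i0 := s0 _ iS.
rewrite /bl !volE // ?mulr_gt0 // ?exprn_gt0 ?c_gt0 //.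
by rewrite -EFinM lee_fin vol_dil.
Qed.

(** The balls are not centred at [x], which makes this set a union of balls, hence open and
    measurable. *)
Definition Omega (u : X -> R) (l : R) : set X :=
  [set x | exists y r, [/\ 0 < r, B y r x & (l%:E * mu (B y r) < nint (B y r) u)%E]].

Lemma open_Omega u l : open (Omega u l).
Proof.
have -> : Omega u l = \bigcup_(i in [set i : X * R |
    0 < i.2 /\ (l%:E * mu (bl i) < nint (bl i) u)%E]) bl i.
  apply/seteqP; split => x /=.
    by move=> [y [r [r0 Bx h]]]; exists (y, r); [split|exact: Bx].
  by move=> [[y r] /= [r0 h] Bx]; exists y, r.
by apply: bigcup_open => i [i0 _]; exact: open_ball.
Qed.

Lemma measurable_Omega u l : measurable (Omega u l : set (borel X)).
Proof. by apply: open_measurable_borel; exact: open_Omega. Qed.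

Lemma sub_Omega u l l' : l <= l' -> Omega u l' `<=` Omega u l.
Proof.
move=> ll x [y [r [r0 Bx h]]]; exists y, r; split => //.
by apply: le_lt_trans h; apply: lee_wpmul2r => //; rewrite lee_fin.
Qed.

(** On a compact subset choose disjoint balls of mean above [l] whose [c]-dilates cover it: doubling
    costs [K], and the integrals over disjoint balls add up. *)
Lemma weak11 u l : measurable_fun setT (u : borel X -> R) ->
  (forall x, 0 <= u x) -> 0 < l ->
  (mu (Omega u l) <= (K / l)%:E * nint setT u)%E.
Proof.
move=> mfu u0 l0; apply: inner_regular; first exact: measurable_Omega.
move=> C cC CO; have [s [sP ds Cs]] := vitali_cover cC CO.
have s0 i : i \in s -> 0 < i.2 by move=> /sP[].
have mC := compact_measurable_borel cC.
have mU : measurable (unions s (fun i => B i.1 (c * i.2)) : set (borel X)).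
  apply: measurable_unions => i /s0 i0; apply: measurable_qball.
  by rewrite mulr_gt0 // c_gt0.
apply: le_trans (le_measure mu (mem_set mC) (mem_set mU) Cs) _.
have := measure_unions_dil 1 s0; rewrite !expr1 => /le_trans; apply.
rewrite EFinM -muleA; apply: lee_wpmul2l; first by rewrite lee_fin ltW // K_gt0.
rewrite lee_pdivlMl //; apply: (@le_trans _ _ (nint (unions s bl) u)); last first.
  exact: nint_le_set.
rewrite nint_unions //; last by move=> i /s0; exact: measurable_qball.
rewrite ge0_sume_distrr //; rewrite !big_seq; apply: lee_sum => i iS.
by apply: ltW; have [_] := sP i iS.
Qed.

(** The values of [u] up to [l / 2] contribute at most [l / 2] to any mean, so the values above must
    contribute more than [l / 2]. *)
Lemma Omega_truncate u l : measurable_fun setT (u : borel X -> R) ->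
  (forall x, 0 <= u x) -> 0 < l ->
  Omega u l `<=` Omega (fun x => u x * \1_(above u (l / 2)) x) (l / 2).
Proof.
move=> mfu u0 l0 x [y [r [r0 Bx h]]]; exists y, r; split => //.
have mv : measurable_fun setT ((fun x => u x * \1_(above u (l / 2)) x) : borel X -> R).
  by apply: measurable_funM => //; apply: measurable_indic; exact: measurable_gt.
rewrite ltNge; apply/negP => h2; move: h; rewrite ltNge => /negP; apply.
rewrite [l in (l%:E * _)%E](_ : l = l / 2 + l / 2); last lra.
rewrite EFinD ge0_muleDl ?lee_fin; [|lra|lra].
have mB := measurable_qball y r0.
have v0 z : 0 <= u z * \1_(above u (l / 2)) z by rewrite mulr_ge0.
have k0 : 0 <= l / 2 by lra.
apply: le_trans (leeD h2 (lexx _)); rewrite -nint_cst //.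
rewrite -(nintD mu mB mv (@measurable_cst _ _ _ _ setT (l / 2)) v0 (fun=> k0)).
apply: nint_le_fun => z _; rewrite u0 /= indic_bool.
by case: ltP => /= uz; have := u0 z; lra.
Qed.

Lemma weak11_truncate u l : measurable_fun setT (u : borel X -> R) ->
  (forall x, 0 <= u x) -> 0 < l ->
  (mu (Omega u l) <= (2 * K / l)%:E * nint (above u (l / 2)) u)%E.
Proof.
move=> mfu u0 l0; have l20 : 0 < l / 2 by lra.
have ma : measurable (above u (l / 2) : set (borel X)) by exact: measurable_gt.
have mv : measurable_fun setT ((fun x => u x * \1_(above u (l / 2)) x) : borel X -> R).
  by apply: measurable_funM => //; apply: measurable_indic.
apply: (@le_trans _ _ (mu (Omega (fun x => u x * \1_(above u (l / 2)) x) (l / 2)))).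
  by apply: le_measure; rewrite ?inE; [exact: measurable_Omega..|exact: Omega_truncate].
apply: le_trans (weak11 mv _ l20) _; first by move=> x; rewrite mulr_ge0.
rewrite nint_indic setTI (_ : K / (l / 2) = 2 * K / l) //.
by field; rewrite gt_eqF.
Qed.

Lemma layer_Omega (a p : R) : 1 < a -> 1 < p -> exists2 C : R, 0 < C &
  forall (u : X -> R) s, 0 < s -> measurable_fun setT (u : borel X -> R) ->
  (forall x, 0 <= u x) ->
  (layer mu a p s (Omega u) <= C%:E * nint setT (fun x => u x `^ p))%E.
Proof.
move=> a1 p1; have K0 := K_gt0.
have [|C C0 HC] := @marcinkiewicz_weak1 _ _ _ mu a p (2 * K) a1 p1; first by lra.
exists C => // u s s0 mfu u0; apply: HC => // l l0; exact: weak11_truncate.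
Qed.

End HomogeneousBasics.

(** * Stopping balls and the sharp function *)

Section MaximalSets.
Context (R : realType) (X : ptopologicalType).
Context (mu : {measure set (borel X) -> \bar R}) (B : X -> R -> set X) (c K : R).
Hypothesis hX : homogeneous_type mu B c K.
Local Notation nint A u := (nint mu A%classic u%R).
Local Notation Omega := (Omega mu B).
Local Notation vol := (vol mu B).
Let bl (i : X * R) := B i.1 i.2.
Let mball y r (r0 : 0 < r) := measurable_qball hX y r0.
Let c0 := c_gt0 hX.
Let K0 := K_gt0 hX.

Lemma compact_lty (C : set X) : compact C -> (mu C < +oo)%E.
Proof.
move=> cC; have [|s [sP ds Cs]] := @vitali_cover _ _ _ _ _ _ hX C (fun _ _ => True) cC.
  by move=> x _; exists x, 1; split => //; exact: (hom_center hX).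
have s0 i : i \in s -> 0 < i.2 by move=> /sP[].
have s0' i : i \in s -> 0 < c * i.2 by move=> /s0 i0; rewrite mulr_gt0.
have mC := compact_measurable_borel hX cC.
have mU : measurable (unions s (fun i => B i.1 (c * i.2)) : set (borel X)).
  by apply: measurable_unions => i /s0' i0; apply: mball.
apply: le_lt_trans (le_measure mu (mem_set mC) (mem_set mU) Cs) _.
apply: le_lt_trans (measure_unions_le _ _) _; first by move=> i /s0' i0; apply: mball.
by rewrite big_seq; apply: lte_sum_pinfty => i /s0' i0; rewrite (volE hX) // ltry.
Qed.

(** Replaces Lebesgue differentiation. Cover [C] by balls that meet it and lie in an open set [U]
    barely larger than [C]. Each ball contains a point outside [Omega u l], so its mean is at most
    [l], while [u > l'] on [C]. Hence a fixed fraction of these balls misses [C], and [U] has no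
    room for it. *)
Lemma compact_Omega_null u l l' (C : set X) : measurable_fun setT (u : borel X -> R) ->
  (forall x, 0 <= u x) -> 0 < l -> l < l' -> compact C ->
  C `<=` above u l' `\` Omega u l -> mu C = 0%E.
Proof.
move=> mfu u0 l0 ll cC CE; have mC := compact_measurable_borel hX cC.
have Cfin : mu C \is a fin_num by rewrite ge0_fin_numE ?compact_lty.
apply/eqP; rewrite eq_le measure_ge0 andbT leNgt; apply/negP => C0.
set m := fine (mu C); have mE : mu C = m%:E by rewrite fineK.
have m0 : 0 < m by rewrite -lte_fin -mE.
pose k := (1 - l / l') / K.
have l'0 : 0 < l' by apply: lt_trans ll.
have lll : l / l' < 1 by rewrite ltr_pdivrMr // mul1r.
have k0 : 0 < k by rewrite divr_gt0 // subr_gt0.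
have [infC _] := hom_regular hX mC.
have : (mu C < ((1 + k) * m)%:E)%E by rewrite mE lte_fin mulrDl mul1r ltrDl mulr_gt0.
rewrite infC => /ereal_inf_lt [_ [U [oU CU] <-]] UC.
have [|t [tP dt Ct]] := @vitali_cover _ _ _ _ _ _ hX C
    (fun y r => B y r `<=` U /\ B y r `&` C !=set0) cC.
  move=> x Cx; have [_ hb] := hom_basis hX.
  have [|V [[y [r [r0 ->]]] Bx] VU] := hb x U.
    by apply: open_nbhs_nbhs; split => //; exact: CU.
  by exists y, r; split => //; split => //; exists x.
have t0 i : i \in t -> 0 < i.2 by move=> /tP[].
pose V := unions t bl.
have mV : measurable (V : set (borel X)).
  by apply: measurable_unions => i /t0 i0; apply: mball.
have VU : V `<=` U by move=> x [i /tP[_ [iU _]]]; exact: iU.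
have mU : measurable (U : set (borel X)) by exact: open_measurable_borel.
have Ufin : (mu U < +oo)%E by apply: lt_trans UC (ltry _).
have fin (A : set X) : measurable (A : set (borel X)) -> A `<=` U -> mu A = (fine (mu A))%:E.
  move=> mA AU; rewrite fineK // ge0_fin_numE //; apply: le_lt_trans Ufin.
  by apply: le_measure; rewrite ?inE.
have mVC : measurable (V `&` C : set (borel X)) by exact: measurableI.
have mVD : measurable (V `\` C : set (borel X)) by exact: measurableD.
have h1 : (mu C <= K%:E * mu V)%E.
  have mU1 : measurable (unions t (fun i => B i.1 (c * i.2)) : set (borel X)).
    by apply: measurable_unions => i /t0 i0; apply: mball; rewrite mulr_gt0.
  apply: le_trans (le_measure mu (mem_set mC) (mem_set mU1) Ct) _.
  have := measure_unions_dil hX 1 t0; rewrite !expr1 => /le_trans; apply.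
  by rewrite -measure_unions // => i /t0 i0; apply: mball.
have h2 : (l'%:E * mu (V `&` C) <= l%:E * mu V)%E.
  apply: (@le_trans _ _ (nint V u)).
    apply: (@le_trans _ _ (nint (V `&` C) u)); last by apply: nint_le_set => // x [].
    rewrite -nint_cst //; apply: nint_le_fun => x [_ /CE[/= h _]].
    by rewrite (ltW l'0) (ltW h).
  rewrite nint_unions //; last by move=> i /t0 i0; apply: mball.
  rewrite measure_unions //; last by move=> i /t0 i0; apply: mball.
  rewrite ge0_sume_distrr //; rewrite !big_seq; apply: lee_sum => i iS.
  rewrite leNgt; apply/negP => h; have [i0 [_ [x [ix Cx]]]] := tP i iS.
  by have [_] := CE x Cx; apply; exists i.1, i.2.
have h3 : (mu V = mu (V `&` C) + mu (V `\` C))%E.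
  by rewrite addeC -(measureDI mu mV mC).
have h4 : (mu (V `\` C) + mu C <= mu U)%E.
  rewrite -measureU //; last by rewrite setDE -setIA setICl setI0.
  apply: le_measure; rewrite ?inE //; first exact: measurableU.
  by move=> x [[Vx _]|/CU //]; exact: VU.
move: h1 h2 h3 h4 UC; rewrite mE (fin V) // (fin (V `&` C)) //; last by move=> x [/VU].
rewrite (fin (V `\` C)) //; last by move=> x [/VU].
rewrite (fin U) // -!EFinM -!EFinD !lee_fin lte_fin.
set v := fine (mu V); set a := fine _; set b := fine _; set w := fine _.
move=> h1 h2 [h3] h4 h5.
have : k * m <= (1 - l / l') * v.
  by rewrite /k -mulrA ler_pM2l ?subr_gt0 // mulrC ler_pdivrMr // mulrC.
have : a <= l / l' * v by rewrite mulrAC ler_pdivlMr // mulrC.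
lra.
Qed.

Lemma ae_le_Omega u l : measurable_fun setT (u : borel X -> R) ->
  (forall x, 0 <= u x) -> 0 < l ->
  {ae mu, forall x, ~ Omega u l x -> u x <= l}.
Proof.
move=> mfu u0 l0.
pose N n := above u (l + n.+1%:R^-1) `\` Omega u l.
have mN n : measurable (N n : set (borel X)).
  by apply: measurableD; [exact: measurable_gt|exact: (measurable_Omega hX)].
have N0 n : mu (N n) = 0%E.
  apply/eqP; rewrite eq_le measure_ge0 andbT; apply: (inner_regular hX) => // C cC CN.
  by rewrite (compact_Omega_null mfu u0 l0 _ cC CN) // ltrDl invr_gt0 ltr0n.
exists (\bigcup_n N n); split.
- exact: bigcupT_measurable.
- have [_ _ [A [mA A0 NA]]] : [/\ True, True & mu.-negligible (\bigcup_n N n)].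
    by split => //; apply: negligible_bigcup => n; exists (N n); split.
  apply/eqP; rewrite eq_le measure_ge0 andbT -A0.
  by apply: le_measure; rewrite ?inE //; exact: bigcupT_measurable.
move=> x /= /not_implyP [nO /negP]; rewrite -ltNge => lu.
have e0 : 0 < u x - l by rewrite subr_gt0.
exists (Num.truncn (u x - l)^-1) => //; split => //=.
rewrite -ltrBrDl -[ltRHS]invrK ltf_pV2 ?posrE ?invr_gt0 //.
have e1 : 0 <= (u x - l)^-1 by rewrite invr_ge0 ltW.
by have /andP[] := truncn_itv e1.
Qed.

Lemma growth_unbounded (hg : ball_growth mu B c) x (M : R) :
  exists n, M < vol x (c ^+ n).
Proof.
have [e [C' [e0 He]]] := hg.
have ce : 1 < c `^ e by apply: powR_gt1 => //; exact: (hom_c hX).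
have [n hn] := expr_unbounded (M / vol x 1) ce; exists n.
have [+ _] := He x 1 n ltr01; rewrite mulr1 !(volE hX) ?exprn_gt0 // -EFinM lee_fin.
apply: lt_le_trans; rewrite [n%:R * e]mulrC powRrM powR_mulrn ?powR_ge0 //.
by rewrite -ltr_pdivrMr // (vol_gt0 hX).
Qed.

(** Together with the growth condition this bounds the radii of the balls of large mean through a
    given point, so that a nearly maximal one exists. *)
Definition small_balls (u : X -> R) (l : R) := exists V : R, forall y r, 0 < r ->
  (l%:E * mu (B y r) < nint (B y r) u)%E -> (mu (B y r) <= V%:E)%E.

(* Through each point of Omega take a ball of nearly maximal radius among those
   witnessing membership: every essentially larger ball has small average. *)
Lemma stopping_balls u l (C : set X) : ball_growth mu B c -> small_balls u l ->
  compact C -> C `<=` Omega u l ->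
  exists s : seq (X * R), [/\ forall i, i \in s -> [/\ 0 < i.2,
        (l%:E * mu (bl i) < nint (bl i) u)%E &
        forall y r, c * i.2 <= r -> bl i `<=` B y r ->
          (nint (B y r) u <= l%:E * mu (B y r))%E],
      disjoint_family bl s & C `<=` unions s (fun i => B i.1 (c * i.2))].
Proof.
move=> hg [V HV] cC CO.
pose P y r := (l%:E * mu (B y r) < nint (B y r) u)%E /\
  forall y' r', c * r <= r' -> B y r `<=` B y' r' ->
          (nint (B y' r') u <= l%:E * mu (B y' r'))%E.
have [|s [sP ds Cs]] := @vitali_cover _ _ _ _ _ _ hX C P cC; last first.
  by exists s; split => // i /sP[i0 [h1 h2]].
move=> x /CO [y0 [r0 [r00 Bx0 h0]]].
pose S := [set r | exists y, [/\ 0 < r, B y r x & (l%:E * mu (B y r) < nint (B y r) u)%E]].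
(* A witness of radius above [c ^+ n] through [x] would have a [c]-dilate containing [B x (c ^+ n)],
   so its own measure would exceed [V]. *)
have [n hn] := growth_unbounded hg x (K * V).
have cn0 : 0 < c ^+ n by rewrite exprn_gt0.
have Sub r : S r -> r <= c ^+ n.
  move=> [y [rp Bx h]]; rewrite leNgt; apply/negP => rn.
  have : vol x (c ^+ n) <= vol y (c * r).
    apply: (le_vol hX) => //; first by rewrite mulr_gt0.
    apply: (hom_engulfing hX) => //; first exact: ltW.
    by exists x; split => //; exact: (hom_center hX).
  have := vol_doubling hX y rp.
  have := HV _ _ rp h; rewrite (volE hX) // lee_fin => h1 h2 h3.
  have : K * vol y r <= K * V by rewrite ler_pM2l.
  lra.
have hS : has_sup S by split; [exists r0, y0|exists (c ^+ n)].
have sup0 : r0 <= sup S by apply: ub_le_sup; [exact: hS.2|exists y0].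
(* The slack is such that a radius within it of the supremum satisfies [sup S < c * r]; radii from
   [c * r] on are then excluded. *)
have e0 : 0 < sup S * (1 - c^-1).
  by rewrite mulr_gt0 ?subr_gt0 ?invf_lt1 ?(hom_c hX) //; lra.
have [r [y [rp Bx h]] rS] := sup_adherent e0 hS.
exists y, r; split => //; split => // y' r' rr' sub.
rewrite leNgt; apply/negP => h'.
have r'p : 0 < r' by apply: lt_le_trans rr'; rewrite mulr_gt0.
have : r' <= sup S by apply: ub_le_sup; [exact: hS.2|exists y'; split => //; exact: sub].
have : sup S < c * r; last by lra.
by move: rS; rewrite mulrBr mulr1 subKr ltr_pdivrMr // mulrC.
Qed.

(** Apply the mean inequality with [D = l / 2]: half of the lower bound [l * mu (B y r)] is
    absorbed, and the other half is bounded by the integral of [u ^ q]. *)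
Lemma small_balls_powR u l q : measurable_fun setT (u : borel X -> R) ->
  (forall x, 0 <= u x) -> 0 < l -> 1 <= q ->
  (nint setT (fun x => u x `^ q) < +oo)%E -> small_balls u l.
Proof.
move=> mfu u0 l0 q1 fin; exists (((l / 2) `^ q)^-1 * fine (nint setT (fun x => u x `^ q))).
move=> y r r0 h; have l20 : 0 < l / 2 by lra.
have := nint_powR_lty_above mu l20 q1 (mball y r0) mfu u0.
have le1 : (nint (B y r) (fun x => u x `^ q) <=
    (fine (nint setT (fun x => u x `^ q)))%:E)%E.
  rewrite fineK; first by apply: nint_le_set => // x; exact: powR_ge0.
  by rewrite ge0_fin_numE //; apply: nint_ge0 => x _; exact: powR_ge0.
move/(lt_le_trans h)/lt_le_trans.
move=> /(_ _ (leeD (lexx _) (lee_wpmul2l _ le1))) H.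
have {}H := H _; have := H; rewrite lee_fin powR_ge0 => /(_ isT).
rewrite (volE hX) // -!EFinM -EFinD lte_fin lee_fin => {}H.
rewrite ler_pdivlMl ?powR_gt0 //.
have e : (l / 2) `^ (1 - q) = (l / 2) / (l / 2) `^ q.
  by rewrite powRB ?powRr1 ?(ltW l20) // (gt_eqF l20) implybT.
move: H; rewrite e; set w := (l / 2) `^ q; set I := fine _ => H.
have w0 : 0 < w by apply: powR_gt0.
have : (l / 2) * vol y r < (l / 2) * (I / w) by rewrite mulrCA mulrC -mulrA; lra.
by rewrite ltr_pM2l // ltr_pdivlMr // mulrC => /ltW.
Qed.

(** Localise to stopping balls at level [l]. Near such a ball, a ball of mean above [(K + 3) * l]
    must be small, hence lies in the [c ^+ 2]-dilate, where [F] is within [g * l] in the mean of a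
    constant [a <= 2 * l]. So the maximal function of [F - a] on that dilate exceeds [l], and the
    weak type bound gives the fraction [K ^+ 3 * g]. The number [K + 3] exceeds both [K], needed for
    the smallness of the ball, and [1 + 2], needed to subtract [a]. *)
Lemma sharp_good_lambda F E' g l : ball_growth mu B c ->
  measurable_fun setT (F : borel X -> R) -> (forall x, 0 <= F x) ->
  small_balls F l -> measurable (E' : set (borel X)) -> 0 < g <= 1 -> 0 < l ->
  (forall y r z, 0 < r -> B y r z -> ~ E' z -> exists2 a : R, 0 <= a &
     (nint (B y r) (fun x => `|F x - a|) <= (g * l)%:E * mu (B y r))%E) ->
  (mu (Omega F ((K + 3) * l)%R) <= (K ^+ 3 * g)%:E * mu (Omega F l) + mu E')%E.
Proof.
move=> hg mF F0 sF mE' /andP[g0 g1] l0 osc.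
have K1 := hom_K hX.
have mO l' : measurable (Omega F l' : set (borel X)) by exact: (measurable_Omega hX).
apply: (@le_trans _ _ (mu (Omega F ((K + 3) * l)%R `\` E') + mu E')%E).
  rewrite -measureU; [|exact: measurableD|by []|].
    apply: le_measure; rewrite ?inE //; first by apply: measurableU => //; exact: measurableD.
    by move=> x Ox; have [|] := pselect (E' x); [right|left].
  by rewrite setDE -setIA setICl setI0.
apply: leeD => //; apply: (inner_regular hX); first exact: measurableD.
move=> C cC CE; have CO : C `<=` Omega F l.
  move=> x /CE[Ox _]; apply: sub_Omega Ox; rewrite ler_peMl ?(ltW l0) //; lra.
have [s [sP ds Cs]] := stopping_balls hg sF cC CO.
have s0 i : i \in s -> 0 < i.2 by move=> /sP[].
have mC := compact_measurable_borel hX cC.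
have mcB i n : i \in s -> measurable (B i.1 (c ^+ n * i.2) : set (borel X)).
  by move=> /s0 i0; apply: mball; rewrite mulr_gt0 // exprn_gt0.
have mCB i : i \in s -> measurable (C `&` B i.1 (c * i.2) : set (borel X)).
  by move=> iS; apply: measurableI => //; have := mcB i 1 iS; rewrite expr1.
have Csub : C `<=` unions s (fun i => C `&` B i.1 (c * i.2)).
  by move=> x Cx; have [i iS Bx] := Cs x Cx; exists i.
have mU := measurable_unions mCB.
apply: le_trans (le_measure mu (mem_set mC) (mem_set mU) Csub) _.
apply: le_trans (measure_unions_le _ mCB) _.
apply: (@le_trans _ _ ((K ^+ 3 * g)%:E * mu (unions s bl))%E); last first.
  apply: lee_wpmul2l; first by rewrite lee_fin mulr_ge0 ?exprn_ge0 ?(ltW K0) ?(ltW g0).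
  have mb : measurable (unions s bl : set (borel X)).
    by apply: measurable_unions => i /s0 i0; exact: mball.
  apply: le_measure; rewrite ?inE // => x [i iS Bx].
  by have [i0 h _] := sP i iS; exists i.1, i.2.
rewrite measure_unions //; last by move=> i /s0 i0; exact: mball.
rewrite ge0_sume_distrr //; rewrite !big_seq; apply: lee_sum => i iS.
have [i0 h1 h2] := sP i iS.
have [e|/set0P[x0 [Cx0 Bx0]]] := eqVneq (C `&` B i.1 (c * i.2)) set0.
  by rewrite e measure0 mule_ge0 // lee_fin mulr_ge0 ?exprn_ge0 ?(ltW K0) ?(ltW g0).
pose r2 := c ^+ 2 * i.2; have r20 : 0 < r2 by rewrite mulr_gt0 // exprn_gt0.
have ci0 : 0 < c * i.2 by rewrite mulr_gt0.
have sub1 : B i.1 (c * i.2) `<=` B i.1 r2.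
  by rewrite /r2 expr2 -mulrA; apply: (subset_dil hX).
have sub2 : bl i `<=` B i.1 r2 by apply: subset_trans sub1; apply: (subset_dil hX).
have [_ nE'] := CE x0 Cx0.
have [a a0 osca] := osc i.1 r2 x0 r20 (sub1 _ Bx0) nE'.
pose v x := `|F x - a| * \1_(B i.1 r2) x.
have mB2 : measurable (B i.1 r2 : set (borel X)) by exact: mball.
have mFa : measurable_fun setT ((fun x => `|F x - a|) : borel X -> R).
  by apply: measurableT_comp => //; apply: measurable_funB.
have mv : measurable_fun setT (v : borel X -> R).
  by apply: measurable_funM => //; exact: measurable_indic.
have v0 x : 0 <= v x by rewrite mulr_ge0.
have avg2 : (nint (B i.1 r2) F <= l%:E * mu (B i.1 r2))%E.
  by apply: h2 => //; rewrite /r2 expr2 -mulrA ler_peMl ?(c_ge1 hX) // ltW.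
have nintFa A : measurable (A : set (borel X)) -> forall k, 0 <= k ->
    nint A (fun x => `|F x - a| + k) = (nint A (fun x => `|F x - a|) + k%:E * mu A)%E.
  by move=> mA k k0; rewrite nintD // nint_cst.
(* The dilate is larger than the stopping ball, so [F] has mean at most [l] there, and [a] differs
   from that mean by at most [g * l <= l]. *)
have al : a <= 2 * l.
  have : (a%:E * mu (B i.1 r2) <= (2 * l)%:E * mu (B i.1 r2))%E.
    rewrite -nint_cst //; apply: (@le_trans _ _ (nint (B i.1 r2) (fun x => `|F x - a| + F x))).
      apply: nint_le_fun => x _; rewrite a0 /=.
      by have := ler_norm (a - F x); rewrite distrC; lra.
    rewrite nintD //; apply: le_trans (leeD osca avg2) _.
    rewrite (volE hX) // -!EFinM -EFinD lee_fin -!mulrA.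
    have : 0 < l * vol i.1 r2 by rewrite mulr_gt0 // (vol_gt0 hX).
    by move: (l * _) => w w0; have := ler_wpM2r (ltW w0) g1; lra.
  by rewrite (volE hX) // -!EFinM lee_fin ler_pM2r // (vol_gt0 hX).
have sub : C `&` B i.1 (c * i.2) `<=` Omega v l.
  move=> x [Cx Bx]; have [[y [r [r0 Bxy h]]] _] := CE x Cx.
  (* Otherwise the [c]-dilate of [B y r] contains the stopping ball, has mean at most [l], and by
     doubling the mean on [B y r] is at most [K * l]. *)
  have rr : r < c * i.2.
    rewrite ltNge; apply/negP => rr.
    have cr0 : 0 < c * r by rewrite mulr_gt0.
    have sub3 : B i.1 (c * i.2) `<=` B y (c * r).
      by apply: (hom_engulfing hX) => //; exists x.
    have h4 : (nint (B y (c * r)) F <= l%:E * mu (B y (c * r)))%E.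
      apply: h2; last by apply: subset_trans sub3; exact: (subset_dil hX).
      by rewrite ler_pM2l //; apply: le_trans rr; rewrite ler_peMl ?(c_ge1 hX) // ltW.
    move: h; rewrite ltNge => /negP; apply.
    apply: (@le_trans _ _ (nint (B y (c * r)) F)).
      by apply: nint_le_set => //; exact: (subset_dil hX).
    apply: (le_trans h4); rewrite !(volE hX) // -!EFinM lee_fin.
    have := vol_doubling hX y r0; have := vol_gt0 hX y r0 => vp vd.
    have : l * vol y (c * r) <= l * (K * vol y r) by rewrite ler_pM2l.
    have : 0 < l * vol y r by rewrite mulr_gt0.
    have -> : (K + 3) * l * vol y r = l * (K * vol y r) + 3 * (l * vol y r) by ring.
    lra.
  have subr : B y r `<=` B i.1 r2.
    rewrite /r2 expr2 -mulrA; apply: (hom_engulfing hX) => //; first exact: ltW.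
    by exists x.
  exists y, r; split => //.
  have ev : nint (B y r) v = nint (B y r) (fun x => `|F x - a|).
    by rewrite nint_indic setIidl.
  rewrite ev ltNge; apply/negP => h3; move: h; rewrite ltNge => /negP; apply.
  have mBr : measurable (B y r : set (borel X)) by exact: mball.
  apply: (@le_trans _ _ (nint (B y r) (fun x => `|F x - a| + a))).
    apply: nint_le_fun => z _; rewrite F0 /=.
    by have := ler_norm (F z - a); lra.
  rewrite nintFa //; apply: le_trans (leeD h3 (lexx _)) _.
  rewrite (volE hX) // -!EFinM -EFinD lee_fin.
  have := vol_gt0 hX y r0; move: (vol y r) => w w0.
  have : a * w <= 2 * l * w by rewrite ler_pM2r.
  have : 0 < l * w by rewrite mulr_gt0.
  have : 0 < K * l * w by rewrite !mulr_gt0.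
  lra.
apply: (@le_trans _ _ (mu (Omega v l))).
  by apply: le_measure; rewrite ?inE //; [exact: mCB|exact: (measurable_Omega hX)].
apply: le_trans (weak11 hX mv v0 l0) _.
rewrite nint_indic setTI; apply: le_trans (lee_wpmul2l _ osca) _.
  by rewrite lee_fin divr_ge0 // ltW.
rewrite /bl !(volE hX) // -!EFinM lee_fin.
have e : K / l * (g * l * vol i.1 r2) = K * g * vol i.1 r2 by field; rewrite gt_eqF.
rewrite e; have := vol_dil hX 2 i.1 i0; rewrite -/r2 => hv.
have : K * g * vol i.1 r2 <= K * g * (K ^+ 2 * vol i.1 i.2) by rewrite ler_pM2l // mulr_gt0.
by move=> /le_trans; apply; rewrite exprS le_eqVlt; apply/orP; left; apply/eqP; ring.
Qed.

End MaximalSets.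

Lemma le_measure_ae d (T : measurableType d) (R : realType)
    (mu : {measure set T -> \bar R}) (A B : set T) : measurable A -> measurable B ->
  {ae mu, forall x, A x -> B x} -> (mu A <= mu B)%E.
Proof.
move=> mA mB [N [mN N0 hN]].
apply: (@le_trans _ _ (mu (B `|` N))).
  apply: le_measure; rewrite ?inE //; first exact: measurableU.
  move=> x Ax; have [|nBx] := pselect (B x); [by left|right].
  by apply: hN => /=; apply/not_implyP.
have -> : mu B = (mu B + mu N)%E by rewrite (N0 : mu N = 0%E) adde0.
exact: measureU2.
Qed.

Lemma ae_mono d (T : measurableType d) (R : realType)
    (mu : {measure set T -> \bar R}) (P Q : T -> Prop) :
  (forall x, P x -> Q x) -> {ae mu, forall x, P x} -> {ae mu, forall x, Q x}.
Proof.
move=> PQ [N [mN N0 hN]]; exists N; split => // x /= nQ.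
by apply: hN => /= /PQ.
Qed.

Lemma ae_and d (T : measurableType d) (R : realType)
    (mu : {measure set T -> \bar R}) (P Q : T -> Prop) :
  {ae mu, forall x, P x} -> {ae mu, forall x, Q x} -> {ae mu, forall x, P x /\ Q x}.
Proof.
move=> [N [mN N0 hN]] [N' [mN' N'0 hN']]; exists (N `|` N'); split.
- exact: measurableU.
- apply/eqP; rewrite eq_le measure_ge0 andbT.
  have -> : 0%E = (mu N + mu N')%E.
    by rewrite (N0 : mu N = 0%E) (N'0 : mu N' = 0%E) adde0.
  exact: measureU2.
- move=> x /= /not_andP[nP|nQ]; [left; exact: hN|right; exact: hN'].
Qed.

Section SharpFunction.
Context (R : realType) (X : ptopologicalType).
Context (mu : {measure set (borel X) -> \bar R}) (B : X -> R -> set X) (c K : R).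
Hypothesis hX : homogeneous_type mu B c K.
Hypothesis hg : ball_growth mu B c.
Local Notation nint A u := (nint mu A%classic u%R).
Local Notation Omega := (Omega mu B).

Lemma layer_above_le_Omega (a p : R) (F : X -> R) s : 1 < a -> 0 < s ->
  measurable_fun setT (F : borel X -> R) -> (forall x, 0 <= F x) ->
  (layer mu a p s (fun l => above F l) <= layer mu a p s (Omega F))%E.
Proof.
move=> a1 s0 mF F0; apply: layer_le => // l l0; apply: le_measure_ae.
- exact: measurable_gt.
- exact: (measurable_Omega hX).
- apply: ae_mono (ae_le_Omega hX mF F0 l0) => x H /= lF.
  have [//|nO] := pselect (Omega F l x).
  by have := H nO; rewrite leNgt lF.
Qed.

(** The exponent [p0] provides only the a priori finiteness; [g] and [C] do not depend on it, nor on
    the norm of [F] in L^p0. *)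
Lemma sharp_function_bound (p : R) : 1 < p -> exists g C : R,
  [/\ 0 < g <= 1, 0 < C & forall (F : X -> R) (E' : R -> set X) (p0 : R) (M : \bar R),
  measurable_fun setT (F : borel X -> R) -> (forall x, 0 <= F x) ->
  1 < p0 <= p -> (nint setT (fun x => F x `^ p0) < +oo)%E ->
  (forall l, measurable (E' l : set (borel X))) ->
  (forall l y r z, 0 < l -> 0 < r -> B y r z -> ~ E' l z -> exists2 a : R, 0 <= a &
     (nint (B y r) (fun x => `|F x - a|) <= (g * l)%:E * mu (B y r))%E) ->
  (forall s, 0 < s -> (layer mu (K + 3) p s E' <= M)%E) ->
  (nint setT (fun x => F x `^ p) <= C%:E * M)%E].
Proof.
move=> p1; have K1 := hom_K hX; pose A := K + 3; have A1 : 1 < A by rewrite /A; lra.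
have Ap : 1 < A `^ p by apply: powR_gt1; lra.
(* With [g = 1 / D] the factor [K ^+ 3 * g] of the good-lambda inequality, multiplied by [A ^ p], is
   exactly one half, the largest value that can be absorbed. *)
pose D := 2 * K ^+ 3 * A `^ p.
have K3 : 1 <= K ^+ 3 by apply: exprn_ege1; lra.
have D1 : 1 <= D.
  have : 1 <= K ^+ 3 * A `^ p by apply: mulr_ege1 => //; lra.
  by rewrite /D -mulrA; lra.
have D0 : 0 < D by lra.
exists D^-1, (A `^ p * (2 * A `^ p)); split.
- by rewrite invr_gt0 D0 invf_le1.
- by rewrite !mulr_gt0 //; lra.
move=> F E' p0 M mF F0 /andP[p01 p0p] fin mE' osc HM.
have bnd s : 0 < s -> (layer mu A p s (Omega F) <= (2 * A `^ p)%:E * M)%E.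
  move=> s0.
  apply: (@le_trans _ _ ((2 * A `^ p)%:E * layer mu A p s E')%E); last first.
    by apply: lee_wpmul2l; [rewrite lee_fin; lra|exact: HM].
  apply: (@good_lambda _ _ _ mu A p (K ^+ 3 * D^-1)) => //; first lra.
  - by rewrite mulr_ge0 ?invr_ge0; lra.
  - have e : K ^+ 3 * D^-1 * A `^ p = 2^-1.
      by rewrite /D; field; apply/andP; split; rewrite gt_eqF //; lra.
    by rewrite e.
  - move=> l l0; apply: (sharp_good_lambda hX) => //.
    + by apply: (small_balls_powR hX) fin; rewrite ?ltW.
    + by rewrite invr_gt0 D0 invf_le1.
    + by move=> y r z r0 Bz nE; exact: (osc l y r z).
  - have [C C0 HC] := layer_Omega hX A1 p01.
    apply: le_lt_trans (layer_exponent mu _ s0 A1 p0p) _.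
    apply: le_lt_trans (lee_wpmul2l _ (HC F s s0 mF F0)) _.
      by rewrite lee_fin powR_ge0.
    rewrite muleA -EFinM.
    have : (0 <= nint setT (fun x => F x `^ p0))%E.
      by apply: nint_ge0 => x _; exact: powR_ge0.
    by case: (nint _ _) fin => [z| |] // _ _; rewrite -EFinM ltry.
rewrite EFinM -muleA.
apply: (nint_powR_le_layer A1) => //; first lra.
move=> s s0; apply: le_trans (bnd s s0); exact: layer_above_le_Omega.
Qed.

End SharpFunction.

(** * Integrals of complex functions *)

Section ComplexNorm.
Context (R : realType).
Implicit Types (x y z : R[i]).

Lemma normc_ge0 x : 0 <= normc x.
Proof. by case: x => a b; exact: sqrtr_ge0. Qed.
Hint Resolve normc_ge0 : core.

Lemma ReD x y : complex.Re (x + y) = complex.Re x + complex.Re y.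
Proof. by case: x y => [? ?] [? ?]. Qed.
Lemma ImD x y : complex.Im (x + y) = complex.Im x + complex.Im y.
Proof. by case: x y => [? ?] [? ?]. Qed.
Lemma ReN x : complex.Re (- x) = - complex.Re x.
Proof. by case: x. Qed.
Lemma ImN x : complex.Im (- x) = - complex.Im x.
Proof. by case: x. Qed.
Lemma ReB x y : complex.Re (x - y) = complex.Re x - complex.Re y.
Proof. by rewrite ReD ReN. Qed.
Lemma ImB x y : complex.Im (x - y) = complex.Im x - complex.Im y.
Proof. by rewrite ImD ImN. Qed.
Lemma ReM x y : complex.Re (x * y) =
  complex.Re x * complex.Re y - complex.Im x * complex.Im y.
Proof. by case: x y => [? ?] [? ?]. Qed.
Lemma ImM x y : complex.Im (x * y) =
  complex.Re x * complex.Im y + complex.Im x * complex.Re y.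
Proof. by case: x y => [? ?] [? ?]. Qed.

Lemma normcB_le x y : normc (x - y) <= normc x + normc y.
Proof. by rewrite -(normcN y) le_normcD. Qed.

Lemma normc_distC x y : normc (x - y) = normc (y - x).
Proof. by rewrite -normcN opprB. Qed.

Lemma normc_triangle y x z : normc (x - z) <= normc (x - y) + normc (y - z).
Proof. by have := le_normcD (x - y) (y - z); rewrite addrA subrK. Qed.

Lemma normc_le_dist x y : normc x <= normc (x - y) + normc y.
Proof. by have := le_normcD (x - y) y; rewrite subrK. Qed.

Lemma normc_dist_le x y : `|normc x - normc y| <= normc (x - y).
Proof.
rewrite ler_norml; have := normc_le_dist x y; have := normc_le_dist y x.
by rewrite (normc_distC y x) => h1 h2; apply/andP; split; lra.
Qed.

Lemma normc_real (r : R) : normc r%:C = `|r|.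
Proof. by rewrite /= expr0n addr0 sqrtr_sqr. Qed.

Lemma Re_le_normc x : `|complex.Re x| <= normc x.
Proof.
case: x => a b /=; rewrite -sqrtr_sqr ler_wsqrtr //.
by rewrite lerDl sqr_ge0.
Qed.

Lemma Im_le_normc x : `|complex.Im x| <= normc x.
Proof.
case: x => a b /=; rewrite -sqrtr_sqr ler_wsqrtr //.
by rewrite lerDr sqr_ge0.
Qed.

Lemma normc_le_ReIm x : normc x <= `|complex.Re x| + `|complex.Im x|.
Proof.
case: x => a b /=; rewrite -[leRHS]ger0_norm ?addr_ge0 //.
rewrite -sqrtr_sqr ler_wsqrtr // sqrrD !real_normK ?num_real //.
have : 0 <= `|a| * `|b| by rewrite mulr_ge0.
lra.
Qed.

Lemma normc_eq0 x : (normc x == 0) = (x == 0).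
Proof.
by apply/eqP/eqP => [/Normc.eq0_normc|->] //; rewrite Normc.normc0.
Qed.

End ComplexNorm.
#[global] Hint Extern 0 (is_true (0 <= Normc.normc _)) => (apply: normc_ge0) : core.

Section ComplexIntegrals.
Context d (T : measurableType d) (R : realType) (mu : {measure set T -> \bar R}).
Implicit Types (A : set T) (f g : T -> R[i]).
Local Notation nint A u := (nint mu A%classic u%R).
Local Notation cm f := (cmeasurable [set: T] f).

Lemma cmeasurable_cst (a : R[i]) : cm (fun=> a).
Proof. by split; exact: measurable_cst. Qed.

Lemma cmeasurable_real (u : T -> R) : measurable_fun setT u -> cm (fun x => (u x)%:C).
Proof. by split => //; exact: measurable_cst. Qed.

Lemma cmeasurableD f g : cm f -> cm g -> cm (fun x => f x + g x).
Proof.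
move=> [f1 f2] [g1 g2]; split.
- by under eq_fun do rewrite ReD; exact: measurable_funD.
- by under eq_fun do rewrite ImD; exact: measurable_funD.
Qed.

Lemma cmeasurableB f g : cm f -> cm g -> cm (fun x => f x - g x).
Proof.
move=> [f1 f2] [g1 g2]; split.
- by under eq_fun do rewrite ReB; exact: measurable_funB.
- by under eq_fun do rewrite ImB; exact: measurable_funB.
Qed.

Lemma cmeasurableM f g : cm f -> cm g -> cm (fun x => f x * g x).
Proof.
move=> [f1 f2] [g1 g2]; split.
- by under eq_fun do rewrite ReM; apply: measurable_funB; exact: measurable_funM.
- by under eq_fun do rewrite ImM; apply: measurable_funD; exact: measurable_funM.
Qed.

Lemma cmeasurable_indic A : measurable A -> cm (fun x => (\1_A x : R)%:C).
Proof. by move=> mA; apply: cmeasurable_real; exact: measurable_indic. Qed.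

Lemma cmeasurable_sum (I : Type) (r : seq I) (f : I -> T -> R[i]) :
  (forall i, cm (f i)) -> cm (fun x => \sum_(i <- r) f i x).
Proof.
move=> mf; elim: r => [|i r IH].
  by under eq_fun do rewrite big_nil; exact: cmeasurable_cst.
by under eq_fun do rewrite big_cons; exact: cmeasurableD.
Qed.

Lemma measurable_normc f : cm f -> measurable_fun setT (fun x => normc (f x)).
Proof.
move=> [f1 f2].
have -> : (fun x => normc (f x)) = fun x =>
    Num.sqrt (complex.Re (f x) ^+ 2 + complex.Im (f x) ^+ 2).
  by apply/funext => x; case: (f x).
have ms : measurable_fun [set: R] (@Num.sqrt R).
  by apply: continuous_measurable_fun; exact: sqrt_continuous.
have mg : measurable_fun setT (fun x => complex.Re (f x) ^+ 2 + complex.Im (f x) ^+ 2).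
  by apply: measurable_funD; exact: measurable_funX.
exact: (measurableT_comp ms mg).
Qed.

Lemma cintegrable_normc A f : measurable A -> cm f ->
  (nint A (fun x => normc (f x)) < +oo)%E -> cintegrable mu A f.
Proof.
move=> mA [f1 f2] fin; split; apply/integrableP; split.
- by apply/measurable_EFinP; exact: measurable_funTS.
- apply: le_lt_trans fin; apply: nint_le => [x _|x _|x Ax] //.
  by split => //; exact: Re_le_normc.
- by apply/measurable_EFinP; exact: measurable_funTS.
- apply: le_lt_trans fin; apply: nint_le => [x _|x _|x Ax] //.
  by split => //; exact: Im_le_normc.
Qed.

(** Real and imaginary parts are estimated separately, whence the factor 2. *)
Lemma normc_cintegral_le A f : measurable A -> cm f ->
  (nint A (fun x => normc (f x)) < +oo)%E ->
  ((normc (cintegral mu A f))%:E <= 2%:E * nint A (fun x => normc (f x)))%E.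
Proof.
move=> mA mf fin; have [i1 i2] := cintegrable_normc mA mf fin.
apply: (@le_trans _ _ (nint A (fun x => normc (f x)) + nint A (fun x => normc (f x)))%E);
  last by rewrite -[2]/(1 + 1) EFinD ge0_muleDl ?lee_fin ?ler01 // !mul1e.
have h (g : T -> R) : mu.-integrable A (EFin \o g) -> (forall x, `|g x| <= normc (f x)) ->
    ((`|\int[mu]_(x in A) g x|)%:E <= nint A (fun x => normc (f x)))%E.
  move=> ig gf; apply: (@le_trans _ _ (\int[mu]_(x in A) `|g x|)%:E).
    by rewrite lee_fin; exact: le_normr_Rintegral.
  rewrite fineK; first by apply: nint_le_fun => x _; rewrite normr_ge0 gf.
  by apply: integrable_fin_num => //; exact: integrable_norm.
apply: le_trans (leeD (h _ i1 _) (h _ i2 _)).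
- by rewrite -EFinD lee_fin; apply: (le_trans (normc_le_ReIm _)).
- by move=> x; exact: Re_le_normc.
- by move=> x; exact: Im_le_normc.
Qed.

Lemma cintegralD A f g : measurable A -> cintegrable mu A f ->
  cintegrable mu A g ->
  cintegral mu A (fun x => f x + g x) = cintegral mu A f + cintegral mu A g.
Proof.
move=> mA [f1 f2] [g1 g2]; rewrite /cintegral.
rewrite -[RHS]/(_ +i* _); congr (_ +i* _).
- by rewrite -RintegralD //; apply: eq_Rintegral => x _; rewrite ReD.
- by rewrite -RintegralD //; apply: eq_Rintegral => x _; rewrite ImD.
Qed.

Lemma cintegrableZ A (a : R[i]) f : measurable A -> cintegrable mu A f ->
  cintegrable mu A (fun x => a * f x).
Proof.
move=> mA [f1 f2]; split.
- under eq_fun do rewrite ReM EFinB !EFinM.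
  by apply: integrableB => //; exact: integrableZl.
- under eq_fun do rewrite ImM EFinD !EFinM.
  by apply: integrableD => //; exact: integrableZl.
Qed.

Lemma cintegralZ A (a : R[i]) f : measurable A -> cintegrable mu A f ->
  cintegral mu A (fun x => a * f x) = a * cintegral mu A f.
Proof.
move=> mA [f1 f2]; case: a => p q; rewrite /cintegral.
have i1 r : mu.-integrable A (EFin \o (fun x => r * complex.Re (f x))).
  by have := integrableZl mA r f1; apply: eq_integrable => // x _; rewrite /= EFinM.
have i2 r : mu.-integrable A (EFin \o (fun x => r * complex.Im (f x))).
  by have := integrableZl mA r f2; apply: eq_integrable => // x _; rewrite /= EFinM.
rewrite -[RHS]/(_ +i* _); congr (_ +i* _).
- by rewrite -!RintegralZl // -RintegralB //; apply: eq_Rintegral => x _; rewrite ReM.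
- rewrite -!RintegralZl // -RintegralD //; apply: eq_Rintegral => x _.
  by rewrite ImM.
Qed.

Lemma cintegralB A f g : measurable A -> cintegrable mu A f ->
  cintegrable mu A g ->
  cintegral mu A (fun x => f x - g x) = cintegral mu A f - cintegral mu A g.
Proof.
move=> mA fi gi; rewrite -[- cintegral mu A g]mulN1r -cintegralZ // -cintegralD //.
  by congr cintegral; apply/funext => x; rewrite mulN1r.
exact: cintegrableZ.
Qed.

Lemma eq_cintegral A f g : (forall x, A x -> f x = g x) ->
  cintegral mu A f = cintegral mu A g.
Proof.
by move=> fg; rewrite /cintegral; congr (_ +i* _); apply: eq_Rintegral => x /set_mem Ax;
  rewrite fg.
Qed.

Lemma cintegral_indic A f :
  cintegral mu setT (fun x => (\1_A x)%:C * f x) = cintegral mu A f.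
Proof.
rewrite /cintegral; congr (_ +i* _); rewrite [RHS]Rintegral_mkcond; apply: eq_Rintegral => x _.
- by rewrite patchE ReM /= indicE; case: ifPn; rewrite ?mul1r !mul0r ?subr0.
- by rewrite patchE ImM /= indicE; case: ifPn; rewrite ?mul1r !mul0r ?addr0.
Qed.

End ComplexIntegrals.

(** * The John-Nirenberg inequality *)

Lemma powRD_le (R : realType) (q x y : R) : 0 <= q -> 0 <= x -> 0 <= y ->
  (x + y) `^ q <= 2 `^ q * (x `^ q + y `^ q).
Proof.
move=> q0 x0 y0.
have h a b : 0 <= a -> a <= b -> (a + b) `^ q <= 2 `^ q * (a `^ q + b `^ q).
  move=> a0 ab; have b0 := le_trans a0 ab.
  apply: (@le_trans _ _ ((2 * b) `^ q)); first by apply: le_powR_base => //; lra.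
  by rewrite powRM // ler_wpM2l ?powR_ge0 // lerDr powR_ge0.
have [xy|/ltW yx] := leP x y; first exact: h.
by rewrite addrC [x `^ q + _]addrC; exact: h.
Qed.

Lemma nint_set0 d (T : measurableType d) (R : realType)
    (mu : {measure set T -> \bar R}) (u : T -> R) : nint mu set0 u = 0%E.
Proof. by rewrite /nint integral_set0. Qed.

Section JohnNirenberg.
Context (R : realType) (X : ptopologicalType).
Context (mu : {measure set (borel X) -> \bar R}) (B : X -> R -> set X) (c K : R).
Hypothesis hX : homogeneous_type mu B c K.
Hypothesis hg : ball_growth mu B c.
Local Notation nint A u := (nint mu A%classic u%R).
Local Notation Omega := (Omega mu B).
Local Notation vol := (vol mu B).
Local Notation cm f := (cmeasurable [set: borel X] f).
Let bl (i : X * R) := B i.1 i.2.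
Let mball y r (r0 : 0 < r) := measurable_qball hX y r0.
Let c0 := c_gt0 hX.
Let K0 := K_gt0 hX.

Lemma compact_approx (A : set X) (e : R) : measurable (A : set (borel X)) ->
  (mu A < +oo)%E -> 0 < e ->
  exists C, [/\ compact C, C `<=` A & (mu (A `\` C) <= e%:E)%E].
Proof.
move=> mA Afin e0; have Af : mu A \is a fin_num by rewrite ge0_fin_numE.
have [_ supA] := hom_regular hX mA.
have : (mu A - e%:E < mu A)%E by rewrite lteBlDr // lteDl.
rewrite {2}supA => /ereal_sup_gt [_ [C [cC CA] <-]] hC.
exists C; split => //; have mC := compact_measurable_borel hX cC.
have Cf : mu C \is a fin_num by rewrite ge0_fin_numE // (compact_lty hX).
have e1 : mu A = (mu (A `\` C) + mu C)%E.
  rewrite -measureU //; first by rewrite setUC setDUK.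
  - exact: measurableD.
  - by rewrite setDE -setIA setICl setI0.
move: hC; rewrite lteBlDr // e1 addeC lteD2lE // => /ltW.
by [].
Qed.

(** Average [|z1 - z2| <= |f - z1| + |f - z2|] over [A]. It compares the constants attached to
    nested balls. *)
Lemma oscillation_constants (A : set X) (f : X -> R[i]) (z1 z2 : R[i]) (N1 N2 : R) :
  measurable (A : set (borel X)) -> (0 < mu A < +oo)%E -> cm f ->
  (nint A (fun x => normc (f x - z1)) <= N1%:E * mu A)%E ->
  (nint A (fun x => normc (f x - z2)) <= N2%:E * mu A)%E ->
  normc (z1 - z2) <= N1 + N2.
Proof.
move=> mA /andP[A0 Afin] mf h1 h2.
have mz z : measurable_fun setT ((fun x => normc (f x - z)) : borel X -> R).
  by apply: measurable_normc; apply: cmeasurableB => //; exact: cmeasurable_cst.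
have : ((normc (z1 - z2))%:E * mu A <= (N1 + N2)%:E * mu A)%E.
  rewrite -nint_cst //; apply: (@le_trans _ _ (nint A
      (fun x => normc (f x - z1) + normc (f x - z2)))).
    apply: nint_le_fun => x _; rewrite normc_ge0 /=.
    by rewrite (le_trans (normc_triangle (f x) _ _)) // (normc_distC z1).
  rewrite nintD //; apply: le_trans (leeD h1 h2) _.
  by rewrite EFinD muleDl // ge0_fin_numE // ltW.
case: (mu A) A0 Afin => [v| |] // v0 _.
by rewrite -!EFinM lee_fin ler_pM2r.
Qed.

Lemma nint_osc_powR (A : set X) (f : X -> R[i]) (z1 z2 : R[i]) (D q : R) :
  measurable (A : set (borel X)) -> cm f -> 0 <= q -> normc (z1 - z2) <= D ->
  (nint A (fun x => normc (f x - z2) `^ q) <=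
   (2 `^ q)%:E * (nint A (fun x => normc (f x - z1) `^ q) + (D `^ q)%:E * mu A))%E.
Proof.
move=> mA mf q0 zD.
have mz z : measurable_fun setT ((fun x => normc (f x - z) `^ q) : borel X -> R).
  apply: (measurableT_comp (measurable_powR q)).
  by apply: measurable_normc; apply: cmeasurableB => //; exact: cmeasurable_cst.
rewrite -nint_cst // -nintD //; last 2 first.
- by move=> x; exact: powR_ge0.
- by move=> x; exact: powR_ge0.
rewrite -nintZ //; last 2 first.
- exact: measurable_funD.
- by move=> x; rewrite addr_ge0 ?powR_ge0.
apply: nint_le_fun => x _; rewrite powR_ge0 /=.
have D0 : 0 <= D by apply: le_trans zD.
apply: le_trans (powRD_le q0 (normc_ge0 _) D0).
apply: le_powR_base => //; apply: (le_trans (normc_triangle z1 _ _)).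
by rewrite lerD2l.
Qed.

(** The stopping level of the self-improvement step. The term [2 * (2 ^ q) ^+ 2 * N * K ^+ 2] makes
    the coefficient of the old bound at most one half; the term [N * K ^+ 3] prevents stopping balls
    from being larger than the given ball. [jn_const] collects what does not involve the old
    bound. *)
Definition jn_level (q N : R) : R :=
  2 * (2 `^ q) ^+ 2 * N * K ^+ 2 + N * K ^+ 3 + 1.
Definition jn_const (q N : R) : R := 2 `^ q * (jn_level q N `^ q + 1 +
  2 `^ q * (N + jn_level q N) `^ q * N * K ^+ 2 / jn_level q N + (N + K * N) `^ q).

(** Stop [|b - bt|] at level [l0] inside [B y r]. Off the stopping balls it is at most [l0]. On the
    dilate of a stopping ball the old bound [Phi] applies around that ball's own constant, which is
    within [N + l0] of [bt]. The total measure of the stopping balls is at most [N * K / l0] times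
    that of [B y r], so [Phi] returns with a small coefficient. *)
Lemma john_nirenberg_step (q N : R) (b : X -> R[i]) (beta : X -> R -> R[i]) (M Phi : R) :
  1 <= q -> 0 < N -> cm b ->
  (forall x y r, 0 < r -> normc (b x - beta y r) <= M) -> 0 < M -> 0 <= Phi ->
  (forall y r, 0 < r ->
    (nint (B y r) (fun x => normc (b x - beta y r)) <= N%:E * mu (B y r))%E) ->
  (forall y r, 0 < r ->
    (nint (B y r) (fun x => normc (b x - beta y r) `^ q) <= Phi%:E * mu (B y r))%E) ->
  forall y r, 0 < r -> (nint (B y r) (fun x => normc (b x - beta y r) `^ q) <=
     (jn_const q N + Phi / 2)%:E * mu (B y r))%E.
Proof.
move=> q1 N0 mb bM M0 Phi0 osc hPhi y r r0.
pose Q : R := 2 `^ q; pose l0 := jn_level q N.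
have q0 : 0 <= q by lra.
have Q0 : 0 < Q by apply: powR_gt0.
have K1 := hom_K hX.
have QN : 0 < Q ^+ 2 * N * K ^+ 2 by rewrite !mulr_gt0 ?exprn_gt0.
have NK3 : 0 < N * K ^+ 3 by rewrite mulr_gt0 ?exprn_gt0.
have l00 : 0 < l0 by rewrite /l0 /jn_level -/Q -!mulrA; rewrite -!mulrA in QN NK3; lra.
have cr0 : 0 < c * r by rewrite mulr_gt0.
(* The oscillation is measured on the dilate, because dilated stopping balls may leave [B y r] but
   not [B y (c * r)]. *)
set bt := beta y (c * r).
have mB := mball y r0; have mcB := mball y cr0.
have BcB : B y r `<=` B y (c * r) := subset_dil hX r0.
have mz z : measurable_fun setT ((fun x => normc (b x - z)) : borel X -> R).
  by apply: measurable_normc; apply: cmeasurableB => //; exact: cmeasurable_cst.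
have mzq z : measurable_fun setT ((fun x => normc (b x - z) `^ q) : borel X -> R).
  exact: (measurableT_comp (measurable_powR q)).
pose u x : R := normc (b x - bt) * \1_(B y (c * r)) x.
have mu_ : measurable_fun setT (u : borel X -> R).
  by apply: measurable_funM => //; exact: measurable_indic.
have u0 x : 0 <= u x by rewrite mulr_ge0.
have uE A : A `<=` B y (c * r) -> nint A u = nint A (fun x => normc (b x - bt)).
  by move=> AB; rewrite nint_indic setIidl.
have intu A : (nint A u <= (N * K * vol y r)%:E)%E.
  apply: (@le_trans _ _ (nint setT u)); first exact: nint_le_set.
  rewrite nint_indic setTI; apply: (le_trans (osc y (c * r) cr0)).
  rewrite (volE hX) // -EFinM lee_fin -mulrA ler_pM2l //.
  exact: vol_doubling.
have su : small_balls mu B u l0.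
  exists (l0^-1 * (N * K * vol y r)) => z s s0 h.
  have := lt_le_trans h (intu _); rewrite (volE hX) // -EFinM lte_fin lee_fin => h'.
  by rewrite ler_pdivlMl // ltW.
have mO : measurable (Omega u l0 : set (borel X)) := measurable_Omega hX u l0.
pose E := Omega u l0 `&` B y r.
have mE : measurable (E : set (borel X)) by exact: measurableI.
have Efin : (mu E < +oo)%E.
  apply: le_lt_trans (_ : (mu (B y r) < +oo)%E); last by rewrite (volE hX) // ltry.
  by apply: le_measure; rewrite ?inE // => x [].
(* The part of [Omega] left uncovered is so small that, even where [|b - bt|] is of size [M], it
   contributes at most [mu (B y r)]. *)
have e0 : 0 < vol y r / M `^ q by rewrite divr_gt0 ?powR_gt0 // (vol_gt0 hX).
have [C [cC CE EC]] := compact_approx mE Efin e0.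
have mC := compact_measurable_borel hX cC.
have [s [sP ds Cs]] := stopping_balls hX hg su cC (fun x Cx => (CE x Cx).1).
have s0 i : i \in s -> 0 < i.2 by move=> /sP[].
pose w x := normc (b x - bt) `^ q.
have w0 x : 0 <= w x by exact: powR_ge0.
have mw : measurable_fun setT (w : borel X -> R) := mzq bt.
have part1 : (nint (B y r `\` Omega u l0) w <= (l0 `^ q)%:E * mu (B y r))%E.
  apply: (@le_trans _ _ (nint (B y r) (fun=> l0 `^ q))); last by rewrite nint_cst.
  apply: (@le_trans _ _ (nint (B y r `\` Omega u l0) (fun=> l0 `^ q))); last first.
    by apply: nint_le_set => [x|x []//]; exact: powR_ge0.
  apply: nint_ae_le => //; first exact: measurableD.
    by move=> x; exact: powR_ge0.
  apply: ae_mono (ae_le_Omega hX mu_ u0 l00) => x H [Bx nO].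
  have := H nO; rewrite /u indicE mem_set ?mulr1; last exact: BcB.
  by move=> h; apply: le_powR_base.
have part2 : (nint (E `\` C) w <= mu (B y r))%E.
  apply: (@le_trans _ _ (nint (E `\` C) (fun=> M `^ q))).
    apply: nint_le_fun => x _; rewrite w0 /=; apply: le_powR_base => //; exact: bM.
  rewrite nint_cst; last exact: measurableD.
  apply: le_trans (lee_wpmul2l _ EC) _; first by rewrite lee_fin powR_ge0.
  rewrite (volE hX) // -EFinM lee_fin mulrCA divff ?mulr1 //.
  by rewrite gt_eqF // powR_gt0.
pose P := Q * (Phi + (N + l0) `^ q) * K.
have P0 : 0 <= P by rewrite !mulr_ge0 ?addr_ge0 ?powR_ge0 ?(ltW K0).
have mcBi i : i \in s -> measurable (C `&` B i.1 (c * i.2) : set (borel X)).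
  by move=> /s0 i0; apply: measurableI => //; apply: mball; rewrite mulr_gt0.
have part3 : (nint C w <= (P * (N * K / l0))%:E * mu (B y r))%E.
  have Csub : C `<=` unions s (fun i => C `&` B i.1 (c * i.2)).
    by move=> x Cx; have [i iS Bx] := Cs x Cx; exists i.
  apply: (le_trans (nint_le_set mu w0 Csub)).
  apply: (le_trans (nint_unions_le mu mcBi mw w0)).
  apply: (@le_trans _ _ (P%:E * \sum_(i <- s) mu (bl i))%E); last first.
    rewrite [(P * _)%:E]EFinM -muleA; apply: lee_wpmul2l; first by rewrite lee_fin.
    rewrite [_ / l0]mulrC [(_ * (N * K))%:E]EFinM -muleA lee_pdivlMl //.
    apply: (@le_trans _ _ (nint (unions s bl) u)); last first.
      by apply: (le_trans (intu _)); rewrite (volE hX) // -EFinM lee_fin.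
    rewrite nint_unions //; last by move=> i /s0 i0; exact: mball.
    rewrite ge0_sume_distrr //; rewrite !big_seq; apply: lee_sum => i iS.
    by have [_ /ltW] := sP i iS.
  rewrite ge0_sume_distrr //; rewrite !big_seq; apply: lee_sum => i iS.
  have [i0 h1 h2] := sP i iS.
  have ci0 : 0 < c * i.2 by rewrite mulr_gt0.
  have mi := mball i.1 i0; have mci := mball i.1 ci0.
  have [e|/set0P[x [Cx Bx]]] := eqVneq (C `&` B i.1 (c * i.2)) set0.
    by rewrite e nint_set0 mule_ge0.
  have [_ Bxy] := CE x Cx.
  (* A larger stopping ball would have measure comparable to that of [B y r], and a mean above [l0]
     on it would force [l0 < N * K ^+ 3]. *)
  have ri : c * i.2 <= r.
    rewrite leNgt; apply/negP => ri.
    have cci0 : 0 < c * (c * i.2) by rewrite mulr_gt0.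
    have sub : B y r `<=` B i.1 (c * (c * i.2)).
      by apply: (hom_engulfing hX) => //; [exact: ltW|exists x].
    have v1 := le_vol hX r0 cci0 sub.
    have v2 := vol_dil hX 2 i.1 i0; rewrite expr2 -mulrA in v2.
    have := lt_le_trans h1 (intu _); rewrite (volE hX) // -EFinM lte_fin.
    have vi := vol_gt0 hX i.1 i0.
    have : N * K * vol y r <= N * K * (K ^+ 2 * vol i.1 i.2).
      by apply: ler_wpM2l; [rewrite mulr_ge0 ?ltW|exact: le_trans v2].
    have -> : N * K * (K ^+ 2 * vol i.1 i.2) = N * K ^+ 3 * vol i.1 i.2 by ring.
    move=> a1 a2; have : l0 * vol i.1 i.2 < N * K ^+ 3 * vol i.1 i.2.
      exact: lt_le_trans a1.
    rewrite ltr_pM2r // /l0 /jn_level -/Q; move: QN; rewrite -!mulrA; lra.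
  have subi : B i.1 (c * i.2) `<=` B y (c * r).
    by apply: (hom_engulfing hX) => //; exists x.
  have avg : (nint (B i.1 (c * i.2)) (fun x => normc (b x - bt)) <=
      l0%:E * mu (B i.1 (c * i.2)))%E.
    by rewrite -uE //; apply: h2 => //; exact: (subset_dil hX).
  have bd : normc (beta i.1 (c * i.2) - bt) <= N + l0.
    exact: (oscillation_constants mci (hom_pos_fin hX i.1 ci0) mb (osc _ _ ci0) avg).
  apply: (@le_trans _ _ (nint (B i.1 (c * i.2)) w)); first by apply: nint_le_set => // z [].
  apply: le_trans (nint_osc_powR mci mb q0 bd) _.
  have -> : (P%:E * mu (bl i) =
     Q%:E * ((Phi + (N + l0) `^ q)%:E * (K%:E * mu (bl i))))%E by rewrite !EFinM !muleA.
  apply: lee_wpmul2l; first by rewrite lee_fin ltW.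
  apply: le_trans (leeD (hPhi _ _ ci0) (lexx _)) _.
  rewrite /bl !(volE hX) // -!EFinM -EFinD lee_fin -mulrDl.
  apply: ler_wpM2l; first by rewrite addr_ge0 ?powR_ge0.
  exact: vol_doubling.
have full : (nint (B y r) w <= (l0 `^ q + 1 + P * (N * K / l0))%:E * mu (B y r))%E.
  have BU : B y r `<=` (B y r `\` Omega u l0) `|` ((E `\` C) `|` C).
    move=> x Bx; have [Ox|] := pselect (Omega u l0 x); last by left.
    by right; have [|] := pselect (C x); [right|left].
  have mD1 : measurable (B y r `\` Omega u l0 : set (borel X)) by exact: measurableD.
  have mD2 : measurable (E `\` C : set (borel X)) by exact: measurableD.
  apply: (le_trans (nint_le_set mu w0 BU)).
  apply: (le_trans (nint_setU_le mu mD1 (measurableU _ _ mD2 mC) mw w0)).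
  have -> : ((l0 `^ q + 1 + P * (N * K / l0))%:E * mu (B y r) = (l0 `^ q)%:E * mu (B y r) +
      (mu (B y r) + (P * (N * K / l0))%:E * mu (B y r)))%E.
    by rewrite (volE hX) // -!EFinM -!EFinD; congr EFin; ring.
  apply: leeD => //.
  by apply: (le_trans (nint_setU_le mu mD2 mC mw w0)); exact: leeD.
have bd : normc (bt - beta y r) <= N * K + N.
  apply: (oscillation_constants mB (hom_pos_fin hX y r0) mb _ (osc _ _ r0)).
  apply: le_trans (nint_le_set mu _ BcB) _ => //.
  apply: (le_trans (osc _ _ cr0)); rewrite !(volE hX) // -!EFinM lee_fin -mulrA.
  by rewrite ler_pM2l //; exact: vol_doubling.
apply: le_trans (nint_osc_powR mB mb q0 bd) _.
apply: le_trans (lee_wpmul2l _ (leeD full (lexx _))) _; first by rewrite lee_fin ltW.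
rewrite (volE hX) // -!EFinM -?EFinD -?EFinM lee_fin -mulrDl [leLHS]mulrA.
apply: ler_wpM2r; first exact: (vol_ge0 hX).
rewrite -/Q.
have -> : N * K + N = N + K * N by ring.
have key : Q ^+ 2 * N * K ^+ 2 / l0 <= 2^-1.
  by rewrite ler_pdivrMr // /l0 /jn_level -/Q -!mulrA; rewrite -!mulrA in QN NK3; lra.
have : Q ^+ 2 * N * K ^+ 2 / l0 * Phi <= 2^-1 * Phi by apply: ler_wpM2r.
rewrite /jn_const -/Q -/l0 /P; set z := (N + l0) `^ q; set x1 := l0 `^ q; set x2 := (_ + _) `^ q.
have -> : Q * (x1 + 1 + Q * (Phi + z) * K * (N * K / l0) + x2) =
  Q * (x1 + 1 + Q * z * N * K ^+ 2 / l0 + x2) + Q ^+ 2 * N * K ^+ 2 / l0 * Phi.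
  by field; rewrite gt_eqF.
lra.
Qed.

Lemma jn_const_gt0 (q N : R) : 0 < N -> 0 < jn_const q N.
Proof.
move=> N0; have Q0 : 0 < 2 `^ q :> R by apply: powR_gt0.
have l00 : 0 <= jn_level q N.
  by rewrite /jn_level !addr_ge0 ?mulr_ge0 ?exprn_ge0 ?(ltW K0) ?(ltW N0) ?(ltW Q0).
rewrite mulr_gt0 // ltr_wpDr ?powR_ge0 // ltr_wpDr //; last by rewrite ltr_wpDl ?powR_ge0.
by rewrite divr_ge0 ?mulr_ge0 ?powR_ge0 ?exprn_ge0 ?(ltW K0) ?(ltW N0).
Qed.

(* [b] is bounded, so the q-th mean oscillations are bounded a priori; iterating
   the self-improvement makes the bound independent of [sup |b|]. *)
Lemma john_nirenberg (q N : R) : 1 <= q -> 0 < N -> exists2 C : R, 0 < C &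
  forall (b : X -> R[i]) (beta : X -> R -> R[i]) (M : R),
  cm b -> (forall x, normc (b x) <= M) ->
  (forall y r, 0 < r ->
    (nint (B y r) (fun x => normc (b x - beta y r)) <= N%:E * mu (B y r))%E) ->
  forall y r, 0 < r ->
    (nint (B y r) (fun x => normc (b x - beta y r) `^ q) <= C%:E * mu (B y r))%E.
Proof.
move=> q1 N0; have C0 := jn_const_gt0 q N0; set C := jn_const q N in C0.
exists (2 * C + 1) => [|b beta M mb bM osc y r r0]; first by lra.
have M0 : 0 <= M by apply: le_trans (bM y).
have mbd z s : 0 < s -> normc (beta z s) <= M + N.
  move=> s0; rewrite -[beta z s]subr0 [M + N]addrC; have ms := mball z s0.
  apply: (oscillation_constants ms (hom_pos_fin hX z s0) mb (osc z s s0)).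
  rewrite -nint_cst //; apply: nint_le_fun => x _.
  by rewrite subr0 normc_ge0 bM.
pose M' := M + (M + N); have M'0 : 0 < M' by rewrite /M'; lra.
have bM' x z s : 0 < s -> normc (b x - beta z s) <= M'.
  by move=> s0; apply: (le_trans (normcB_le _ _)); apply: lerD => //; exact: mbd.
(* The map sending [Phi] to [C + Phi / 2] has fixed point [2 * C] and halves the distance to it;
   [M' ^ q] is the crude bound to start from. *)
have it n z s : 0 < s -> (nint (B z s) (fun x => normc (b x - beta z s) `^ q) <=
    (2 * C + M' `^ q / 2 ^+ n)%:E * mu (B z s))%E.
  elim: n z s => [|n IH] z s s0.
    have ms := mball z s0; rewrite expr0 divr1 -nint_cst //.
    apply: nint_le_fun => x _; rewrite powR_ge0 /=.
    apply: (@le_trans _ _ (M' `^ q)); last by rewrite lerDr; lra.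
    by apply: le_powR_base; [lra|exact: normc_ge0|exact: bM'].
  have Phi0 : 0 <= 2 * C + M' `^ q / 2 ^+ n.
    by rewrite addr_ge0 ?divr_ge0 ?powR_ge0 ?exprn_ge0 //; lra.
  apply: (le_trans (john_nirenberg_step q1 N0 mb bM' M'0 Phi0 osc IH z s0)).
  apply: lee_wpmul2r => //; rewrite lee_fin -/C le_eqVlt; apply/orP; left; apply/eqP.
  by rewrite exprS; field; rewrite expf_neq0.
have [n hn] := @expr_unbounded R 2 (M' `^ q) (ltr1n _ 2).
apply: (le_trans (it n y r r0)); apply: lee_wpmul2r => //.
by rewrite lee_fin lerD2l ler_pdivrMr ?exprn_gt0 // mul1r ltW.
Qed.

End JohnNirenberg.

(** * Separation and measurability *)

Section QuasiMetric.
Context (R : realType) (X : ptopologicalType) (d : X -> X -> R).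
Context (mu : {measure set (borel X) -> \bar R}) (c K : R).
Hypothesis hd : quasi_metric d.
Hypothesis hX : homogeneous_type mu (qball d) c K.
Local Notation B := (qball d).
Local Notation vol := (vol mu B).
Let c0 : 0 < c := c_gt0 hX.
Let K0 : 0 < K := K_gt0 hX.

Lemma dist_ge0 x y : 0 <= d x y. Proof. by have [+ _ _ _] := hd. Qed.
Lemma dist_sym x y : d x y = d y x. Proof. by have [_ _ + _] := hd. Qed.
Lemma dist_eq0 x y : d x y = 0 <-> x = y. Proof. by have [_ + _ _] := hd. Qed.
Lemma distxx x : d x x = 0. Proof. exact/dist_eq0. Qed.
Lemma dist_gt0 x y : x <> y -> 0 < d x y.
Proof.
by move=> xy; rewrite lt_neqAle dist_ge0 andbT eq_sym; apply/eqP => /dist_eq0.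
Qed.

Lemma dist_triangle : exists2 A : R, 1 <= A & forall x y z, d x z <= A * (d x y + d y z).
Proof.
have [_ _ _ [A hA]] := hd; exists (Num.max A 1) => [|x y z]; first by rewrite le_max lexx orbT.
apply: (le_trans (hA x y z)); apply: ler_wpM2r; first by rewrite addr_ge0 ?dist_ge0.
by rewrite le_max lexx.
Qed.

(** Engulfing for two balls of the same radius [r], one centred at [x0] and one at [x]: points
    outside a dilate are at distance at least [r] from the ball, with no triangle constant. *)
Lemma notin_dil_dist x0 r x y : 0 < r -> B x0 r x -> ~ B x0 (c * r) y -> r <= d x y.
Proof.
move=> r0 Bx; rewrite leNgt => nBy; apply/negP => xy; apply: nBy.
apply: (hom_engulfing hX r0 r0 (lexx r)) xy.
by exists x; split => //; rewrite /qball /= distxx.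
Qed.

Lemma separated_dil x0 r : 0 < r -> separated d (B x0 r) (~` B x0 (c * r)).
Proof. by move=> r0; exists r => // x y Bx By; exact: notin_dil_dist By. Qed.

Lemma separated_sym (A E : set X) : separated d A E -> separated d E A.
Proof. by move=> [r r0 h]; exists r => // x y Ex Ay; rewrite dist_sym; exact: h. Qed.

Lemma separatedS (A A' E E' : set X) : A' `<=` A -> E' `<=` E ->
  separated d A E -> separated d A' E'.
Proof. by move=> AA EE [r r0 h]; exists r => // x y /AA Ax /EE Ey; exact: h. Qed.

Lemma separatedUr (A E F : set X) :
  separated d A E -> separated d A F -> separated d A (E `|` F).
Proof.
move=> [r r0 h] [s s0 h']; exists (Num.min r s); first by rewrite lt_min r0.
by move=> x y Ax [Ey|Fy]; rewrite ge_min; [rewrite h|rewrite h' ?orbT].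
Qed.

Lemma qball_pow x n m : (n <= m)%N -> B x (c ^+ n) `<=` B x (c ^+ m).
Proof.
move=> nm; apply: (hom_nested hX); first by rewrite exprn_gt0.
by apply: ler_weXn2l => //; exact: c_ge1 hX.
Qed.

Lemma qbounded_qball (A : set X) x0 : qbounded d A -> exists2 r, 0 < r & A `<=` B x0 r.
Proof.
move=> [x [r Ar]]; have [r1 r1p Bx] : exists2 s, 0 < s & B x0 s x.
  have [s s0 Bs] : (\bigcup_(s in [set s : R | 0 < s]) B x0 s) x.
    by rewrite -(hom_cover hX).
  by exists s.
pose s := Num.max 1 (Num.max r r1).
have s0 : 0 < s by rewrite lt_max ltr01.
exists (c * s); first by rewrite mulr_gt0.
have sub : B x s `<=` B x0 (c * s).
  apply: (hom_engulfing hX) => //; exists x; split; last by rewrite /qball /= distxx.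
  by move: Bx; rewrite /qball /= => /lt_le_trans; apply; rewrite /s !le_max lexx !orbT.
move=> y /Ar yr; apply: sub; move: yr; rewrite /qball /= => /lt_le_trans; apply.
by rewrite /s !le_max lexx !orbT.
Qed.

Lemma qboundedU (A E : set X) : qbounded d A -> qbounded d E -> qbounded d (A `|` E).
Proof.
have x0 : X := point.
move=> /(qbounded_qball x0) [r r0 Ar] /(qbounded_qball x0) [s s0 Es].
exists x0, (Num.max r s) => y [/Ar|/Es]; rewrite /qball /= lt_max => -> //.
by rewrite orbT.
Qed.

Lemma qboundedS (A E : set X) : A `<=` E -> qbounded d E -> qbounded d A.
Proof. by move=> AE [x [r Er]]; exists x, r; apply: subset_trans Er. Qed.

Lemma qbounded_ball x r : qbounded d (B x r).
Proof. by exists x, r. Qed.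

Lemma qbounded_lty (A : set X) : qbounded d A -> measurable (A : set (borel X)) ->
  (mu A < +oo)%E.
Proof.
have x0 : X := point.
move=> /(qbounded_qball x0) [r r0 Ar] mA.
apply: (@le_lt_trans _ _ (mu (B x0 r))); last by rewrite (volE hX) // ltry.
by apply: le_measure; rewrite ?inE //; exact: (measurable_qball hX).
Qed.

(** A ball containing [F] lies in a fixed dilate of every [B x eta] centred in [F], so doubling
    bounds the measure of [B x eta] from below. This is what bounds the kernel on separated sets. *)
Lemma vol_lower_bound (F : set X) (eta : R) : qbounded d F -> 0 < eta ->
  exists2 v, 0 < v & forall x r, F x -> eta <= r -> v <= vol x r.
Proof.
have x0 : X := point.
move=> /(qbounded_qball x0) [r r0 Fr] e0.
have [n hn] := expr_unbounded (r / eta) (hom_c hX).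
exists (vol x0 r / K ^+ n.+1).
  by rewrite divr_gt0 ?exprn_gt0 // (vol_gt0 hX).
move=> x s Fx es; rewrite ler_pdivrMr ?exprn_gt0 // mulrC.
have n0 : 0 < c ^+ n by rewrite exprn_gt0.
have re : r <= c ^+ n * eta.
  by move: hn; rewrite ltr_pdivrMr // => /ltW.
have ce0 : 0 < c ^+ n * eta by rewrite mulr_gt0.
apply: (@le_trans _ _ (vol x (c ^+ n.+1 * eta))).
  apply: (le_vol hX) => //; first by rewrite mulr_gt0 // exprn_gt0.
  rewrite exprS -mulrA; apply: (hom_engulfing hX) => //.
  by exists x; split; [rewrite /qball /= distxx|exact: Fr].
apply: (le_trans (vol_dil hX n.+1 x e0)); apply: ler_wpM2l; first by rewrite exprn_ge0 // ltW.
have s0 : 0 < s by apply: lt_le_trans es.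
by apply: (le_vol hX) => //; exact: (hom_nested hX).
Qed.

Lemma qball_nbhs x r : 0 < r -> nbhs x (B x r).
Proof.
move=> r0; apply: open_nbhs_nbhs; split; first exact: (open_ball hX).
by rewrite /qball /= distxx.
Qed.

Lemma exists_small A (e : R) : 0 < A -> 0 < e -> exists2 r : R, 0 < r & A * r < e.
Proof.
move=> A0 e0; exists (e / (2 * A)); first by rewrite divr_gt0 // mulr_gt0.
by rewrite (_ : A * (e / (2 * A)) = e / 2); [lra|field; rewrite gt_eqF].
Qed.

(** A quasi-metric need not be continuous, so the distance cannot simply be minimised. The
    quasi-triangle inequality gives a lower bound near each pair of points, and two successive
    finite subcovers, first in [y] and then in [x], make it uniform. *)
Lemma compact_separated (C C' : set X) : compact C -> compact C' ->
  C `&` C' = set0 -> separated d C C'.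
Proof.
move=> cC cC' dCC; have {}dCC x : C x -> ~ C' x.
  by move=> Cx C'x; have : (C `&` C') x; [split|rewrite dCC].
have [A A1 tri] := dist_triangle.
have A0 : 0 < A by lra.
have pt x y : C x -> C' y -> exists2 r : R, 0 < r &
    forall x' y', B x r x' -> B y r y' -> r <= d x' y'.
  move=> Cx C'y; have xy : x <> y.
    by move=> e; apply: (dCC x) => //; rewrite e.
  have rho := dist_gt0 xy.
  (* Three steps of length at most [r], from [x] via [x'] and [y'] to [y], cover at most
     [(A + 2 * A ^+ 2) * r]. *)
  have [|r r0 hr] := @exists_small (A + 2 * A ^+ 2) (d x y) _ rho.
    by rewrite ltr_wpDr // mulr_ge0 // exprn_ge0 // ltW.
  exists r => // x' y'; rewrite /qball /= => xx yy; rewrite leNgt; apply/negP => x'y'.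
  have h1 := tri x x' y; have h2 := tri x' y' y.
  rewrite (dist_sym y' y) in h2.
  have h3 : A * (d x' y' + d y y') <= A * (2 * r) by rewrite ler_pM2l //; lra.
  have h4 : A * (d x x' + d x' y) <= A * (r + A * (2 * r)) by rewrite ler_pM2l //; lra.
  have e : A * (r + A * (2 * r)) = (A + 2 * A ^+ 2) * r by ring.
  by rewrite e in h4; lra.
have line x : C x -> exists2 r : R, 0 < r &
    forall x' y', B x r x' -> C' y' -> r <= d x' y'.
  move=> Cx; have := cC'; rewrite compact_cover.
  pose P (i : X * R) := 0 < i.2 /\
    forall x' y', B x i.2 x' -> B i.1 i.2 y' -> i.2 <= d x' y'.
  move=> /(_ _ [set i : X * R | P i] (fun i => B i.1 i.2)).
  case=> [i [i0 _]|y C'y|D Dsub Dcov]; first exact: (open_ball hX).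
    by have [r r0 hr] := pt x y Cx C'y; exists (y, r) => //; rewrite /qball /= distxx.
  have DP i : i \in finmap.enum_fset D -> P i by move=> /Dsub; rewrite inE.
  have [r [r0 hr]] : exists r, 0 < r /\ forall i, i \in finmap.enum_fset D -> r <= i.2.
    elim: (finmap.enum_fset D) DP => [|i s IH] sP; first by exists 1; split.
    have [|r [r0 hr]] := IH; first by move=> j js; apply: sP; rewrite in_cons js orbT.
    have [i0 _] : P i by apply: sP; rewrite mem_head.
    exists (Num.min r i.2); split; first by rewrite lt_min r0.
    move=> j; rewrite in_cons => /predU1P[->|/hr]; first by rewrite ge_min lexx orbT.
    by move=> rj; rewrite ge_min rj.
  exists r => // x' y' Bx' C'y'; have [i /= iD By'] := Dcov y' C'y'.
  have [i0 hi] := DP _ iD; apply: (le_trans (hr i iD)); apply: hi By'.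
  by move: Bx'; rewrite /qball /= => /lt_le_trans; apply; exact: hr.
have := cC; rewrite compact_cover.
pose P (i : X * R) := 0 < i.2 /\
  forall x' y', B i.1 i.2 x' -> C' y' -> i.2 <= d x' y'.
move=> /(_ _ [set i : X * R | P i] (fun i => B i.1 i.2)).
case=> [i [i0 _]|x Cx|D Dsub Dcov]; first exact: (open_ball hX).
  by have [r r0 hr] := line x Cx; exists (x, r) => //; rewrite /qball /= distxx.
have DP i : i \in finmap.enum_fset D -> P i by move=> /Dsub; rewrite inE.
have [r [r0 hr]] : exists r, 0 < r /\ forall i, i \in finmap.enum_fset D -> r <= i.2.
  elim: (finmap.enum_fset D) DP => [|i s IH] sP; first by exists 1; split.
  have [|r [r0 hr]] := IH; first by move=> j js; apply: sP; rewrite in_cons js orbT.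
  have [i0 _] : P i by apply: sP; rewrite mem_head.
  exists (Num.min r i.2); split; first by rewrite lt_min r0.
  move=> j; rewrite in_cons => /predU1P[->|/hr]; first by rewrite ge_min lexx orbT.
  by move=> rj; rewrite ge_min rj.
exists r => // x y Cx C'y; have [i /= iD Bx] := Dcov x Cx.
by have [i0 hi] := DP _ iD; apply: (le_trans (hr i iD)); exact: hi C'y.
Qed.

(** Separability from inner regularity: a large ball is compact up to a set of measure at most
    [1 / (k + 1)], and the compact part has finite nets at every scale. A ball of positive measure
    inside the large ball cannot avoid the compact parts for all [k]. *)
Lemma dense_sequence : exists P : nat -> X,
  forall x (e : R), 0 < e -> exists n, d (P n) x < e.
Proof.
have x0 : X := point; have [A A1 tri] := dist_triangle; have A0 : 0 < A by lra.
have mB n : measurable (B x0 (c ^+ n) : set (borel X)).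
  by apply: (measurable_qball hX); rewrite exprn_gt0.
have Bfin n : (mu (B x0 (c ^+ n)) < +oo)%E by rewrite (volE hX) ?ltry // exprn_gt0.
have inv0 m : 0 < m.+1%:R^-1 :> R by rewrite invr_gt0 ltr0n.
have /choice [C HC] : forall nk : nat * nat, exists C : set X,
    [/\ compact C, C `<=` B x0 (c ^+ nk.1) &
        (mu (B x0 (c ^+ nk.1) `\` C) <= nk.2.+1%:R^-1%:E)%E].
  by move=> nk; apply: (compact_approx hX).
have /choice [F HF] : forall nkj : nat * nat * nat, exists F : seq X,
    forall z, C nkj.1 z -> exists2 p, p \in F & B p nkj.2.+1%:R^-1 z.
  move=> [nk j] /=; have [cC _ _] := HC nk.
  have := cC; rewrite compact_cover.
  move=> /(_ _ setT (fun p => B p j.+1%:R^-1)).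
  case=> [p _|z Cz|D Dsub Dcov]; first exact: (open_ball hX).
    by exists z => //; rewrite /qball /= distxx.
  by exists (finmap.enum_fset D) => z /Dcov [p /= pD Bz]; exists p.
pose P (n : nat) : X := if @unpickle (nat * nat * nat * nat)%type n is Some t
  then nth x0 (F t.1) t.2 else x0.
exists P => x e e0.
have [eta eta0 heta] := exists_small (mulr_gt0 A0 (ltr0n R 2)) e0.
have [n hn] := expr_unbounded (d x0 x) (hom_c hX).
have Bx : B x0 (c ^+ n) x by [].
have [U [oU Ux UB]] : exists U : set X, [/\ open U, U x & U `<=` B x eta `&` B x0 (c ^+ n)].
  exists (B x eta `&` B x0 (c ^+ n)); split => //.
    by apply: openI; apply: (open_ball hX) => //; rewrite exprn_gt0.
  by split => //; rewrite /qball /= distxx.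
have [_ hb] := hom_basis hX.
have [|V [[y [r [r0 ->]]] By] VU] := hb x U; first exact: open_nbhs_nbhs.
have vr := vol_gt0 hX y r0.
pose k := Num.truncn (vol y r)^-1.
have hk : k.+1%:R^-1 < vol y r.
  rewrite -[ltRHS]invrK ltf_pV2 ?posrE ?invr_gt0 ?ltr0n //.
  have v1 : 0 <= (vol y r)^-1 by rewrite invr_ge0 ltW.
  by have /andP[] := truncn_itv v1.
have [cC CB muC] := HC (n, k).
have mC := compact_measurable_borel hX cC.
have [z [Bz Cz]] : B y r `&` C (n, k) !=set0.
  apply/set0P/eqP => e1.
  have sub : B y r `<=` B x0 (c ^+ n) `\` C (n, k).
    move=> z Bz; split; first by have [] := UB _ (VU _ Bz).
    by move=> Cz; have : (B y r `&` C (n, k)) z by []; rewrite e1.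
  have mBr : measurable (B y r : set (borel X)) by exact: (measurable_qball hX).
  have mD : measurable (B x0 (c ^+ n) `\` C (n, k) : set (borel X)) by exact: measurableD.
  have : (mu (B y r) <= k.+1%:R^-1%:E)%E.
    by apply: le_trans muC; apply: le_measure; rewrite ?inE.
  by rewrite (volE hX) // lee_fin leNgt hk.
pose j := Num.truncn eta^-1.
have hj : j.+1%:R^-1 < eta.
  rewrite -[ltRHS]invrK ltf_pV2 ?posrE ?invr_gt0 ?ltr0n //.
  have v1 : 0 <= eta^-1 by rewrite invr_ge0 ltW.
  by have /andP[] := truncn_itv v1.
have [p pF /= Bp] := HF (n, k, j) z Cz.
exists (pickle (n, k, j, index p (F (n, k, j)))).
rewrite /P pickleK /= nth_index //.
have [xz _] := UB _ (VU _ Bz).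
move: Bp xz; rewrite /qball /= => h1 h2.
have {}h1 : d p z < eta by apply: lt_trans hj.
have := tri p z x; rewrite (dist_sym z x) => h3.
have : A * (d p z + d x z) <= A * (2 * eta) by rewrite ler_pM2l //; lra.
lra.
Qed.

(** An open set of the product need not belong to the product of the Borel sigma-algebras. Here a
    countable union of rectangles suffices: products of disjoint balls of radius [1 / (j + 1)]
    around points of the dense sequence. *)
Lemma measurable_off_diagonal :
  measurable [set z : borel X * borel X | z.1 <> z.2].
Proof.
have [P HP] := dense_sequence; have [A A1 tri] := dist_triangle.
have A0 : 0 < A by lra.
have inv0 m : 0 < m.+1%:R^-1 :> R by rewrite invr_gt0 ltr0n.
pose E j a b : set (borel X * borel X) :=
  [set z | B (P a) j.+1%:R^-1 `&` B (P b) j.+1%:R^-1 = set0 /\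
    (B (P a) j.+1%:R^-1 `*` B (P b) j.+1%:R^-1) z].
have mE j a b : measurable (E j a b).
  have [e|ne] := pselect (B (P a) j.+1%:R^-1 `&` B (P b) j.+1%:R^-1 = set0).
    rewrite (_ : E j a b = B (P a) j.+1%:R^-1 `*` B (P b) j.+1%:R^-1).
      by apply: measurableX; exact: (measurable_qball hX).
    by apply/seteqP; split => z // [].
  by rewrite (_ : E j a b = set0) //; apply/seteqP; split => z // [].
rewrite (_ : [set z | _] = \bigcup_j \bigcup_a \bigcup_b E j a b).
  by do 3!apply: bigcupT_measurable => ?; exact: mE.
apply/seteqP; split => [[x y] /= xy|[x y] [j _ [a _ [b _ [e [/= Bx By]]]]] xy].
  have rho := dist_gt0 xy.
  have [|eta eta0 heta] := @exists_small (4 * A ^+ 2) (d x y) _ rho.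
    by rewrite mulr_gt0 // exprn_gt0.
  pose j := Num.truncn eta^-1.
  have hj : j.+1%:R^-1 < eta.
    rewrite -[ltRHS]invrK ltf_pV2 ?posrE ?invr_gt0 ?ltr0n //.
    have v1 : 0 <= eta^-1 by rewrite invr_ge0 ltW.
    by have /andP[] := truncn_itv v1.
  have [a ha] := HP x _ (inv0 j); have [b hb] := HP y _ (inv0 j).
  exists j => //; exists a => //; exists b => //; split; last by split.
  apply/seteqP; split => // z [/=]; rewrite /qball /= => h1 h2.
  have t1 := tri x (P a) z; have t2 := tri z (P b) y; have t3 := tri x z y.
  rewrite (dist_sym x (P a)) in t1; rewrite (dist_sym z (P b)) in t2.
  have {}h1 := lt_trans h1 hj; have {}h2 := lt_trans h2 hj.
  have {}ha := lt_trans ha hj; have {}hb := lt_trans hb hj.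
  have u1 : A * (d (P a) x + d (P a) z) <= A * (2 * eta) by rewrite ler_pM2l //; lra.
  have u2 : A * (d (P b) z + d (P b) y) <= A * (2 * eta) by rewrite ler_pM2l //; lra.
  have u3 : A * (d x z + d z y) <= A * (4 * (A * eta)) by rewrite ler_pM2l //; lra.
  have e : A * (4 * (A * eta)) = 4 * A ^+ 2 * eta by ring.
  by rewrite e in u3; lra.
by have : (B (P a) j.+1%:R^-1 `&` B (P b) j.+1%:R^-1) x;
  [split => //=; move: By; rewrite /= -xy|rewrite e].
Qed.

End QuasiMetric.

(** * Density of Hölder functions *)

Section HolderDensity.
Context (R : realType) (X : ptopologicalType) (d : X -> X -> R).
Context (mu : {measure set (borel X) -> \bar R}) (c K : R).
Hypothesis hd : quasi_metric d.
Hypothesis hX : homogeneous_type mu (qball d) c K.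
Local Notation B := (qball d).
Local Notation nint A u := (nint mu A%classic u%R).
Local Notation cm f := (cmeasurable [set: borel X] f).
Let c0 : 0 < c := c_gt0 hX.
Let K0 : 0 < K := K_gt0 hX.
Implicit Types (f g h : X -> R[i]) (A E F W : set X).

(** The working class of functions: it lies in every L^p with [p > 0] and, unlike the Hölder
    functions, is stable under restriction to measurable sets and multiplication by bounded
    measurable functions. *)
Definition nice f :=
  [/\ cm f, exists M, forall x, normc (f x) <= M & qbounded d (nonzero f)].

Lemma nice_linear (a : R[i]) f g : nice f -> nice g -> nice (fun x => a * f x + g x).
Proof.
move=> [mf [M fM] sf] [mg [N gN] sg]; split.
- by apply: cmeasurableD => //; apply: cmeasurableM => //; exact: cmeasurable_cst.
- exists (normc a * M + N) => x; apply: (le_trans (le_normcD _ _)).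
  by apply: lerD => //; rewrite Normc.normcM ler_wpM2l.
- apply: (qboundedS _ (qboundedU hd hX sf sg)) => x /= nz.
  have [fx|fx] := pselect (f x = 0); last by left.
  by right => /= gx; apply: nz; rewrite fx gx mulr0 addr0.
Qed.

Lemma nice0 : nice (fun=> 0).
Proof.
split; first exact: cmeasurable_cst.
- by exists 0 => x; rewrite Normc.normc0.
- by exists point, 1 => x /=.
Qed.

Lemma niceD f g : nice f -> nice g -> nice (fun x => f x + g x).
Proof.
by move=> nf ng; have := nice_linear 1 nf ng; under eq_fun do rewrite mul1r.
Qed.

Lemma niceZ (a : R[i]) f : nice f -> nice (fun x => a * f x).
Proof.
by move=> nf; have := nice_linear a nf nice0; under eq_fun do rewrite addr0.
Qed.

Lemma niceB f g : nice f -> nice g -> nice (fun x => f x - g x).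
Proof.
move=> nf ng; have := nice_linear (-1) ng nf.
by under eq_fun do rewrite mulN1r addrC.
Qed.

Lemma niceMl (b : X -> R[i]) (M : R) f : cm b -> (forall x, normc (b x) <= M) ->
  nice f -> nice (fun x => b x * f x).
Proof.
move=> mb bM [mf [N fN] sf]; split; first exact: cmeasurableM.
- exists (M * N) => x; rewrite Normc.normcM ler_pM //.
- by apply: qboundedS sf => x /= nz fx; apply: nz; rewrite fx mulr0.
Qed.

Lemma nice_restrict A f : measurable (A : set (borel X)) -> nice f ->
  nice (fun x => (\1_A x)%:C * f x).
Proof.
move=> mA; apply: (@niceMl _ 1); first exact: cmeasurable_indic.
by move=> x; rewrite normc_real ger0_norm // indicE; case: (_ \in _).
Qed.

Lemma nice_indic A : measurable (A : set (borel X)) -> qbounded d A ->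
  nice (fun x => (\1_A x)%:C).
Proof.
move=> mA bA; split; first exact: cmeasurable_indic.
- exists 1 => x; rewrite normc_real ger0_norm // indicE; by case: (_ \in _).
- by apply: qboundedS bA => x /= nz; apply: contrapT => nA; apply: nz;
    rewrite indicE memNset.
Qed.

Lemma nice_Lp (p : R) f : 0 < p -> nice f ->
  (nint setT (fun x => normc (f x) `^ p)%R < +oo)%E.
Proof.
move=> p0 [mf [M fM] sf]; have x0 : X := point.
have [r r0 fr] := qbounded_qball hd hX x0 sf.
have mB := measurable_qball hX x0 r0.
apply: (@le_lt_trans _ _ (nint (B x0 r) (fun=> `|M| `^ p)%R)); last first.
  by rewrite nint_cst // (volE hX) // -EFinM ltry.
rewrite -(setTI (B x0 r)) -nint_indic; apply: nint_le_fun => x _; rewrite powR_ge0 /=.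
have [fx|fx] := pselect (f x = 0).
  by rewrite fx Normc.normc0 powR0 ?gt_eqF // mulr_ge0 ?powR_ge0.
rewrite indicE mem_set ?mulr1; last exact: fr.
by apply: le_powR_base => //; [exact: ltW|exact: le_trans (fM x) (ler_norm M)].
Qed.

Lemma nice_L2 f : nice f -> (nint setT (fun x => normc (f x) ^+ 2)%R < +oo)%E.
Proof.
move=> /(nice_Lp (ltr0n R 2)); rewrite -(@eq_nint _ _ _ mu _ (fun x => normc (f x) ^+ 2)%R) //.
by move=> x _; rewrite powR_mulrn.
Qed.

Lemma nice_L1 f : nice f -> (nint setT (fun x => normc (f x))%R < +oo)%E.
Proof.
move=> /(nice_Lp (@ltr01 R)); rewrite -(@eq_nint _ _ _ mu _ (fun x => normc (f x))%R) //.
by move=> x _; rewrite powRr1.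
Qed.

Variable delta : R.
Hypothesis delta0 : 0 < delta.
Hypothesis hadm : admissible d delta.

Lemma holder_open (M : R) (u : X -> R) (l : R) :
  (forall x y, `|u x - u y| <= M * d x y `^ delta) -> open [set x | l < u x].
Proof.
move=> hu; rewrite openE => x /= lx; rewrite /interior.
pose e := u x - l; have e0 : 0 < e by rewrite subr_gt0.
pose N := Num.max M 1; have N0 : 0 < N by rewrite lt_max ltr01 orbT.
pose r := (e / N) `^ delta^-1; have r0 : 0 < r by rewrite powR_gt0 // divr_gt0.
apply: filterS (qball_nbhs hd hX x r0) => y; rewrite /qball /= => xy.
have : d x y `^ delta < e / N.
  have -> : e / N = r `^ delta.
    by rewrite /r -powRrM mulVf ?gt_eqF // powRr1 // divr_ge0 // ltW.
  by apply: lt_powR_base => //; exact: dist_ge0 hd _ _.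
rewrite ltr_pdivlMr // => h1.
have h2 : M * d x y `^ delta <= d x y `^ delta * N.
  by rewrite mulrC; apply: ler_wpM2l; rewrite ?powR_ge0 // le_max lexx.
have := ler_norm (u x - u y); have := hu x y; rewrite /e in h1; lra.
Qed.

Lemma holder_measurable (M : R) (u : X -> R) :
  (forall x y, `|u x - u y| <= M * d x y `^ delta) ->
  measurable_fun setT (u : borel X -> R).
Proof.
move=> hu; apply: (measurability _ (RGenOInfty.measurableE R)).
move=> _ [_ [x ->] <-]; rewrite setTI.
apply: open_measurable_borel.
rewrite (_ : _ @^-1` _ = [set z | x < u z]); first exact: holder_open hu.
by apply/seteqP; split => z; rewrite /= in_itv /= andbT.
Qed.

Lemma holder_nice f : Holder d delta f -> nice f.
Proof.
move=> [[M [fM fH]] sf]; split => //; last by exists M.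
split; apply: (@holder_measurable M) => x y.
- by rewrite -ReB; apply: le_trans (fH x y); exact: Re_le_normc.
- by rewrite -ImB; apply: le_trans (fH x y); exact: Im_le_normc.
Qed.

Lemma holder_linear (a : R[i]) f g : Holder d delta f -> Holder d delta g ->
  Holder d delta (fun x => a * f x + g x).
Proof.
move=> hf hg; have [_ _ s] := nice_linear a (holder_nice hf) (holder_nice hg).
split => //; move: hf hg => [[M [fM fH]] _] [[N [gN gH]] _].
exists (normc a * M + N); split => x.
  apply: (le_trans (le_normcD _ _)).
  by apply: lerD => //; rewrite Normc.normcM ler_wpM2l.
move=> y; rewrite opprD addrACA -mulrBr mulrDl.
apply: (le_trans (le_normcD _ _)).
by apply: lerD => //; rewrite Normc.normcM -mulrA ler_wpM2l.
Qed.

(** Admissibility gives cut-off functions with no control on their range; clamping the real part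
    puts it in the unit interval and keeps the Hölder bound. *)
Definition clamp01 (t : R) : R := Num.max 0 (Num.min 1 t).

Lemma clamp01_itv t : 0 <= clamp01 t <= 1.
Proof. by rewrite /clamp01 le_max lexx /= ge_max ler01 /= ge_min lexx. Qed.

Lemma clamp01_dist s t : `|clamp01 s - clamp01 t| <= `|s - t|.
Proof.
rewrite /clamp01; case: (leP 1 s); case: (leP 1 t) => ? ?; rewrite ?maxEle;
  repeat case: ifP => //= ?; rewrite ?subrr ?normr0 //;
  repeat match goal with |- context [`|?x|] => case: (ger0P x) => ? end; lra.
Qed.

(** The approximants must stay supported in [W], so that the kernel pairing applies to them. *)
Definition approximable W h := forall e : R, 0 < e -> exists phi,
  [/\ Holder d delta phi, nonzero phi `<=` W &
      (nint setT (fun x => normc (h x - phi x) ^+ 2)%R <= e%:E)%E].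

(** Take compact sets [C] and [C'] filling [A] and its complement in [W] up to measure [e / 2] each.
    A cut-off equal to 1 on [C] and 0 on [C'] and off [W] differs from the indicator only on the two
    leftovers. *)
Lemma approximable_indic W A0 A : measurable (W : set (borel X)) -> qbounded d W ->
  A0 `<=` W -> separated d A0 (~` W) -> measurable (A : set (borel X)) ->
  A `<=` A0 -> approximable W (fun x => (\1_A x)%:C).
Proof.
move=> mW bW AW sAW mA AA0 e e0.
have e20 : 0 < e / 2 by lra.
have Afin : (mu A < +oo)%E.
  by apply: (qbounded_lty hd hX) => //; apply: qboundedS bW; exact: subset_trans AW.
have mWA : measurable (W `\` A : set (borel X)) by exact: measurableD.
have WAfin : (mu (W `\` A) < +oo)%E.
  by apply: (qbounded_lty hd hX) => //; apply: qboundedS bW => x [].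
have [C [cC CA muC]] := compact_approx hX mA Afin e20.
have [C' [cC' C'W muC']] := compact_approx hX mWA WAfin e20.
have sep : separated d C (C' `|` ~` W).
  apply: separatedUr; last by apply: separatedS sAW => //; exact: subset_trans CA AA0.
  apply: (compact_separated hd hX) => //; apply/seteqP; split => // x [Cx /C'W [_]].
  by apply; exact: CA.
have bC : qbounded d C.
  by apply: qboundedS bW; apply: subset_trans (subset_trans CA AA0) AW.
have [phi [[M [phiM phiH]] sphi] [phi1 phi0]] := hadm bC sep.
pose psi x : R := clamp01 (complex.Re (phi x)).
have psi1 x : C x -> psi x = 1.
  by move=> Cx; rewrite /psi phi1 // /clamp01 minxx maxEle ler01.
have psi0 x : phi x = 0 -> psi x = 0.
  by move=> e1; rewrite /psi e1 /clamp01 minEle ler10 /= maxxx.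
have psiM x : 0 <= psi x <= 1 by exact: clamp01_itv.
exists (fun x => (psi x)%:C); split.
- split; last first.
    by apply: qboundedS sphi => x /= nz p0; apply: nz; rewrite psi0.
  exists (`|M| + 1); split => x.
    rewrite normc_real; have /andP[p0 p1] := psiM x.
    by rewrite ger0_norm //; have := normr_ge0 M; lra.
  move=> y; have -> : (psi x)%:C - (psi y)%:C = (psi x - psi y)%:C by rewrite rmorphB.
  rewrite normc_real; apply: (le_trans (clamp01_dist _ _)).
  rewrite -ReB; apply: (le_trans (Re_le_normc _)); apply: (le_trans (phiH x y)).
  apply: ler_wpM2r; first exact: powR_ge0.
  by have := ler_norm M; lra.
- move=> x /= nz; apply: contrapT => nW; apply: nz.
  by rewrite psi0 // phi0 //; right.
- have mD1 : measurable (A `\` C : set (borel X)).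
    by apply: measurableD => //; exact: (compact_measurable_borel hX).
  have mD2 : measurable ((W `\` A) `\` C' : set (borel X)).
    by apply: measurableD => //; exact: (compact_measurable_borel hX).
  apply: (@le_trans _ _ (mu (A `\` C) + mu ((W `\` A) `\` C'))%E); last first.
    by apply: le_trans (leeD muC muC') _; rewrite -EFinD lee_fin; lra.
  rewrite -[X in (X + _)%E]mul1e -[X in (_ + X)%E]mul1e -!nint_cst //.
  rewrite -(setTI (A `\` C)) -(setTI ((W `\` A) `\` C')) -!nint_indic -nintD //; last 2 first.
  + by apply: measurable_funM => //; exact: measurable_indic.
  + by apply: measurable_funM => //; exact: measurable_indic.
  apply: nint_le_fun => x _; apply/andP; split; first exact: exprn_ge0.
  rewrite !mul1r.
  rewrite -rmorphB normc_real real_normK ?num_real //.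
  have /andP[p0 p1] := psiM x.
  have i0 (S : set X) : 0 <= \1_S x :> R by [].
  have [Ax|nAx] := pselect (A x).
    rewrite [\1_A x]indicE mem_set //=.
    have [Cx|nCx] := pselect (C x).
      by rewrite psi1 // subrr expr0n /= addr_ge0.
    rewrite (_ : \1_(A `\` C) x = 1); last by rewrite indicE mem_set.
    by have := i0 ((W `\` A) `\` C'); nra.
  rewrite [\1_A x]indicE memNset //=.
  have [Wx|nWx] := pselect (W x); last first.
    by rewrite psi0 ?phi0 ?subrr ?expr0n ?addr_ge0 //; right.
  have [C'x|nC'x] := pselect (C' x).
    by rewrite psi0 ?phi0 ?subrr ?expr0n ?addr_ge0 //; left.
  rewrite (_ : \1_((W `\` A) `\` C') x = 1); last by rewrite indicE mem_set.
  by have := i0 (A `\` C); nra.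
Qed.

Lemma sqr_normcD_le (z w : R[i]) :
  normc (z + w) ^+ 2 <= 2 * normc z ^+ 2 + 2 * normc w ^+ 2.
Proof.
have h := le_normcD z w; have z0 := normc_ge0 z; have w0 := normc_ge0 w.
have : normc (z + w) ^+ 2 <= (normc z + normc w) ^+ 2.
  by rewrite ler_sqr // nnegrE ?addr_ge0.
have := sqr_ge0 (normc z - normc w); rewrite sqrrB sqrrD; lra.
Qed.

Lemma measurable_normc_sqr f : cm f ->
  measurable_fun setT ((fun x => normc (f x) ^+ 2) : borel X -> R).
Proof. by move=> mf; apply: measurable_funX; exact: measurable_normc. Qed.

Lemma nint_sqr_normcD f g : cm f -> cm g ->
  (nint setT (fun x => normc (f x + g x) ^+ 2)%R <=
   2%:E * nint setT (fun x => normc (f x) ^+ 2)%R +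
   2%:E * nint setT (fun x => normc (g x) ^+ 2)%R)%E.
Proof.
move=> mf mg; have m1 := measurable_normc_sqr mf; have m2 := measurable_normc_sqr mg.
rewrite -!nintZ // => [|x|x]; [|exact: exprn_ge0|exact: exprn_ge0].
rewrite -nintD //; last 4 first.
- by apply: measurable_funM.
- by apply: measurable_funM.
- by move=> x; rewrite mulr_ge0 // exprn_ge0.
- by move=> x; rewrite mulr_ge0 // exprn_ge0.
by apply: nint_le_fun => x _; rewrite exprn_ge0 // sqr_normcD_le.
Qed.

Lemma approximable_linear W (a : R[i]) f g : cm f -> cm g ->
  approximable W f -> approximable W g -> approximable W (fun x => a * f x + g x).
Proof.
move=> mf mg af ag e e0.
pose s := e / 4 / (normc a ^+ 2 + 1).
have a1 : 0 < normc a ^+ 2 + 1 by rewrite ltr_wpDl // exprn_ge0.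
have s0 : 0 < s by rewrite divr_gt0 //; lra.
have e4 : 0 < e / 4 by lra.
have [p [hp pW pe]] := af s s0; have [q [hq qW qe]] := ag _ e4.
exists (fun x => a * p x + q x); split; first exact: holder_linear.
  move=> x /= nz; apply: contrapT => nW; apply: nz.
  have -> : p x = 0 by apply: contrapT => /pW.
  have -> : q x = 0 by apply: contrapT => /qW.
  by rewrite mulr0 addr0.
have [mp _ _] := holder_nice hp; have [mq _ _] := holder_nice hq.
have mfp := cmeasurableB mf mp.
have -> : (fun x => normc (a * f x + g x - (a * p x + q x)) ^+ 2) =
    (fun x => normc (a * (f x - p x) + (g x - q x)) ^+ 2).
  by apply/funext => x; congr (normc _ ^+ 2); rewrite mulrBr opprD addrACA.
apply: le_trans (nint_sqr_normcD _ _) _.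
- by apply: cmeasurableM => //; exact: cmeasurable_cst.
- exact: cmeasurableB.
have -> : nint setT (fun x => normc (a * (f x - p x)) ^+ 2) =
   ((normc a ^+ 2)%:E * nint setT (fun x => normc (f x - p x) ^+ 2)%R)%E.
  rewrite -nintZ //; [|exact: measurable_normc_sqr|by move=> x; exact: exprn_ge0|exact: exprn_ge0].
  by apply: eq_nint => x _; rewrite Normc.normcM exprMn.
have n2 : (0 <= (normc a ^+ 2)%:E)%E by rewrite lee_fin exprn_ge0.
apply: le_trans (leeD (lee_wpmul2l _ (lee_wpmul2l n2 pe)) (lee_wpmul2l _ qe)) _;
  [by rewrite lee_fin..|].
rewrite -!EFinM -EFinD lee_fin.
have : normc a ^+ 2 * s <= e / 4.
  rewrite /s mulrA ler_pdivrMr // mulrC ler_wpM2l //; lra.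
lra.
Qed.

Lemma approximable_closed W f : cm f -> (forall e : R, 0 < e -> exists g,
    [/\ cm g, approximable W g &
    (nint setT (fun x => normc (f x - g x) ^+ 2)%R <= e%:E)%E]) -> approximable W f.
Proof.
move=> mf H e e0; have e4 : 0 < e / 4 by lra.
have [g [mg ag fg]] := H _ e4; have [p [hp pW gp]] := ag _ e4.
exists p; split => //; have [mp _ _] := holder_nice hp.
have -> : (fun x => normc (f x - p x) ^+ 2) =
    (fun x => normc ((f x - g x) + (g x - p x)) ^+ 2).
  by apply/funext => x; rewrite addrA subrK.
apply: le_trans (nint_sqr_normcD _ _) _; [exact: cmeasurableB..|].
apply: le_trans (leeD (lee_wpmul2l _ fg) (lee_wpmul2l _ gp)) _; [by rewrite lee_fin..|].
by rewrite -!EFinM -EFinD lee_fin; lra.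
Qed.

Section Dense.
Variables (A0 W : set X).
Hypotheses (mA0 : measurable (A0 : set (borel X))) (mW : measurable (W : set (borel X))).
Hypotheses (bW : qbounded d W) (AW : A0 `<=` W) (sAW : separated d A0 (~` W)).

(** Binary expansion: subtracting [M / 2] where [u > M / 2] leaves a function with values between 0
    and [M / 2], so [n] steps express [u] by indicators up to an error [M / 2 ^+ n] on [A0]. *)
Lemma approximable_nneg (u : X -> R) (M : R) :
  measurable_fun setT (u : borel X -> R) -> (forall x, 0 <= u x <= M) ->
  (forall x, ~ A0 x -> u x = 0) -> approximable W (fun x => (u x)%:C).
Proof.
move=> mfu uM u0.
have step n : forall (u : X -> R) (M : R), measurable_fun setT (u : borel X -> R) ->
    (forall x, 0 <= u x <= M) -> (forall x, ~ A0 x -> u x = 0) ->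
    exists g : X -> R, [/\ measurable_fun setT (g : borel X -> R),
      approximable W (fun x => (g x)%:C) &
      forall x, 0 <= u x - g x <= M / 2 ^+ n * \1_A0 x].
  elim: n => [|n IH] {mfu uM u0} {}u {}M mfu uM u0.
    exists (fun=> 0); split; first exact: measurable_cst.
      move=> e e0; exists (fun=> 0); split.
      - split; last by exists point, 1 => x /=.
        by exists 0; split => *; rewrite ?subrr Normc.normc0 ?mul0r.
      - by move=> x /=.
      - rewrite (_ : (fun x => _) = (fun=> 0)) ?nint0 ?lee_fin ?ltW //.
        by apply/funext => x; rewrite subrr Normc.normc0 expr0n.
    move=> x; rewrite subr0 expr0 divr1; have /andP[p0 p1] := uM x; rewrite p0 /=.
    have [Ax|nAx] := pselect (A0 x); first by rewrite indicE mem_set // mulr1.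
    by rewrite u0 // indicE memNset // mulr0.
  pose A := [set x | M / 2 < u x].
  have mA : measurable (A : set (borel X)) by exact: measurable_gt.
  have M0 : 0 <= M by have /andP[h1 h2] := uM point; apply: le_trans h2.
  have AA0 : A `<=` A0.
    move=> x /= Ax; apply: contrapT => nA; move: Ax; rewrite /A /= u0 //; lra.
  pose v x := u x - M / 2 * \1_A x.
  have mi : measurable_fun setT ((fun x => M / 2 * \1_A x) : borel X -> R).
    by apply: measurable_funM => //; exact: measurable_indic.
  have mv : measurable_fun setT (v : borel X -> R) by exact: measurable_funB.
  have [||g [mg ag gM]] := IH v (M / 2) mv.
  - move=> x; rewrite /v indic_bool; have /andP[p0 p1] := uM x.
    by case: ltP => /= h; apply/andP; split; lra.
  - move=> x nA; rewrite /v u0 // indicE memNset ?mulr0 ?subr0 //.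
    by move=> /AA0.
  exists (fun x => M / 2 * \1_A x + g x); split.
  - exact: measurable_funD.
  - have := approximable_linear (M / 2)%:C (cmeasurable_indic R mA)
      (cmeasurable_real mg) (approximable_indic mW bW AW sAW mA AA0) ag.
    by under eq_fun do rewrite -rmorphM -rmorphD.
  - move=> x; have := gM x; rewrite /v opprD addrA exprS invfM [2^-1 * _]mulrC mulrA.
    by rewrite [M / 2 / _]mulrAC.
have mu_ : cm (fun x => (u x)%:C) by exact: cmeasurable_real.
apply: approximable_closed => // e e0.
have A0fin : (mu A0 < +oo)%E.
  by apply: (qbounded_lty hd hX) => //; exact: qboundedS bW.
have vE : mu A0 = (fine (mu A0))%:E by rewrite fineK // ge0_fin_numE.
set v := fine (mu A0) in vE.
have v0 : 0 <= v by rewrite -lee_fin -vE.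
have M0 : 0 <= M by have /andP[h1 h2] := uM point; apply: le_trans h2.
have [n hn] := @expr_unbounded R 2 (Num.max 1 (M ^+ 2 * v / e)) (ltr1n _ 2).
have [g [mg ag gM]] := step n u M mfu uM u0.
have mcg : cm (fun x => (g x)%:C) by exact: cmeasurable_real.
exists (fun x => (g x)%:C); split => //.
have n1 : 1 < 2 ^+ n :> R by apply: le_lt_trans hn; rewrite le_max lexx.
have hn2 : M ^+ 2 * v / e < 2 ^+ n.
  by apply: le_lt_trans hn; rewrite le_max lexx orbT.
have n0 : 0 < 2 ^+ n :> R by rewrite exprn_gt0.
apply: (@le_trans _ _ (nint A0 (fun=> (M / 2 ^+ n) ^+ 2))); last first.
  rewrite nint_cst // vE -EFinM lee_fin expr_div_n mulrAC ler_pdivrMr ?exprn_gt0 //.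
  move: hn2; rewrite ltr_pdivrMr // => /ltW /le_trans; apply.
  rewrite mulrC ler_pM2l // expr2 ler_peMr // ?ltW //.
rewrite -(setTI A0) -nint_indic; apply: nint_le_fun => x _; apply/andP; split; first exact: exprn_ge0.
rewrite -rmorphB normc_real; have /andP[h1 h2] := gM x.
rewrite ger0_norm //.
have -> : (M / 2 ^+ n) ^+ 2 * \1_A0 x = (M / 2 ^+ n * \1_A0 x) ^+ 2.
  by rewrite [RHS]exprMn indicE; case: (_ \in _); rewrite /= ?mulr1n ?expr1n ?expr0n.
by rewrite ler_sqr ?nnegrE ?mulr_ge0 // ?divr_ge0 // ltW.
Qed.

Lemma holder_dense h : nice h -> nonzero h `<=` A0 -> approximable W h.
Proof.
move=> [mh [M hM] _] hA.
have h0 x : ~ A0 x -> h x = 0 by move=> nA; apply: contrapT => /hA.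
have pos (v : X -> R) : measurable_fun setT (v : borel X -> R) ->
    (forall x, `|v x| <= M) -> (forall x, ~ A0 x -> v x = 0) ->
    approximable W (fun x => (v x)%:C).
  move=> mv vM v0.
  have mp : measurable_fun setT ((fun x => Num.max (v x) 0) : borel X -> R).
    exact: (measurable_maxr mv (@measurable_cst _ _ (borel X) R setT 0)).
  have mn : measurable_fun setT ((fun x => Num.max (- v x) 0) : borel X -> R).
    exact: (measurable_maxr (measurable_funN mv) (@measurable_cst _ _ (borel X) R setT 0)).
  have ap : approximable W (fun x => (Num.max (v x) 0)%:C).
    apply: (@approximable_nneg _ M) => // [x|x nA]; last by rewrite v0 // maxxx.
    rewrite le_max lexx orbT /= ge_max (le_trans (ler_norm _)) //=.
    by apply: le_trans (vM x).
  have an : approximable W (fun x => (Num.max (- v x) 0)%:C).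
    apply: (@approximable_nneg _ M) => // [x|x nA]; last by rewrite v0 // oppr0 maxxx.
    rewrite le_max lexx orbT /= ge_max (le_trans (ler_norm _)) ?normrN //=.
    by apply: le_trans (vM x).
  have := approximable_linear (-1) (cmeasurable_real mn) (cmeasurable_real mp) an ap.
  congr approximable; apply/funext => x; rewrite mulN1r -rmorphN -rmorphD; congr (_%:C).
  by rewrite !maxEle oppr_le0; case: leP => ?; case: leP => ?; lra.
have [m1 m2] := mh.
have aR : approximable W (fun x => (complex.Re (h x))%:C).
  apply: pos => // [x|x nA]; last by rewrite h0.
  by apply: le_trans (hM x); exact: Re_le_normc.
have aI : approximable W (fun x => (complex.Im (h x))%:C).
  apply: pos => // [x|x nA]; last by rewrite h0.
  by apply: le_trans (hM x); exact: Im_le_normc.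
have := approximable_linear 'i (cmeasurable_real m2) (cmeasurable_real m1) aI aR.
congr approximable; apply/funext => x; case: (h x) => a e /=.
by simpc.
Qed.

End Dense.
End HolderDensity.

(** * The kernel representation *)

Lemma measurable_param_Rintegral d1 d2 (T1 : measurableType d1) (T2 : measurableType d2)
    (R : realType) (mu : {measure set T2 -> \bar R}) (g : T1 * T2 -> R) :
  sigma_finite setT mu -> measurable_fun setT g ->
  measurable_fun setT (fun x => (\int[mu]_y g (x, y))%R).
Proof.
move=> sf mg.
(* [mu] comes as a bare measure with sigma-finiteness as a hypothesis; it is packaged so that
   Tonelli's theorem applies. *)
pose H1 := isSFinite.Build _ _ _ _ (sfinite_measure_sigma_finite sf).
pose H2 := isSigmaFinite.Build _ _ _ _ sf.
pose m := HB.pack_for (SigmaFiniteMeasure.type T2 R) (Measure.sort mu) H1 H2.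
have me : measurable_fun setT (EFin \o g) by exact/measurable_EFinP.
have mp := @measurable_fun_fubini_tonelli_F _ _ T1 T2 R m _
  (measurable_funepos me) (funepos_ge0 _).
have mn := @measurable_fun_fubini_tonelli_F _ _ T1 T2 R m _
  (measurable_funeneg me) (funeneg_ge0 _).
have := measurableT_comp (fine_measurable measurableT) (emeasurable_funB mp mn).
congr measurable_fun; apply/funext => x; rewrite /Rintegral [in RHS]integralE.
by rewrite /= /fubini_F; congr (fine (_ - _)%E); apply: eq_integral => y _;
  rewrite ?funeposE ?funenegE.
Qed.

Lemma cmeasurable_param_cintegral d1 d2 (T1 : measurableType d1) (T2 : measurableType d2)
    (R : realType) (mu : {measure set T2 -> \bar R}) (g : T1 * T2 -> R[i]) :
  sigma_finite setT mu -> cmeasurable setT g ->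
  cmeasurable setT (fun x => cintegral mu setT (fun y => g (x, y))).
Proof.
move=> sf [g1 g2]; split.
- exact: (measurable_param_Rintegral sf g1).
- exact: (measurable_param_Rintegral sf g2).
Qed.

Lemma cmeasurable_comp d1 d2 (T1 : measurableType d1) (T2 : measurableType d2)
    (R : realType) (g : T2 -> R[i]) (f : T1 -> T2) : measurable_fun setT f ->
  cmeasurable setT g -> cmeasurable setT (g \o f).
Proof.
by move=> mf [g1 g2]; split; [exact: (measurableT_comp g1 mf)|exact: (measurableT_comp g2 mf)].
Qed.

(** Cauchy-Schwarz with a parameter, from the square of [s * u - v]. The parameter is left free and
    eliminated at the end by [le0_div_all]. *)
Lemma nint_mul_le d (T : measurableType d) (R : realType)
    (mu : {measure set T -> \bar R}) A (u v : T -> R) (s : R) : 0 < s ->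
  measurable A -> measurable_fun setT u -> measurable_fun setT v ->
  (forall x, 0 <= u x) -> (forall x, 0 <= v x) ->
  (nint mu A (fun x => (u x * v x)%R) <= s%:E * nint mu A (fun x => (u x ^+ 2)%R) +
    (s^-1)%:E * nint mu A (fun x => (v x ^+ 2)%R))%E.
Proof.
move=> s0 mA mfu mv u0 v0.
have m2 (w : T -> R) : measurable_fun setT w -> measurable_fun setT (fun x => w x ^+ 2).
  by move=> mw; exact: measurable_funX.
rewrite -!nintZ //; [|exact: m2|by move=> x; exact: sqr_ge0|by rewrite invr_ge0 ltW
  |exact: m2|by move=> x; exact: sqr_ge0|exact: ltW].
rewrite -nintD //; last 4 first.
- by apply: measurable_funM => //; exact: m2.
- by apply: measurable_funM => //; exact: m2.
- by move=> x; rewrite mulr_ge0 ?sqr_ge0 // ltW.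
- by move=> x; rewrite mulr_ge0 ?sqr_ge0 // invr_ge0 ltW.
apply: nint_le_fun => x _; rewrite mulr_ge0 //=.
have h : 0 <= s^-1 * (s * u x - v x) ^+ 2 by rewrite mulr_ge0 ?sqr_ge0 // invr_ge0 ltW.
have e : s^-1 * (s * u x - v x) ^+ 2 =
    s * u x ^+ 2 - 2 * (u x * v x) + s^-1 * v x ^+ 2 by field; rewrite gt_eqF.
by have := mulr_ge0 (u0 x) (v0 x); lra.
Qed.

Lemma le0_div_all (R : realType) (a D : R) :
  (forall s, 0 < s -> a <= D / s) -> a <= 0.
Proof.
move=> H; rewrite leNgt; apply/negP => a0.
pose s := (`|D| + 1) / a; have D1 : 0 < `|D| + 1 by rewrite ltr_wpDl.
have s0 : 0 < s by rewrite divr_gt0.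
have := H s s0; rewrite ler_pdivlMr // /s mulrC divfK ?gt_eqF //.
by have := ler_norm D; lra.
Qed.

Section KernelRepresentation.
Context (R : realType) (X : ptopologicalType) (d : X -> X -> R).
Context (mu : {measure set (borel X) -> \bar R}) (c K : R).
Hypothesis hd : quasi_metric d.
Hypothesis hX : homogeneous_type mu (qball d) c K.
Local Notation B := (qball d).
Local Notation nint A u := (nint mu A%classic u%R).
Local Notation cm f := (cmeasurable [set: borel X] f).
Local Notation nice := (nice d).
Let c0 : 0 < c := c_gt0 hX.
Let K0 : 0 < K := K_gt0 hX.
Implicit Types (f g h : X -> R[i]) (A E F W : set X).

Variable delta : R.
Hypothesis delta0 : 0 < delta.
Hypothesis hadm : admissible d delta.

Variables (k : X -> X -> R[i]) (Ck : R).
Hypothesis Ck0 : 0 < Ck.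
Hypothesis mk : cmeasurable [set: borel X * borel X] (fun z => k z.1 z.2).
Hypothesis ksize : forall x y, x <> y -> normc (k x y) <= Ck / lambda mu d x y.

Variables (T2 : (X -> R[i]) -> X -> R[i]) (C2 : R).
Hypothesis C20 : 0 <= C2.
Hypothesis mT : forall f, nice f -> cm (T2 f).
Hypothesis linT : forall a f g, nice f -> nice g ->
  {ae mu, forall x, T2 (fun y => a * f y + g y) x = a * T2 f x + T2 g x}.
Hypothesis bndT : forall f, nice f -> (nint setT (fun x => normc (T2 f x) ^+ 2)%R <=
  C2%:E * nint setT (fun x => normc (f x) ^+ 2)%R)%E.
Hypothesis repT : forall f g, Holder d delta f -> Holder d delta g ->
  separated d (nonzero f) (nonzero g) ->
  cintegral mu setT (fun x => T2 f x * g x) = cintegral mu setT (fun x =>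
    cintegral mu setT (fun y => k x y * f y * g x)).

Definition kernel_op h x : R[i] := cintegral mu setT (fun y => k x y * h y).

Lemma homogeneous_sigma_finite : sigma_finite [set: borel X] mu.
Proof.
have x0 : X := point.
exists (fun n => B x0 n.+1%:R).
  apply/seteqP; split => // x _; exists (Num.truncn (d x0 x)) => //.
  by rewrite /qball /=; have /andP[] := truncn_itv (dist_ge0 hd x0 x).
move=> n; split; first by apply: (measurable_qball hX); rewrite ltr0n.
by rewrite (volE hX) ?ltr0n // ltry.
Qed.

Lemma cmeasurable_kernel_op h : cm h -> cm (kernel_op h).
Proof.
move=> mh; apply: (@cmeasurable_param_cintegral _ _ (borel X) (borel X) R mu
  (fun z => k z.1 z.2 * h z.2)); first exact: homogeneous_sigma_finite.
apply: cmeasurableM => //.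
exact: (cmeasurable_comp (@measurable_snd _ _ (borel X) (borel X)) mh).
Qed.

Lemma cmeasurable_kernel_section x : cm (k x).
Proof.
exact: (cmeasurable_comp (@pair1_measurable _ _ (borel X) (borel X) x) mk).
Qed.

Lemma kernel_bounded F W : qbounded d F -> separated d F W -> exists2 kap : R,
  0 < kap & forall x y, F x -> W y -> normc (k x y) <= kap.
Proof.
move=> bF [eta eta0 FW]; have [v v0 hv] := vol_lower_bound hd hX bF eta0.
exists (Ck / v) => [|x y Fx Wy]; first exact: divr_gt0.
have xy : x <> y.
  by move=> e; have := FW x y Fx Wy; rewrite e (distxx hd) leNgt eta0.
apply: (le_trans (ksize xy)); apply: ler_wpM2l; first exact: ltW.
by rewrite lef_pV2 ?posrE //; [exact/hv/FW|exact: lt_le_trans (hv _ _ Fx (FW _ _ Fx Wy))].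
Qed.

Section Separated.
Variables (F W : set X) (kap : R).
Hypothesis kap0 : 0 < kap.
Hypothesis kapP : forall x y, F x -> W y -> normc (k x y) <= kap.

Lemma kernel_nint h x : nice h -> nonzero h `<=` W -> F x ->
  (nint setT (fun y => normc (k x y * h y))%R <=
   kap%:E * nint setT (fun y => normc (h y))%R)%E.
Proof.
move=> [mh _ _] hW Fx; rewrite -nintZ //; [|exact: measurable_normc|exact: ltW].
apply: nint_le_fun => y _; rewrite normc_ge0 Normc.normcM /=.
have [hy|hy] := pselect (h y = 0); first by rewrite hy Normc.normc0 !mulr0.
by apply: ler_wpM2r => //; apply: kapP => //; exact: hW.
Qed.

Lemma kernel_nint_lty h x : nice h -> nonzero h `<=` W -> F x ->
  (nint setT (fun y => normc (k x y * h y))%R < +oo)%E.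
Proof.
move=> nh hW Fx; apply: le_lt_trans (kernel_nint nh hW Fx) _.
have := nice_L1 hd hX nh; have := nint_ge0 mu (A := setT) (fun x _ => normc_ge0 (h x)).
by case: (nint _ _) => [r| |] // _ _; rewrite -?EFinM ltry.
Qed.

Lemma kernel_cintegrable h x : nice h -> nonzero h `<=` W -> F x ->
  cintegrable mu setT (fun y => k x y * h y).
Proof.
move=> nh hW Fx; apply: cintegrable_normc => //; last exact: kernel_nint_lty.
by have [mh _ _] := nh; apply: cmeasurableM => //; exact: cmeasurable_kernel_section.
Qed.

Lemma kernel_op_bound h x : nice h -> nonzero h `<=` W -> F x ->
  ((normc (kernel_op h x))%:E <= (2 * kap)%:E * nint setT (fun y => normc (h y))%R)%E.
Proof.
move=> nh hW Fx; apply: (le_trans (normc_cintegral_le _ _ _)) => //.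
- by have [mh _ _] := nh; apply: cmeasurableM => //; exact: cmeasurable_kernel_section.
- exact: kernel_nint_lty.
by rewrite EFinM -muleA; apply: lee_wpmul2l => //; exact: kernel_nint.
Qed.

Lemma kernel_opB h g x : nice h -> nice g -> nonzero h `<=` W -> nonzero g `<=` W ->
  F x -> kernel_op (fun y => h y - g y) x = kernel_op h x - kernel_op g x.
Proof.
move=> nh ng hW gW Fx; rewrite /kernel_op -cintegralB //; last 2 first.
- exact: kernel_cintegrable.
- exact: kernel_cintegrable.
by apply: eq_cintegral => y _; rewrite mulrBr.
Qed.

End Separated.

Section Representation.
Variables (A0 W F0 F : set X).
Hypotheses (mA0 : measurable (A0 : set (borel X))) (mW : measurable (W : set (borel X))).
Hypotheses (mF0 : measurable (F0 : set (borel X))) (mF : measurable (F : set (borel X))).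
Hypotheses (bW : qbounded d W) (bF : qbounded d F) (AW : A0 `<=` W) (FF : F0 `<=` F).
Hypotheses (sAW : separated d A0 (~` W)) (sFF : separated d F0 (~` F)).
Hypothesis sFW : separated d F W.

Lemma cm_L2_mul f g : cm f -> cm g ->
  (nint setT (fun x => normc (f x) ^+ 2)%R < +oo)%E ->
  (nint setT (fun x => normc (g x) ^+ 2)%R < +oo)%E ->
  (nint setT (fun x => normc (f x * g x))%R < +oo)%E.
Proof.
move=> mf mg f2 g2.
rewrite (@eq_nint _ _ _ mu _ _ (fun x => normc (f x) * normc (g x))%R); last first.
  by move=> x _; rewrite Normc.normcM.
apply: le_lt_trans (nint_mul_le mu ltr01 measurableT (measurable_normc mf)
  (measurable_normc mg) (fun x => normc_ge0 _) (fun x => normc_ge0 _)) _.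
by rewrite invr1 !mul1e lte_add_pinfty.
Qed.

Lemma T2_L2 f : nice f -> (nint setT (fun x => normc (T2 f x) ^+ 2)%R < +oo)%E.
Proof.
move=> nf; apply: le_lt_trans (bndT nf) _.
have := nice_L2 hd hX nf; have := nint_ge0 mu (A := setT) (fun x _ => sqr_ge0 (normc (f x))).
by case: (nint _ _) => [r| |] // _ _; rewrite -?EFinM ltry.
Qed.

Lemma bndTB f g : nice f -> nice g ->
  (nint setT (fun x => normc (T2 f x - T2 g x) ^+ 2)%R <=
   C2%:E * nint setT (fun x => normc (f x - g x) ^+ 2)%R)%E.
Proof.
move=> nf ng; have nfg := niceB hd hX nf ng.
apply: le_trans (bndT nfg); apply: nint_ae_le => //.
- by apply: measurable_normc_sqr; apply: cmeasurableB; exact: mT.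
- by apply: measurable_normc_sqr; exact: mT.
- by move=> x; exact: sqr_ge0.
- by move=> x; exact: sqr_ge0.
have := linT (-1) ng nf; apply: ae_mono => x + _.
under [X in T2 X]eq_fun do rewrite mulN1r addrC.
by move=> ->; rewrite mulN1r addrC.
Qed.

(** For Hölder functions supported in [W] this is the hypothesis on the pairing. Both sides are
    continuous in [h]: the left by the L^2 bound, the right because the kernel is bounded on [F]
    times [W] and L^2 controls L^1 on the bounded set [W]. *)
Lemma kernel_pairing h g : nice h -> nonzero h `<=` A0 -> Holder d delta g ->
  nonzero g `<=` F ->
  cintegral mu setT (fun x => T2 h x * g x) = cintegral mu setT (fun x => kernel_op h x * g x).
Proof.
move=> nh hA Hg gF; have ng := holder_nice hd hX delta0 Hg.
have [mh _ _] := nh; have [mg [Mg gM] _] := ng.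
have [kap kap0 kapP] := kernel_bounded bF sFW.
have hW : nonzero h `<=` W by exact: subset_trans AW.
have KL f : nice f -> nonzero f `<=` W ->
    (nint setT (fun x => normc (kernel_op f x * g x))%R <=
     (2 * kap)%:E * nint setT (fun y => normc (f y))%R * nint setT (fun y => normc (g y))%R)%E.
  move=> nf fW; have f1 := nice_L1 hd hX nf.
  have f0 := nint_ge0 mu (A := setT) (fun x _ => normc_ge0 (f x)).
  have kb := kernel_op_bound kap0 kapP nf fW.
  move: f1 f0 kb; case: (nint setT (fun x => normc (f x))%R) => [r| |] // _.
  rewrite lee_fin => r0 kb; rewrite -EFinM -nintZ //; [|exact: measurable_normc|].
    apply: nint_le_fun => x _; rewrite normc_ge0 Normc.normcM /=.
    have [gx|gx] := pselect (g x = 0); first by rewrite gx Normc.normc0 !mulr0.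
    by apply: ler_wpM2r => //; have := kb x (gF _ gx); rewrite -EFinM lee_fin.
  by rewrite !mulr_ge0 // ltW.
have KLf f : nice f -> nonzero f `<=` W ->
    (nint setT (fun x => normc (kernel_op f x * g x))%R < +oo)%E.
  move=> nf fW; apply: le_lt_trans (KL f nf fW) _.
  have := nice_L1 hd hX nf; have := nint_ge0 mu (A := setT) (fun x _ => normc_ge0 (f x)).
  have := nice_L1 hd hX ng; have := nint_ge0 mu (A := setT) (fun x _ => normc_ge0 (g x)).
  case: (nint setT (fun x => normc (g x))%R) => [s| |] // _ _.
  by case: (nint setT (fun x => normc (f x))%R) => [r| |] // _ _; rewrite -?EFinM ltry.
have Ki f : nice f -> nonzero f `<=` W -> cintegrable mu setT (fun x => kernel_op f x * g x).
  move=> nf fW; apply: cintegrable_normc => //; last exact: KLf.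
  by have [mf _ _] := nf; exact: (cmeasurableM (cmeasurable_kernel_op mf) mg).
have Tf f : nice f -> (nint setT (fun x => normc (T2 f x * g x))%R < +oo)%E.
  by move=> nf; apply: cm_L2_mul; [exact: mT|by []|exact: T2_L2|exact: (nice_L2 hd hX ng)].
have Ti f : nice f -> cintegrable mu setT (fun x => T2 f x * g x).
  move=> nf; apply: cintegrable_normc => //; last exact: Tf.
  by apply: cmeasurableM => //; exact: mT.
pose G := fine (nint setT (fun x => normc (g x) ^+ 2)%R).
have GE : nint setT (fun x => normc (g x) ^+ 2)%R = G%:E.
  rewrite fineK // ge0_fin_numE; first exact: (nice_L2 hd hX ng).
  by apply: nint_ge0 => x _; exact: sqr_ge0.
pose G1 := fine (nint setT (fun x => normc (g x))%R).
have G1E : nint setT (fun x => normc (g x))%R = G1%:E.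
  by rewrite fineK // ge0_fin_numE; [exact: (nice_L1 hd hX ng)|exact: nint_ge0].
have G10 : 0 <= G1 by rewrite -lee_fin -G1E nint_ge0.
pose w := fine (mu W).
have wE : mu W = w%:E.
  by rewrite fineK // ge0_fin_numE //; exact: (qbounded_lty hd hX).
apply/eqP; rewrite -subr_eq0 -normc_eq0 eq_le normc_ge0 andbT.
apply: (@le0_div_all _ _ (2 * (C2 + G) + 4 * kap * G1 * (w + 1))) => s s0.
(* An L^2 error of [1 / s ^+ 2], weighted by [s] in the parametrised Cauchy-Schwarz inequality,
   leaves a total error of order [1 / s]. *)
have e0 : 0 < (s ^+ 2)^-1 by rewrite invr_gt0 exprn_gt0.
have [p [Hp pW pe]] := holder_dense hd hX delta0 hadm mA0 mW bW AW sAW nh hA e0.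
have np := holder_nice hd hX delta0 Hp; have [mp _ _] := np.
have repp : cintegral mu setT (fun x => T2 p x * g x) =
    cintegral mu setT (fun x => kernel_op p x * g x).
  rewrite repT //; last first.
    by apply: (separated_sym hd); exact: separatedS gF pW sFW.
  apply: eq_cintegral => x _; rewrite /kernel_op.
  have [gx|gx] := pselect (g x = 0).
    rewrite gx mulr0 (eq_cintegral mu (g := fun=> 0 * 0)); last by move=> y _; rewrite !mulr0.
    rewrite cintegralZ ?mul0r //; split; exact: integrable0.
  have ki := kernel_cintegrable kap0 kapP np pW (gF _ gx).
  rewrite mulrC -cintegralZ //; apply: eq_cintegral => y _.
  by rewrite mulrC.
have nhp := niceB hd hX nh np.
have hpW : nonzero (fun x => h x - p x) `<=` W.
  move=> x /= nz; apply: contrapT => nWx; apply: nz.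
  have -> : h x = 0 by apply: contrapT => /hW.
  have -> : p x = 0 by apply: contrapT => /pW.
  by rewrite subr0.
have -> : cintegral mu setT (fun x => T2 h x * g x) -
    cintegral mu setT (fun x => kernel_op h x * g x) =
    cintegral mu setT (fun x => T2 h x * g x - T2 p x * g x) -
    cintegral mu setT (fun x => kernel_op h x * g x - kernel_op p x * g x).
  rewrite !cintegralB //; [|exact: Ki|exact: Ki|exact: Ti|exact: Ti].
  by rewrite repp opprB addrA subrK.
apply: (le_trans (normcB_le _ _)).
have b1 : normc (cintegral mu setT (fun x => T2 h x * g x - T2 p x * g x)) <=
    2 * (C2 + G) / s.
  have mTT : cm (fun x => T2 h x - T2 p x) by apply: cmeasurableB; exact: mT.
  have TT2 : (nint setT (fun x => normc (T2 h x - T2 p x) ^+ 2)%R <= (C2 / s ^+ 2)%:E)%E.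
    apply: (le_trans (bndTB nh np)); rewrite EFinM.
    by apply: lee_wpmul2l; rewrite ?lee_fin.
  have -> : (fun x => T2 h x * g x - T2 p x * g x) = (fun x => (T2 h x - T2 p x) * g x).
    by apply/funext => x; rewrite mulrBl.
  rewrite -lee_fin; apply: (le_trans (normc_cintegral_le _ _ _)) => //.
  - exact: cmeasurableM.
  - apply: cm_L2_mul => //; last exact: (nice_L2 hd hX ng).
    by apply: le_lt_trans TT2 _; rewrite ltry.
  rewrite -mulrA EFinM; apply: lee_wpmul2l => //.
  rewrite (@eq_nint _ _ _ mu _ _ (fun x => normc (T2 h x - T2 p x) * normc (g x))%R); last first.
    by move=> x _; rewrite Normc.normcM.
  apply: le_trans (nint_mul_le mu s0 measurableT (measurable_normc mTT)
    (measurable_normc mg) (fun x => normc_ge0 _) (fun x => normc_ge0 _)) _.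
  rewrite GE; apply: le_trans (leeD (lee_wpmul2l _ TT2) (lexx _)) _.
    by rewrite lee_fin ltW.
  rewrite -!EFinM -EFinD lee_fin le_eqVlt; apply/orP; left; apply/eqP.
  by field; rewrite gt_eqF.
have b2 : normc (cintegral mu setT (fun x => kernel_op h x * g x - kernel_op p x * g x)) <=
    4 * kap * G1 * (w + 1) / s.
  have -> : cintegral mu setT (fun x => kernel_op h x * g x - kernel_op p x * g x) =
      cintegral mu setT (fun x => kernel_op (fun y => h y - p y) x * g x).
    apply: eq_cintegral => x _; rewrite -mulrBl.
    have [gx|gx] := pselect (g x = 0); first by rewrite gx !mulr0.
    by rewrite (kernel_opB kap0 kapP) //; exact: gF.
  rewrite -lee_fin; apply: (le_trans (normc_cintegral_le _ _ _)) => //.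
  - by have [mhp _ _] := nhp; exact: (cmeasurableM (cmeasurable_kernel_op mhp) mg).
  - exact: KLf.
  apply: le_trans (lee_wpmul2l _ (KL _ nhp hpW)) _ => //.
  have l1 : (nint setT (fun y => normc (h y - p y))%R <= ((w + 1) / s)%:E)%E.
    have mhp : measurable_fun setT ((fun y => normc (h y - p y)) : borel X -> R).
      by apply: measurable_normc; exact: cmeasurableB.
    (* The second factor is the indicator of [W]; this turns the L^2 error on [W] into an L^1
       error. *)
    have := nint_mul_le mu s0 measurableT mhp (@measurable_indic _ (borel X) R setT _ mW)
      (fun x => normc_ge0 _) (fun x => (_ : 0 <= \1_W x :> R)).
    rewrite (@eq_nint _ _ _ mu _ (fun x => normc (h x - p x) * \1_W x)%R
      (fun x => normc (h x - p x))); last first.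
      move=> x _; rewrite indicE; case: (boolP (x \in W)) => xW; first by rewrite mulr1.
      rewrite mulr0 (_ : h x - p x = 0) ?Normc.normc0 //.
      by apply: contrapT => nz; move: xW; rewrite mem_set //; exact: hpW.
    rewrite (@eq_nint _ _ _ mu _ (fun x => \1_W x ^+ 2)%R (fun x => 1 * \1_W x)); last first.
      by move=> x _; rewrite indicE; case: (_ \in _); rewrite /= ?mul1r ?expr1n ?expr0n.
    rewrite nint_indic setTI nint_cst // mul1e wE => H.
    apply: le_trans (H _) _; first by move=> x.
    apply: le_trans (leeD (lee_wpmul2l _ pe) (lexx _)) _; first by rewrite lee_fin ltW.
    rewrite -!EFinM -EFinD lee_fin le_eqVlt; apply/orP; left; apply/eqP.
    by field; rewrite gt_eqF.
  rewrite G1E muleA muleA -!EFinM; apply: le_trans (lee_wpmul2r _ (lee_wpmul2l _ l1)) _.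
  - by rewrite lee_fin.
  - by rewrite lee_fin !mulr_ge0 // ltW.
  rewrite -!EFinM lee_fin le_eqVlt; apply/orP; left; apply/eqP; ring.
by rewrite mulrDl; exact: lerD.
Qed.

(** The difference [r] of the two sides is square integrable on [F] and annihilates Hölder functions
    supported there. By density it annihilates indicators of measurable subsets of [F0], so it
    vanishes almost everywhere on [F0]. The margins between [A0] and [W] and between [F0] and [F]
    make room for the approximants. *)
Lemma kernel_representation h : nice h -> nonzero h `<=` A0 ->
  {ae mu, forall x, F0 x -> T2 h x = kernel_op h x}.
Proof.
move=> nh hA; have [kap kap0 kapP] := kernel_bounded bF sFW.
have hW : nonzero h `<=` W by exact: subset_trans AW.
have [mh _ _] := nh.
pose r x := T2 h x - kernel_op h x.
have mr : cm r by apply: cmeasurableB; [exact: mT|exact: cmeasurable_kernel_op].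
pose D := fine (nint setT (fun y => normc (h y))%R).
have DE : nint setT (fun y => normc (h y))%R = D%:E.
  by rewrite fineK // ge0_fin_numE; [exact: (nice_L1 hd hX nh)|exact: nint_ge0].
have D0 : 0 <= D by rewrite -lee_fin -DE nint_ge0.
have Fw : (mu F < +oo)%E by exact: (qbounded_lty hd hX).
have r2 : (nint F (fun x => normc (r x) ^+ 2)%R < +oo)%E.
  apply: (@le_lt_trans _ _ (nint F (fun x => 2 * normc (T2 h x) ^+ 2 +
      2 * (2 * kap * D) ^+ 2)%R)).
    apply: nint_le_fun => x Fx; rewrite sqr_ge0 /=.
    have := sqr_normcD_le (T2 h x) (- kernel_op h x); rewrite normcN => /le_trans; apply.
    rewrite lerD2l ler_pM2l // ler_sqr ?nnegrE ?normc_ge0 ?mulr_ge0 ?(ltW kap0) //.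
    by have := kernel_op_bound kap0 kapP nh hW Fx; rewrite DE -EFinM lee_fin.
  have mT2 : measurable_fun setT ((fun x => normc (T2 h x) ^+ 2) : borel X -> R).
    by apply: measurable_normc_sqr; exact: mT.
  rewrite nintD //; last 3 first.
  - by apply: measurable_funM.
  - by move=> x; rewrite mulr_ge0 ?sqr_ge0.
  - by move=> x; rewrite mulr_ge0 ?sqr_ge0.
  rewrite nint_cst // nintZ //; last by move=> x; exact: sqr_ge0.
  apply: lte_add_pinfty; last first.
    have F1 : (0 <= mu F)%E by exact: measure_ge0.
    by move: Fw F1; case: (mu F) => [v| |] // _ _; rewrite -?EFinM ltry.
  have := T2_L2 nh; have le := nint_le_set mu (fun x => sqr_ge0 (normc (T2 h x))) (@subsetT _ F).
  move=> /(le_lt_trans le); have := nint_ge0 mu (A := F) (fun x _ => sqr_ge0 (normc (T2 h x))).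
  by case: (nint F _) => [v| |] // _ _; rewrite -?EFinM ltry.
pose V := fine (nint F (fun x => normc (r x) ^+ 2)%R).
have VE : nint F (fun x => normc (r x) ^+ 2)%R = V%:E.
  by rewrite fineK // ge0_fin_numE //; apply: nint_ge0 => x _; exact: sqr_ge0.
have prod u : nice u -> nonzero u `<=` F -> forall s, 0 < s ->
    (nint setT (fun x => normc (r x * u x))%R <= s%:E *
      nint setT (fun x => normc (u x) ^+ 2)%R + (V / s)%:E)%E.
  move=> nu uF s s0; have [mu' _ _] := nu.
  apply: (@le_trans _ _ (nint F (fun x => normc (u x) * normc (r x)))).
    rewrite -(setTI F) -nint_indic; apply: nint_le_fun => x _; rewrite normc_ge0 /=.
    rewrite Normc.normcM mulrC; have [ux|ux] := pselect (u x = 0).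
      by rewrite ux Normc.normc0 !mul0r.
    by rewrite indicE mem_set ?mulr1 //; exact: uF.
  apply: le_trans (nint_mul_le mu s0 mF (measurable_normc mu')
    (measurable_normc mr) (fun x => normc_ge0 _) (fun x => normc_ge0 _)) _.
  rewrite VE -EFinM [V / s]mulrC; apply: leeD => //; apply: lee_wpmul2l; first by rewrite lee_fin ltW.
  by apply: nint_le_set => // x; exact: sqr_ge0.
have prodf u : nice u -> nonzero u `<=` F ->
    (nint setT (fun x => normc (r x * u x))%R < +oo)%E.
  move=> nu uF; apply: le_lt_trans (prod u nu uF 1 ltr01) _.
  by rewrite mul1e lte_add_pinfty ?ltry //; exact: (nice_L2 hd hX nu).
have prodi u : nice u -> nonzero u `<=` F -> cintegrable mu setT (fun x => r x * u x).
  move=> nu uF; apply: cintegrable_normc => //; last exact: prodf.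
  by have [mu' _ _] := nu; exact: cmeasurableM.
have zero A : measurable (A : set (borel X)) -> A `<=` F0 -> cintegral mu A r = 0.
  move=> mA AF0; have bA : qbounded d A by apply: qboundedS bF; exact: subset_trans FF.
  have nA := nice_indic mA bA.
  have AF : nonzero (fun x => (\1_A x)%:C : R[i]) `<=` F.
    by move=> x /= nz; apply: FF; apply: AF0; apply: contrapT => nAx; apply: nz;
      rewrite indicE memNset.
  have AF0' : nonzero (fun x => (\1_A x)%:C : R[i]) `<=` F0.
    by move=> x /= nz; apply: AF0; apply: contrapT => nAx; apply: nz;
      rewrite indicE memNset.
  apply/eqP; rewrite -normc_eq0 eq_le normc_ge0 andbT.
  apply: (@le0_div_all _ _ (2 * (1 + V))) => s s0.
  have e0 : 0 < (s ^+ 2)^-1 by rewrite invr_gt0 exprn_gt0.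
  have [p [Hp pF pe]] := holder_dense hd hX delta0 hadm mF0 mF bF FF sFF nA AF0' e0.
  have np := holder_nice hd hX delta0 Hp; have [mp _ _] := np.
  have p0 : cintegral mu setT (fun x => r x * p x) = 0.
    have := kernel_pairing nh hA Hp pF => e.
    have -> : (fun x => r x * p x) = (fun x => T2 h x * p x - kernel_op h x * p x).
      by apply/funext => x; rewrite mulrBl.
    rewrite cintegralB ?e ?subrr //.
    - apply: cintegrable_normc => //; first by apply: cmeasurableM => //; exact: mT.
      by apply: cm_L2_mul => //; [exact: mT|exact: T2_L2|exact: (nice_L2 hd hX np)].
    - apply: cintegrable_normc => //.
        exact: (cmeasurableM (cmeasurable_kernel_op mh) mp).
      apply: (@le_lt_trans _ _ (nint setT (fun x => 2 * kap * D * normc (p x)))).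
        apply: nint_le_fun => x _; rewrite normc_ge0 Normc.normcM /=.
        have [px|px] := pselect (p x = 0); first by rewrite px Normc.normc0 !mulr0.
        apply: ler_wpM2r => //.
        by have := kernel_op_bound kap0 kapP nh hW (pF _ px); rewrite DE -EFinM lee_fin.
      rewrite nintZ //; [|exact: measurable_normc|by rewrite !mulr_ge0 // ltW].
      have := nice_L1 hd hX np; have := nint_ge0 mu (A := setT) (fun x _ => normc_ge0 (p x)).
      by case: (nint _ _) => [v| |] // _ _; rewrite -?EFinM ltry.
  have nAp := niceB hd hX nA np.
  have ApF : nonzero (fun x => (\1_A x)%:C - p x) `<=` F.
    move=> x /= nz; apply: contrapT => nFx; apply: nz.
    have -> : p x = 0 by apply: contrapT => /pF.
    have -> : (\1_A x)%:C = 0 :> R[i] by apply: contrapT => /AF.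
    by rewrite subr0.
  have -> : cintegral mu A r = cintegral mu setT (fun x => r x * ((\1_A x)%:C - p x)).
    rewrite -cintegral_indic -[LHS]subr0 -p0 -cintegralB //; last 2 first.
    - by have := prodi _ nA AF; under eq_fun do rewrite mulrC.
    - exact: prodi.
    by apply: eq_cintegral => x _; rewrite [RHS]mulrBr; congr (_ - _); exact: mulrC.
  rewrite -lee_fin; apply: (le_trans (normc_cintegral_le _ _ _)) => //.
  - by apply: cmeasurableM => //; have [] := nAp.
  - exact: prodf.
  rewrite -mulrA EFinM; apply: lee_wpmul2l => //.
  apply: le_trans (prod _ nAp ApF s s0) _.
  apply: le_trans (leeD (lee_wpmul2l _ pe) (lexx _)) _; first by rewrite lee_fin ltW.
  rewrite -EFinM -EFinD lee_fin le_eqVlt; apply/orP; left; apply/eqP.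
  by field; rewrite gt_eqF.
have bF0 : qbounded d F0 by exact: qboundedS bF.
have n0 := nice_indic mF0 bF0.
have n0F : nonzero (fun x => (\1_F0 x)%:C : R[i]) `<=` F.
  by move=> x /= nz; apply: FF; apply: contrapT => nAx; apply: nz; rewrite indicE memNset.
have rF : cintegrable mu F0 r.
  apply: cintegrable_normc => //; rewrite -(setTI F0) -nint_indic.
  rewrite (@eq_nint _ _ _ mu _ _ (fun x => normc (r x * (\1_F0 x)%:C))); first exact: prodf.
  by move=> x _; rewrite Normc.normcM normc_real ger0_norm.
have [i1 i2] := rF; have [m1 m2] := mr.
have part (g : X -> R) : mu.-integrable F0 (EFin \o g) ->
    (forall A, measurable (A : set (borel X)) -> A `<=` F0 -> \int[mu]_(x in A) g x = 0) ->
    {ae mu, forall x, F0 x -> g x = 0}.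
  move=> ig g0.
  have : ae_eq mu F0 (EFin \o g) (cst 0%E).
    apply: integral_ae_eq => //.
    move=> E EF mE; rewrite integral_cst // mul0e.
    have := g0 E mE EF; rewrite /Rintegral => e.
    rewrite -[LHS]fineK ?e //; apply: integrable_fin_num => //.
    exact: integrableS ig.
  by apply: ae_mono => x /[apply] -[].
have z1 A : measurable (A : set (borel X)) -> A `<=` F0 ->
    \int[mu]_(x in A) complex.Re (r x) = 0.
  by move=> mA AF; have /eqP := zero A mA AF; rewrite eq_complex => /andP[/eqP].
have z2 A : measurable (A : set (borel X)) -> A `<=` F0 ->
    \int[mu]_(x in A) complex.Im (r x) = 0.
  by move=> mA AF; have /eqP := zero A mA AF; rewrite eq_complex => /andP[_ /eqP].
apply: ae_mono (ae_and (part _ i1 z1) (part _ i2 z2)) => x [h1 h2] Fx.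
apply/eqP; rewrite -subr_eq0 -/(r x) eq_complex.
by rewrite (h1 Fx) (h2 Fx) !eqxx.
Qed.

End Representation.
End KernelRepresentation.

Lemma ae_foralln' d (T : measurableType d) (R : realType)
    (mu : {measure set T -> \bar R}) (P : nat -> T -> Prop) :
  (forall n, {ae mu, forall x, P n x}) -> {ae mu, forall x n, P n x}.
Proof.
move=> H; have /choice [N HN] : forall n, exists N, [/\ measurable N, mu N = 0%E &
    ~` [set x | P n x] `<=` N] by move=> n; exact: H n.
have : mu.-negligible (\bigcup_n N n).
  by apply: negligible_bigcup => n; have [mN N0 _] := HN n; exists (N n); split.
move=> [N' [mN' N'0 NN']]; exists N'; split => // x /= nP; apply: NN'.
have [n nPn] : exists n, ~ P n x by apply/existsNP.
by exists n => //; have [_ _] := HN n; apply.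
Qed.

Lemma geometric_partial_sum (R : realType) (q : R) n : 0 <= q < 1 ->
  \sum_(i < n) q ^+ i <= (1 - q)^-1.
Proof.
move=> /andP[q0 q1]; have p0 : 0 < 1 - q by lra.
rewrite -[leRHS]mul1r ler_pdivlMr // mulrC.
have := subrX1 q n => e.
have -> : (1 - q) * (\sum_(i < n) q ^+ i) = 1 - q ^+ n.
  by rewrite -[1 - q]opprB mulNr -e opprB.
by rewrite lerBlDr lerDl exprn_ge0.
Qed.

(** * Decay of the kernel over annuli, and the kernel near and far from the support *)

Section KernelEstimates.
Context (R : realType) (X : ptopologicalType) (d : X -> X -> R).
Context (mu : {measure set (borel X) -> \bar R}) (c K : R).
Hypothesis hd : quasi_metric d.
Hypothesis hX : homogeneous_type mu (qball d) c K.
Local Notation B := (qball d).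
Local Notation vol := (vol mu B).
Local Notation nint A u := (nint mu A%classic u%R).
Local Notation cm f := (cmeasurable [set: borel X] f).
Local Notation nice := (nice d).
Let c0 : 0 < c := c_gt0 hX.
Let K0 : 0 < K := K_gt0 hX.
Let c1 : 1 < c := hom_c hX.
Implicit Types (f g h : X -> R[i]) (A E F W : set X).

Lemma separated_annulus x0 r s : 0 < r -> 0 < s ->
  separated d (B x0 s `\` B x0 (c * r)) (~` (B x0 (c * s) `\` B x0 r)).
Proof.
move=> r0 s0; have -> : ~` (B x0 (c * s) `\` B x0 r) = ~` B x0 (c * s) `|` B x0 r.
  by rewrite setDE setCI setCK.
apply: (separatedUr).
- by apply: separatedS (separated_dil hd hX x0 s0) => // x [].
- apply: (separatedS _ _ (separated_sym hd (separated_dil hd hX x0 r0))) => // x [].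
Qed.

(* On the annulus between radii [c ^+ m * rho] and [c ^+ m.+1 * rho] the kernel
   decays like [c `^ (- m * eps)], of which the growth of [u] uses up half. *)
Lemma annuli_tail (eps Ck : R) : 0 < eps -> 0 < Ck -> exists2 Ct, 0 < Ct &
  forall x0 (rho D : R) (u v : X -> R), 0 < rho -> 0 <= D ->
  measurable_fun setT (u : borel X -> R) -> measurable_fun setT (v : borel X -> R) ->
  (forall y, 0 <= u y) -> (forall y, 0 <= v y) ->
  (forall y, ~ B x0 (c * rho) y ->
     v y <= (rho / d x0 y) `^ eps * (Ck / lambda mu d x0 y) * u y) ->
  (forall m, (nint (B x0 (c ^+ m * rho)) u <=
     (D * c `^ (m%:R * (eps / 2)))%:E * mu (B x0 (c ^+ m * rho)%R))%E) ->
  (nint (~` B x0 (c * rho)) v <= (Ct * D)%:E)%E.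
Proof.
move=> eps0 Ck0; pose q := c `^ (- (eps / 2)).
have q0 : 0 <= q by exact: powR_ge0.
have q1 : q < 1.
  rewrite /q powRN invf_lt1 ?powR_gt0 //; apply: powR_gt1 => //; lra.
have i0 : 0 < (1 - q)^-1 by rewrite invr_gt0; lra.
exists (Ck * K * (1 - q)^-1) => [|x0 rho D u v rho0 D0 mfu mfv u0 v0 vu uD].
  by rewrite !mulr_gt0.
have cm0 m : 0 < c ^+ m * rho by rewrite mulr_gt0 // exprn_gt0.
have mB m : measurable (B x0 (c ^+ m * rho) : set (borel X)).
  exact: (measurable_qball hX).
(* This bounds the kernel factor where [d x0 y] is between [c ^+ m.+1 * rho] and
   [c ^+ m.+2 * rho]. *)
pose a m : R := c `^ (- (m.+1%:R * eps)) * (Ck / vol x0 (c ^+ m.+1 * rho)).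
have a0 m : 0 <= a m by rewrite mulr_ge0 ?powR_ge0 // divr_ge0 ?(vol_ge0 hX) // ltW.
pose w m y := a m * (u y * \1_(B x0 (c ^+ m.+2 * rho)) y).
have mw1 m : measurable_fun setT ((fun y => u y * \1_(B x0 (c ^+ m.+2 * rho)) y) : borel X -> R).
  by apply: measurable_funM => //; exact: measurable_indic.
have mw m : measurable_fun setT (w m : borel X -> R) by exact: measurable_funM.
have w0 m y : 0 <= w m y by rewrite /w mulr_ge0 // mulr_ge0.
have mA : measurable (~` B x0 (c * rho) : set (borel X)).
  by apply: measurableC; have := mB 1%N; rewrite expr1.
apply: (@le_trans _ _ (\sum_(0 <= m <oo) nint (~` B x0 (c * rho)) (w m))%E).
  apply: nint_series => // y ny.
  have dy : c * rho <= d x0 y by rewrite leNgt; apply/negP.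
  have dy0 : 0 < d x0 y by apply: lt_le_trans dy; rewrite mulr_gt0.
  have ex : exists n, d x0 y < c ^+ n * rho.
    have [n hn] := expr_unbounded (d x0 y / rho) c1; exists n.
    by rewrite -ltr_pdivrMr.
  (* The least [n] with [d x0 y < c ^+ n * rho] is at least 2, as [y] lies outside the [c]-dilate;
     annulus [m] corresponds to [n = m + 2]. *)
  case: (ex_minnP ex) => -[|[|m]] hn hmin.
  - have h1 : rho <= c * rho by rewrite ler_peMl // ltW.
    by move: hn; rewrite expr0 mul1r => /lt_le_trans /(_ h1); rewrite ltNge dy.
  - by move: hn; rewrite expr1 ltNge dy.
  have hm : c ^+ m.+1 * rho <= d x0 y.
    by rewrite leNgt; apply/negP => /hmin; rewrite ltnn.
  have := @nneseries_lim_ge R (fun i => (w i y)%:E) xpredT 0 m.+1.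
  move=> /(_ (fun i _ _ => _)) H; apply: le_trans (H _); last by move=> i; rewrite lee_fin.
  rewrite big_nat_recr //=; apply: le_trans (_ : ((w m y)%:E <= _)%E); last first.
    by apply: leeDr; apply: sume_ge0 => i _; rewrite lee_fin.
  rewrite lee_fin; apply: (le_trans (vu y ny)).
  rewrite /w indicE mem_set // mulr1; apply: ler_wpM2r => //.
  rewrite /a; apply: ler_pM; rewrite ?powR_ge0 //.
  - by rewrite divr_ge0 ?(ltW Ck0) // /lambda -/(vol x0 (d x0 y)) (vol_ge0 hX).
  - have -> : - (m.+1%:R * eps) = - m.+1%:R * eps by rewrite mulNr.
    rewrite powRrM powR_invn ?(ltW c0) //; apply: le_powR_base; first exact: ltW.
      by rewrite divr_ge0 ?ltW.
    rewrite ler_pdivrMr // ler_pdivlMl ?exprn_gt0 //.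
  - apply: ler_wpM2l; first exact: ltW.
    rewrite lef_pV2 ?posrE ?(vol_gt0 hX) //.
    by apply: (le_vol hX) => //; exact: (hom_nested hX).
(* Decay [eps] per annulus against growth [eps / 2] leaves a geometric series of ratio [q]. *)
have cq m : c `^ (- (m.+1%:R * eps)) * c `^ (m.+2%:R * (eps / 2)) = q ^+ m.
  rewrite -powRD; last by rewrite (gt_eqF c0) implybT.
  rewrite -powR_mulrn // /q -powRrM; congr (_ `^ _).
  by rewrite -!natr1; field.
apply: nneseries_le_bound => [n|n]; first exact: nint_ge0.
apply: (@le_trans _ _ (\sum_(0 <= i < n) (Ck * K * D * q ^+ i)%:E)%E).
  apply: lee_sum => m _; apply: (@le_trans _ _ (nint setT (w m))).
    exact: nint_le_set.
  rewrite nintZ //; last by move=> y; rewrite mulr_ge0.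
  rewrite nint_indic setTI; apply: le_trans (lee_wpmul2l _ (uD m.+2)) _; first by rewrite lee_fin.
  rewrite (volE hX) // -!EFinM lee_fin /a.
  have vp := vol_gt0 hX x0 (cm0 m.+1).
  have vd : vol x0 (c ^+ m.+2 * rho) <= K * vol x0 (c ^+ m.+1 * rho).
    by rewrite exprS -mulrA; exact: vol_doubling.
  rewrite -cq; set z1 := c `^ _; set z2 := c `^ _.
  have z10 : 0 <= z1 by exact: powR_ge0. have z20 : 0 <= z2 by exact: powR_ge0.
  move: vp vd; set v1 := vol _ _; set v2 := vol _ _ => vp vd.
  have -> : z1 * (Ck / v1) * (D * z2 * v2) = (z1 * Ck * D * z2 / v1) * v2 by field; rewrite gt_eqF.
  have -> : Ck * K * D * (z1 * z2) = (z1 * Ck * D * z2 / v1) * (K * v1) by field; rewrite gt_eqF.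
  by apply: ler_wpM2l => //; rewrite divr_ge0 ?mulr_ge0 // ltW.
rewrite sumEFin lee_fin -mulr_sumr big_mkord.
have := @geometric_partial_sum _ q n; rewrite q0 q1 => /(_ isT) h.
have : Ck * K * D * \sum_(i < n) q ^+ i <= Ck * K * D * (1 - q)^-1.
  by apply: ler_wpM2l => //; rewrite !mulr_ge0 // ltW.
by move=> /le_trans; apply; rewrite mulrAC.
Qed.

End KernelEstimates.

(** What the estimates use of the operator: a kernel measurable on the whole product, and L^2
    properties stated on nice functions only. *)
Record kernel_operator (R : realType) (X : ptopologicalType) (d : X -> X -> R)
    (mu : {measure set (borel X) -> \bar R}) (c delta : R) (k : X -> X -> R[i])
    (eps Ck : R) (T2 : (X -> R[i]) -> X -> R[i]) (C2 : R) : Prop := {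
  ko_delta : 0 < delta;
  ko_admissible : admissible d delta;
  ko_Ck : 0 < Ck;
  ko_eps : 0 < eps;
  ko_measurable_kernel : cmeasurable [set: borel X * borel X] (fun z => k z.1 z.2);
  ko_size : forall x y, x <> y -> normc (k x y) <= Ck / lambda mu d x y;
  ko_smooth : forall x x' y, x <> y -> c * d x x' <= d x y ->
    normc (k x y - k x' y) + normc (k y x - k y x') <=
      (d x x' / d x y) `^ eps * (Ck / lambda mu d x y);
  ko_C2 : 0 <= C2;
  ko_measurable : forall f, nice d f -> cmeasurable [set: borel X] (T2 f);
  ko_linear : forall a f g, nice d f -> nice d g ->
    {ae mu, forall x, T2 (fun y => a * f y + g y) x = a * T2 f x + T2 g x};
  ko_L2 : forall f, nice d f -> (nint mu setT (fun x => normc (T2 f x) ^+ 2)%R <=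
    C2%:E * nint mu setT (fun x => normc (f x) ^+ 2)%R)%E;
  ko_pairing : forall f g, Holder d delta f -> Holder d delta g ->
    separated d (nonzero f) (nonzero g) ->
    cintegral mu setT (fun x => T2 f x * g x) = cintegral mu setT (fun x =>
      cintegral mu setT (fun y => k x y * f y * g x))
}.

Section KernelOperator.
Context (R : realType) (X : ptopologicalType) (d : X -> X -> R).
Context (mu : {measure set (borel X) -> \bar R}) (c K : R).
Hypothesis hd : quasi_metric d.
Hypothesis hX : homogeneous_type mu (qball d) c K.
Local Notation B := (qball d).
Local Notation cm f := (cmeasurable [set: borel X] f).
Local Notation nice := (nice d).
Local Notation separated := (Defs.separated d).
Let c0 : 0 < c := c_gt0 hX.
Let K0 : 0 < K := K_gt0 hX.
Let c1 : 1 < c := hom_c hX.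
Implicit Types (f g h : X -> R[i]) (A E F W : set X).

Variables (delta : R) (k : X -> X -> R[i]) (eps Ck : R).
Variables (T2 : (X -> R[i]) -> X -> R[i]) (C2 : R).
Hypothesis hk : kernel_operator d mu c delta k eps Ck T2 C2.
Local Notation kernel_op := (kernel_op mu k).

Lemma kernel_ae A0 W F0 F h : measurable (A0 : set (borel X)) ->
  measurable (W : set (borel X)) -> measurable (F0 : set (borel X)) ->
  measurable (F : set (borel X)) -> qbounded d W -> qbounded d F ->
  A0 `<=` W -> F0 `<=` F -> separated A0 (~` W) -> separated F0 (~` F) ->
  separated F W -> nice h -> nonzero h `<=` A0 ->
  {ae mu, forall x, F0 x -> T2 h x = kernel_op h x}.
Proof.
move=> mA mW mF0 mF bW bF AW FF sAW sFF sFW nh hA.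
by have [d0 ha Ck0 _ mk sz _ C20 mT lT bT pT] := hk;
  exact: (kernel_representation hd hX d0 ha Ck0 mk sz C20 mT lT bT pT mA mW mF0 mF bW bF AW FF sAW sFF sFW nh hA).
Qed.

Let exprc_gt0 n : 0 < c ^+ n. Proof. exact: exprn_gt0. Qed.

Lemma mem_qball_pow x0 (r : R) x : 0 < r -> exists n, B x0 (c ^+ n * r) x.
Proof.
move=> r0; have [n hn] := expr_unbounded (d x0 x / r) c1; exists n.
by rewrite /qball /= -ltr_pdivrMr.
Qed.

(** Of the three factors [c], one is the margin around the support, one separates the two enlarged
    sets, and one is the margin around the region of evaluation. That region is unbounded, so it is
    exhausted by countably many bounded pieces. *)
Lemma kernel_far x0 r h : 0 < r -> nice h -> nonzero h `<=` B x0 r ->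
  {ae mu, forall x, ~ B x0 (c ^+ 3 * r) x -> T2 h x = kernel_op h x}.
Proof.
move=> r0 nh hB.
have r1 : 0 < c * r by rewrite mulr_gt0.
have r2 : 0 < c * (c * r) by rewrite mulr_gt0.
have r3 : 0 < c * (c * (c * r)) by rewrite mulr_gt0.
have -> : c ^+ 3 * r = c * (c * (c * r)) by ring.
suff H n : {ae mu, forall x, (B x0 (c ^+ n * r) `\` B x0 (c * (c * (c * r)))) x ->
    T2 h x = kernel_op h x}.
  apply: ae_mono (ae_foralln' H) => x Hx nBx.
  by have [n Bx] := mem_qball_pow x0 x r0; apply: (Hx n); split.
have rn : 0 < c ^+ n * r by rewrite mulr_gt0.
have crn : 0 < c * (c ^+ n * r) by rewrite mulr_gt0.
apply: (@kernel_ae (B x0 r) (B x0 (c * r)) _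
  (B x0 (c * (c ^+ n * r)) `\` B x0 (c * (c * r)))) => //.
- exact: (measurable_qball hX).
- exact: (measurable_qball hX).
- by apply: measurableD; exact: (measurable_qball hX).
- by apply: measurableD; exact: (measurable_qball hX).
- exact: qbounded_ball.
- by apply: (qboundedS _ (@qbounded_ball _ _ d x0 (c * (c ^+ n * r)))) => x [].
- exact: (subset_dil hX).
- move=> x [h1 h2]; split; first exact: (subset_dil hX).
  by move=> h3; apply: h2; exact: (subset_dil hX).
- exact: (separated_dil hd hX).
- exact: (separated_annulus hd hX).
- by apply: (separated_sym hd); apply: (separatedS _ _ (separated_dil hd hX x0 r1)) => // x [].
Qed.

(** The mirror image of [kernel_far], with the ball and its complement exchanged. Only one bounded
    piece is needed, since [h] has bounded support. *)
Lemma kernel_near x0 r h : 0 < r -> nice h -> (forall x, B x0 (c ^+ 3 * r) x -> h x = 0) ->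
  {ae mu, forall x, B x0 r x -> T2 h x = kernel_op h x}.
Proof.
move=> r0 nh hB; have [_ _ bh] := nh.
have [rho rho0 hrho] := qbounded_qball hd hX x0 bh.
have r1 : 0 < c * r by rewrite mulr_gt0.
have r2 : 0 < c * (c * r) by rewrite mulr_gt0.
have r3 : 0 < c * (c * (c * r)) by rewrite mulr_gt0.
have e3 : c ^+ 3 * r = c * (c * (c * r)) by ring.
have crho : 0 < c * rho by rewrite mulr_gt0.
rewrite e3 in hB.
apply: (@kernel_ae (B x0 rho `\` B x0 (c * (c * (c * r))))
  (B x0 (c * rho) `\` B x0 (c * (c * r))) _ (B x0 (c * r))) => //.
- by apply: measurableD; exact: (measurable_qball hX).
- by apply: measurableD; exact: (measurable_qball hX).
- exact: (measurable_qball hX).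
- exact: (measurable_qball hX).
- by apply: (qboundedS _ (@qbounded_ball _ _ d x0 (c * rho))) => x [].
- exact: qbounded_ball.
- move=> x [h1 h2]; split; first exact: (subset_dil hX).
  by move=> h3; apply: h2; exact: (subset_dil hX).
- exact: (subset_dil hX).
- exact: (separated_annulus hd hX).
- exact: (separated_dil hd hX).
- by apply: (separatedS _ _ (separated_dil hd hX x0 r1)) => // x [].
- by move=> x nz; split; [exact: hrho|move=> /hB].
Qed.

End KernelOperator.

(** * The weak type (1,1) estimate *)

Lemma disjoint_family_uniq (T : Type) (I : eqType) (F : I -> set T) (s : seq I) :
  (forall i, i \in s -> F i !=set0) -> disjoint_family F s -> uniq s.
Proof.
elim: s => // i s IH F0 /disjoint_familyP[dj ds] /=; rewrite IH ?andbT //; last first.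
  by move=> j js; apply: F0; rewrite in_cons js orbT.
apply/negP => iS; have [x Fx] := F0 i (mem_head i s).
have : (F i `&` unions s F) x by split => //; exists i.
by rewrite dj.
Qed.

(** Each point of [C] is assigned to the first set of the list that contains it. The pieces are
    indexed by elements and not by positions, hence [uniq]. *)
Lemma disjoint_refinement d (T : measurableType d) (R : realType) (I : eqType)
    (F : I -> set T) (s : seq I) (C : set T) : uniq s ->
  (forall i, i \in s -> measurable (F i)) -> measurable C -> C `<=` unions s F ->
  exists Q : I -> set T, [/\ forall i, measurable (Q i),
    forall i, i \in s -> Q i `<=` F i &
    forall x, \sum_(i <- s) \1_(Q i) x = \1_C x :> R].
Proof.
elim: s C => [|i s IH] C /=.
  move=> _ _ _ CF; exists (fun=> set0); split => // x.
  rewrite big_nil indicE memNset // => /CF; by rewrite unions_nil.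
move=> /andP[iS us] mF mC; rewrite unions_cons => CF.
have mFi : measurable (F i) by apply: mF; rewrite mem_head.
have [|||Q [mQ QF Qs]] := IH (C `\` F i) us.
- by move=> j js; apply: mF; rewrite in_cons js orbT.
- exact: measurableD.
- by move=> x [/CF[]].
exists (fun j => if j == i then C `&` F i else Q j); split.
- by move=> j; case: eqP => // _; exact: measurableI.
- move=> j; rewrite in_cons; case: eqP => [->|_] /=; first by move=> _ x [].
  exact: QF.
- move=> x; rewrite big_cons eqxx big_seq.
  under eq_bigr => j js do rewrite (negbTE (memPn iS j js)).
  rewrite -big_seq Qs !indicE in_setI in_setD.
  by case: (x \in C); case: (x \in F i); rewrite /= ?addr0 ?add0r.
Qed.

Section WeakType.
Context (R : realType) (X : ptopologicalType) (d : X -> X -> R).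
Context (mu : {measure set (borel X) -> \bar R}) (c K : R).
Hypothesis hd : quasi_metric d.
Hypothesis hX : homogeneous_type mu (qball d) c K.
Local Notation B := (qball d).
Local Notation vol := (vol mu B).
Local Notation nint A u := (nint mu A%classic u%R).
Local Notation cm f := (cmeasurable [set: borel X] f).
Local Notation nice := (nice d).
Let c0 : 0 < c := c_gt0 hX.
Let K0 : 0 < K := K_gt0 hX.
Let c1 : 1 < c := hom_c hX.
Implicit Types (f g h : X -> R[i]) (A E F W : set X).

Variables (delta : R) (k : X -> X -> R[i]) (eps Ck : R).
Variables (T2 : (X -> R[i]) -> X -> R[i]) (C2 : R).
Hypothesis hk : kernel_operator d mu c delta k eps Ck T2 C2.
Local Notation kernel_op := (kernel_op mu k).

Lemma nice_sum (I : Type) (s : seq I) (b : I -> X -> R[i]) :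
  (forall i, nice (b i)) -> nice (fun x => \sum_(i <- s) b i x).
Proof.
move=> nb; elim: s => [|i s IH]; first by under eq_fun do rewrite big_nil; exact: nice0.
by under eq_fun do rewrite big_cons; exact: (niceD hd hX (nb i)).
Qed.

Lemma T2_sum (I : Type) (s : seq I) (b : I -> X -> R[i]) g :
  nice g -> (forall i, nice (b i)) ->
  {ae mu, forall x, T2 (fun y => \sum_(i <- s) b i y + g y) x =
    \sum_(i <- s) T2 (b i) x + T2 g x}.
Proof.
move=> ng nb; elim: s => [|i s IH].
  rewrite (_ : (fun y => _) = g); last by apply/funext => y; rewrite big_nil add0r.
  by apply: aeW => x; rewrite big_nil add0r.
have n1 : nice (fun y => \sum_(i <- s) b i y + g y).
  by apply: (niceD hd hX) => //; exact: nice_sum.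
apply: ae_mono (ae_and IH (ko_linear hk 1 (nb i) n1)) => x [e1 e2].
rewrite big_cons -addrA -e1 -[T2 (b i) x]mul1r -e2.
by congr (T2 _ x); apply/funext => y; rewrite big_cons mul1r addrA.
Qed.

Lemma kernel_section_cm x : cm (k x).
Proof. exact: (cmeasurable_kernel_section (ko_measurable_kernel hk)). Qed.

Lemma kernel_op_cm h : cm h -> cm (kernel_op h).
Proof. exact: (cmeasurable_kernel_op hd hX (ko_measurable_kernel hk)). Qed.

(** As [b] has integral zero, [k x y] may be replaced by [k x y - k x x0], which the smoothness of
    the kernel in its second variable bounds. *)
Lemma kernel_op_cancel x0 rho b x : 0 < rho -> nice b -> nonzero b `<=` B x0 rho ->
  cintegral mu setT b = 0 -> ~ B x0 (c * rho) x ->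
  ((normc (kernel_op b x))%:E <= (2 * ((rho / d x0 x) `^ eps * (Ck / lambda mu d x0 x)))%:E
     * nint setT (fun y => normc (b y)))%E.
Proof.
move=> r0 nb bB b0 nBx; have [mb [M bM] _] := nb.
have dx : c * rho <= d x0 x by rewrite leNgt; apply/negP.
have dx0 : 0 < d x0 x by apply: lt_le_trans dx; rewrite mulr_gt0.
have xx0 : x0 <> x by move=> e; move: dx0; rewrite e (distxx hd) ltxx.
have Ck0 := ko_Ck hk; have eps0 := ko_eps hk.
set a := (rho / d x0 x) `^ eps * (Ck / lambda mu d x0 x).
have L0 : 0 <= Ck / lambda mu d x0 x.
  by rewrite divr_ge0 ?(ltW Ck0) // /lambda -/(vol x0 (d x0 x)) (vol_ge0 hX).
have a0 : 0 <= a by rewrite mulr_ge0 // powR_ge0.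
have kb y : normc ((k x y - k x x0) * b y) <= a * normc (b y).
  rewrite Normc.normcM; have [by0|by0] := pselect (b y = 0).
    by rewrite by0 Normc.normc0 !mulr0.
  apply: ler_wpM2r => //; have By := bB _ by0.
  have cd : c * d x0 y <= d x0 x by apply: le_trans dx; rewrite ler_pM2l // ltW.
  have := ko_smooth hk xx0 cd; rewrite (normc_distC (k x y)).
  have := normc_ge0 (k x0 x - k y x).
  have : (d x0 y / d x0 x) `^ eps <= (rho / d x0 x) `^ eps.
    apply: le_powR_base; [exact: ltW|by rewrite divr_ge0 ?(dist_ge0 hd)|].
    by rewrite ler_pM2r ?invr_gt0 // ltW.
  by move=> /(ler_wpM2r L0); rewrite -/a; lra.
have mkb : cm (fun y => (k x y - k x x0) * b y).
  apply: cmeasurableM => //; apply: cmeasurableB; first exact: kernel_section_cm.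
  exact: cmeasurable_cst.
have b1 := nice_L1 hd hX nb.
have le1 : (nint setT (fun y => normc ((k x y - k x x0) * b y)) <=
    a%:E * nint setT (fun y => normc (b y)))%E.
  rewrite -nintZ //; [|exact: measurable_normc].
  by apply: nint_le_fun => y _; rewrite normc_ge0 kb.
have b1f : nint setT (fun y => normc (b y)) \is a fin_num.
  by rewrite ge0_fin_numE // nint_ge0.
have fin : (nint setT (fun y => normc ((k x y - k x x0) * b y)) < +oo)%E.
  by apply: le_lt_trans le1 _; rewrite -(fineK b1f) -EFinM ltry.
have bi : cintegrable mu setT b by exact: cintegrable_normc.
have -> : kernel_op b x = cintegral mu setT (fun y => (k x y - k x x0) * b y).
  transitivity (cintegral mu setT (fun y => (k x y - k x x0) * b y + k x x0 * b y)).
    by apply: eq_cintegral => y _; rewrite -mulrDl subrK.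
  rewrite cintegralD // ?cintegralZ ?b0 ?mulr0 ?addr0 //.
  - exact: cintegrable_normc.
  - exact: cintegrableZ.
apply: (le_trans (normc_cintegral_le _ mkb fin)) => //.
by rewrite EFinM -muleA; apply: lee_wpmul2l.
Qed.

Lemma atom_bound : exists2 Ct, 0 < Ct & forall x0 rho b, 0 < rho -> nice b ->
  nonzero b `<=` B x0 rho -> cintegral mu setT b = 0 ->
  (nint (~` B x0 (c ^+ 3 * rho)) (fun x => normc (T2 b x)) <=
   Ct%:E * nint setT (fun x => normc (b x)))%E.
Proof.
have [Ct Ct0 HCt] := annuli_tail hX (ko_eps hk) (ko_Ck hk).
exists (Ct * 2); first by rewrite mulr_gt0.
move=> x0 rho b r0 nb bB b0; have [mb _ _] := nb.
have mkb := kernel_op_cm mb.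
have r3 : 0 < c ^+ 3 * rho by rewrite mulr_gt0 // exprn_gt0.
have m3 := measurable_qball hX x0 r3.
apply: (@le_trans _ _ (nint (~` B x0 (c ^+ 3 * rho)) (fun x => normc (kernel_op b x)))).
  apply: nint_ae_le => //.
  - exact: measurableC.
  - by apply: measurable_normc; exact: (ko_measurable hk).
  - exact: measurable_normc.
  by apply: ae_mono (kernel_far hd hX hk r0 nb bB) => x /[apply] ->.
apply: (@le_trans _ _ (nint (~` B x0 (c * rho)) (fun x => normc (kernel_op b x)))).
  apply: nint_le_set => // x nB /= Bx; apply: nB.
  apply: (hom_nested hX _ _ Bx); first by rewrite mulr_gt0.
  rewrite ler_pM2r // exprS ler_peMr ?(ltW c0) //.
  by rewrite exprn_ege1 // ltW.
have b1f : nint setT (fun y => normc (b y)) \is a fin_num.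
  by rewrite ge0_fin_numE ?nint_ge0 //; exact: (nice_L1 hd hX nb).
have cancel := kernel_op_cancel r0 nb bB b0.
move: cancel; rewrite -(fineK b1f); set I := fine _ => cancel.
have I0 : 0 <= I by apply: fine_ge0; exact: nint_ge0.
rewrite -EFinM -mulrA.
(* The previous lemma bounds the integrand by the kernel decay times a constant, so the tail
   estimate is used with a constant [u]. *)
apply: (HCt x0 rho (2 * I) (fun=> 2 * I)) => //.
- by rewrite mulr_ge0.
- exact: measurable_normc.
- by move=> _; rewrite mulr_ge0.
- move=> y /cancel; rewrite -EFinM lee_fin => /le_trans; apply.
  rewrite le_eqVlt; apply/orP; left; apply/eqP; ring.
- move=> m; have rm : 0 < c ^+ m * rho by rewrite mulr_gt0 // exprn_gt0.
  rewrite nint_cst; last exact: (measurable_qball hX).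
  apply: lee_wpmul2r => //; rewrite lee_fin ler_peMr ?mulr_ge0 //.
  by rewrite -{1}(powRr0 c); apply: ler_powR; rewrite ?mulr_ge0 ?divr_ge0 ?(ltW c1) ?(ltW (ko_eps hk)).
Qed.

End WeakType.

Lemma disjoint_family_sum_indic (R : numDomainType) (T : Type) (I : eqType) (F : I -> set T) (s : seq I) x :
  disjoint_family F s -> \sum_(i <- s) \1_(F i) x <= 1 :> R.
Proof.
elim: s => [|i s IH]; first by rewrite big_nil.
move=> /disjoint_familyP[dj /IH{}IH]; rewrite big_cons indicE.
have [Fx|nFx] := pselect (F i x); last by rewrite memNset // add0r.
rewrite mem_set //= big_seq big1 ?addr0 // => j js.
rewrite indicE memNset // => Fj.
by have : (F i `&` unions s F) x by [split => //; exists j]; rewrite dj.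
Qed.

Section Decomposition.
Context (R : realType) (X : ptopologicalType) (d : X -> X -> R).
Context (mu : {measure set (borel X) -> \bar R}) (c K : R).
Hypothesis hd : quasi_metric d.
Hypothesis hX : homogeneous_type mu (qball d) c K.
Hypothesis hg : ball_growth mu (qball d) c.
Local Notation B := (qball d).
Local Notation vol := (vol mu B).
Local Notation nint A u := (nint mu A%classic u%R).
Local Notation cm f := (cmeasurable [set: borel X] f).
Local Notation nice := (nice d).
Local Notation Omega := (Omega mu B).
Local Notation bl i := (B i.1 i.2).
Let c0 : 0 < c := c_gt0 hX.
Let K0 : 0 < K := K_gt0 hX.
Let c1 : 1 < c := hom_c hX.
Implicit Types (f g h : X -> R[i]) (A E F W : set X).

(** Off [Omega] one has [u <= l] almost everywhere, so [u ^+ 2 <= l * u]; the rest of the complement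
    of [C] has measure at most [e]. *)
Lemma nint_below_sqr (u : X -> R) (l M e : R) (C : set X) :
  measurable_fun setT (u : borel X -> R) -> (forall x, 0 <= u x <= M) -> 0 < l ->
  measurable (C : set (borel X)) -> C `<=` Omega u l ->
  (mu (Omega u l `\` C) <= e%:E)%E ->
  (nint (~` C) (fun x => u x ^+ 2) <= l%:E * nint setT u + (M ^+ 2 * e)%:E)%E.
Proof.
move=> mfu uM l0 mC CO muC.
have u0 x : 0 <= u x by have /andP[] := uM x.
have mO := @measurable_Omega _ _ _ _ _ _ hX u l.
have mOC : measurable (Omega u l `\` C : set (borel X)) by exact: measurableD.
have mu2 : measurable_fun setT ((fun x => u x ^+ 2) : borel X -> R) by exact: measurable_funX.
have -> : ~` C = ~` Omega u l `|` (Omega u l `\` C).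
  apply/seteqP; split => [x nC|x [nO|[]//]]; last by move=> /CO.
  by have [|] := pselect (Omega u l x); [right|left].
apply: (le_trans (nint_setU_le mu (measurableC mO) mOC mu2 (fun x => sqr_ge0 _))).
apply: leeD.
  rewrite -nintZ ?(ltW l0) //.
  apply: (@le_trans _ _ (nint (~` Omega u l) (fun x => l * u x))).
    apply: nint_ae_le => //.
    - exact: measurableC.
    - exact: measurable_funM.
    - by move=> x; exact: sqr_ge0.
    - by move=> x; rewrite mulr_ge0 // ltW.
    apply: ae_mono (ae_le_Omega hX mfu u0 l0) => x /[apply] ul.
    by rewrite expr2; exact: ler_wpM2r.
  by apply: nint_le_set => // x; rewrite mulr_ge0 // ltW.
apply: (@le_trans _ _ (nint (Omega u l `\` C) (fun=> M ^+ 2))).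
  apply: nint_le_fun => x _; rewrite sqr_ge0 /=; have /andP[a0 aM] := uM x.
  by rewrite ler_sqr ?nnegrE // (le_trans a0).
by rewrite nint_cst // [leRHS]EFinM; apply: lee_wpmul2l; rewrite ?lee_fin ?sqr_ge0.
Qed.

(** The pieces of [f] live on a partition [Q] of [C] subordinate to the dilated stopping balls. To
    give [b i] integral zero, the integral of its piece is spread over the original stopping ball
    and not over [Q i], which may be null. As the original balls are disjoint, the means collected
    in [g] are bounded by [2 * (l * K)] without overlap. Only a compact part of [Omega] is treated,
    which costs the term [e]. *)
Lemma calderon_zygmund_decomposition f (l e : R) : nice f -> 0 < l -> 0 < e ->
  exists (s : seq (X * R)) (b : X * R -> X -> R[i]) g,
  [/\ nice g /\ (forall i, nice (b i)), f = (fun x => \sum_(i <- s) b i x + g x),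
    forall i, i \in s -> [/\ 0 < i.2, nonzero (b i) `<=` B i.1 (c * i.2) &
      cintegral mu setT (b i) = 0],
    (\sum_(i <- s) nint setT (fun x => normc (b i x)) <=
       3%:E * nint setT (fun x => normc (f x)))%E /\
    (l%:E * \sum_(i <- s) mu (bl i) <= nint setT (fun x => normc (f x)))%E &
    (nint setT (fun x => normc (g x) ^+ 2) <=
       ((2 + 8 * K ^+ 2) * l)%:E * (nint setT (fun x => normc (f x)) + e%:E))%E].
Proof.
move=> nf l0 e0; have [mf [M fM] bf] := nf.
pose u x := normc (f x); have u0 x : 0 <= u x by exact: normc_ge0.
have mfu : measurable_fun setT (u : borel X -> R) by exact: measurable_normc.
have uM x : 0 <= u x <= M by rewrite u0 fM.
have u1 : (nint setT (fun x => u x `^ 1) < +oo)%E by exact: (nice_Lp hd hX ltr01 nf).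
have If : nint setT u \is a fin_num.
  by rewrite ge0_fin_numE ?nint_ge0 //; exact: (nice_L1 hd hX nf).
pose I := fine (nint setT u); have IE : nint setT u = I%:E by rewrite fineK.
have I0 : 0 <= I by apply: fine_ge0; exact: nint_ge0.
have su := small_balls_powR hX mfu u0 l0 (lexx 1) u1.
have mO := @measurable_Omega _ _ _ _ _ _ hX u l.
have Ofin : (mu (Omega u l) < +oo)%E.
  by apply: le_lt_trans (weak11 hX mfu u0 l0) _; rewrite IE -EFinM ltry.
have M2 : 0 < M ^+ 2 + 1 by rewrite ltr_wpDl // sqr_ge0.
(* On the untreated part [|f| ^+ 2] is at most [M ^+ 2], so it adds at most [l * e] to the integral
   of [|g| ^+ 2]. *)
pose e1 := l * e / (M ^+ 2 + 1); have e10 : 0 < e1 by rewrite divr_gt0 // mulr_gt0.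
have [C [cC CO muC]] := compact_approx hX mO Ofin e10.
have mC := compact_measurable_borel hX cC.
have [s [sP ds Cs]] := stopping_balls hX hg su cC CO.
have s0 i : i \in s -> 0 < i.2 by move=> /sP[].
have mb i : i \in s -> measurable (bl i : set (borel X)) by move=> /s0 ?; exact: (measurable_qball hX).
have us : uniq s.
  by apply: disjoint_family_uniq ds => i /s0 i0; exists i.1; exact: (hom_center hX).
have [|Q [mQ QF Qs]] := @disjoint_refinement _ (borel X) R _ (fun i => B i.1 (c * i.2)) s C us _ mC Cs.
  by move=> i /s0 i0; apply: (measurable_qball hX); rewrite mulr_gt0.
have Qu i : i \in s -> (nint (Q i) u <= (l * K * vol i.1 i.2)%:E)%E.
  move=> iS; have [i0 _ hi] := sP i iS.
  apply: (@le_trans _ _ (nint (B i.1 (c * i.2)) u)); first by apply: nint_le_set => //; exact: QF.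
  apply: (le_trans (hi i.1 (c * i.2) (lexx _) _)); first exact: (subset_dil hX).
  rewrite (volE hX) ?mulr_gt0 // -EFinM lee_fin -mulrA ler_pM2l //.
  exact: vol_doubling.
have Qf i : nint (Q i) u \is a fin_num.
  rewrite ge0_fin_numE ?nint_ge0 //; apply: (@le_lt_trans _ _ (nint setT u)).
    exact: nint_le_set.
  by rewrite IE ltry.
pose q i := fine (nint (Q i) u).
have qE i : nint (Q i) u = (q i)%:E by rewrite fineK.
have q0 i : 0 <= q i by apply: fine_ge0; exact: nint_ge0.
pose fQ i x := (\1_(Q i) x)%:C * f x.
have nfQ i : nice (fQ i) by exact: nice_restrict.
pose m i : R[i] := cintegral mu setT (fQ i) / (vol i.1 i.2)%:C.
have nQ i : nint setT (fun x => normc (fQ i x)) = nint (Q i) u.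
  rewrite -(setTI (Q i)) -nint_indic; apply: eq_nint => x _.
  by rewrite /fQ Normc.normcM normc_real ger0_norm // mulrC.
have intQ i : normc (cintegral mu setT (fQ i)) <= 2 * q i.
  rewrite -lee_fin EFinM -qE -nQ; apply: normc_cintegral_le => //.
    by have [] := nfQ i.
  by rewrite nQ qE ltry.
have mv i : i \in s -> normc (m i) * vol i.1 i.2 <= 2 * q i.
  move=> /s0 i0; have v0 := vol_gt0 hX i.1 i0.
  rewrite /m Normc.normcM Normc.normcV normc_real ger0_norm ?(ltW v0) //.
  by rewrite mulfVK ?gt_eqF.
have mK i : i \in s -> normc (m i) <= 2 * (l * K).
  move=> iS; have v0 := vol_gt0 hX i.1 (s0 i iS).
  rewrite -(ler_pM2r v0); apply: (le_trans (mv i iS)).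
  by rewrite -mulrA ler_pM2l // -lee_fin -qE; exact: Qu.
(* Indices outside [s] may have a nonpositive radius; they get the zero function so that the whole
   family is nice. *)
pose S i : X -> R := if i \in s then \1_(bl i) else fun=> 0.
have mS i : measurable_fun setT (S i : borel X -> R).
  by rewrite /S; case: ifP => [iS|_]; [exact: measurable_indic (mb i iS)|exact: measurable_cst].
have S0 i x : 0 <= S i x by rewrite /S; case: ifP.
have Sint i : i \in s -> nint setT (S i) = mu (bl i).
  move=> iS; rewrite /S iS -[RHS]mul1e -(nint_cst mu 1 (mb i iS)) -(setTI (bl i)) -nint_indic.
  by apply: eq_nint => x _; rewrite setTI mul1r.
pose mm i x : R[i] := m i * (S i x)%:C.
have nmm i : nice (mm i).
  apply: (niceZ hd hX); rewrite /S; case: ifP => [iS|_]; last exact: nice0.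
  by apply: nice_indic; [exact: mb|exact: qbounded_ball].
pose b i : X -> R[i] := if i \in s then (fun x => fQ i x - mm i x) else (fun=> 0).
have nb i : nice (b i).
  by rewrite /b; case: ifP => _; [exact: (niceB hd hX)|exact: nice0].
pose g x : R[i] := \sum_(i <- s) mm i x + (f x - (\1_C x)%:C * f x).
have ng : nice g.
  apply: (niceD hd hX); first exact: (nice_sum hd hX).
  by apply: (niceB hd hX) => //; exact: nice_restrict.
have mmn i : i \in s -> nint setT (fun x => normc (mm i x)) = (normc (m i) * vol i.1 i.2)%:E.
  move=> iS; rewrite EFinM -(volE hX) ?(s0 i iS) // -(Sint i iS) -nintZ //.
  by apply: eq_nint => x _; rewrite /mm Normc.normcM normc_real ger0_norm.
exists s, b, g; split => //.
- apply/funext => x; rewrite /g addrA -big_split /=.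
  rewrite (eq_big_seq (fun i => fQ i x)); last first.
    by move=> i iS; rewrite /b iS subrK.
  rewrite -mulr_suml -rmorph_sum Qs.
  by rewrite addrC subrK.
- move=> i iS; have i0 := s0 i iS; split => //.
    move=> x /=; rewrite /b iS /fQ /mm /S iS => nz; apply: contrapT => nB; apply: nz.
    rewrite [\1_(Q i) x]indicE memNset ?[\1_(bl i) x]indicE ?memNset ?mul0r ?mulr0 ?subrr //.
      by move=> Bx; apply: nB; exact: (subset_dil hX).
    by move=> Qx; apply: nB; exact: QF Qx.
  have fi : cintegrable mu setT (fQ i).
    by apply: cintegrable_normc => //; [have [] := nfQ i|rewrite nQ qE ltry].
  have Si : cintegrable mu setT (fun x => (S i x)%:C).
    have [mSi _ _] := nmm i.
    apply: cintegrable_normc => //; first exact: cmeasurable_real.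
    rewrite (_ : nint setT (fun x => normc (S i x)%:C) = nint setT (S i)); last first.
      by apply: eq_nint => x _; rewrite normc_real ger0_norm.
    by rewrite (Sint i iS) (volE hX) // ltry.
  rewrite (_ : b i = (fun x => fQ i x - mm i x)); last first.
    by apply/funext => x; rewrite /b iS.
  rewrite cintegralB //; last exact: cintegrableZ.
  rewrite cintegralZ //.
  have -> : cintegral mu setT (fun x => (S i x)%:C) = (vol i.1 i.2)%:C.
    rewrite /cintegral /= /Rintegral -/(nint setT (S i)) (Sint i iS).
    by rewrite (integral0 mu) (volE hX).
  by rewrite /m divfK ?subrr // -normc_eq0 normc_real normr_eq0 gt_eqF ?(vol_gt0 hX).
- split.
    apply: (@le_trans _ _ (\sum_(i <- s) (3 * q i)%:E)%E).
      rewrite big_seq [leRHS]big_seq; apply: lee_sum => i iS.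
      apply: (@le_trans _ _ (nint setT (fun x => normc (fQ i x) + normc (mm i x)))).
        by apply: nint_le_fun => x _; rewrite normc_ge0 /b iS /= normcB_le.
      rewrite nintD //; [|by apply: measurable_normc; have [] := nfQ i
        |by apply: measurable_normc; have [] := nmm i].
      by rewrite nQ qE mmn // -EFinD lee_fin; have := mv i iS; lra.
    rewrite sumEFin -mulr_sumr EFinM; apply: lee_wpmul2l => //.
    rewrite -sumEFin; under eq_bigr do rewrite -qE.
    apply: (@le_trans _ _ (\sum_(i <- s) nint setT (fun x => u x * \1_(Q i) x))%E).
      by apply: lee_sum => i _; rewrite nint_indic setTI.
    rewrite -nint_sum //; last 2 first.
    - by move=> i; apply: measurable_funM => //; exact: measurable_indic.
    - by move=> i x; rewrite mulr_ge0.
    apply: nint_le_fun => x _; rewrite -mulr_sumr Qs mulr_ge0 //=.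
    by rewrite ler_piMr // indicE; case: (_ \in _).
  rewrite ge0_sume_distrr; last by move=> i _; exact: measure_ge0.
  apply: (@le_trans _ _ (\sum_(i <- s) nint (bl i) u)%E).
    by rewrite big_seq [leRHS]big_seq; apply: lee_sum => i /sP[_ /ltW].
  by rewrite -nint_unions //; apply: nint_le_set.
(* By disjointness the sum of indicators is 0 or 1 and equals its own square. *)
have sm x : normc (\sum_(i <- s) mm i x) ^+ 2 <= 4 * (l * K) ^+ 2 * \sum_(i <- s) S i x.
  have h1 : \sum_(i <- s) S i x <= 1.
    apply: le_trans (disjoint_family_sum_indic R x ds).
    by rewrite big_seq [leRHS]big_seq; apply: ler_sum => i iS; rewrite /S iS.
  have h0 : 0 <= \sum_(i <- s) S i x by apply: sumr_ge0.
  have h2 : normc (\sum_(i <- s) mm i x) <= 2 * (l * K) * \sum_(i <- s) S i x.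
    apply: (@le_trans _ _ (\sum_(i <- s) normc (mm i x))).
      elim: (s) => [|i t IH]; first by rewrite !big_nil Normc.normc0.
      by rewrite !big_cons; apply: (le_trans (le_normcD _ _)); rewrite lerD2l.
    rewrite mulr_sumr big_seq [leRHS]big_seq; apply: ler_sum => i iS.
    by rewrite /mm Normc.normcM normc_real ger0_norm //; apply: ler_wpM2r => //; exact: mK.
  have lK : 0 <= l * K by rewrite mulr_ge0 // ltW.
  have n0 := normc_ge0 (\sum_(i <- s) mm i x).
  apply: (@le_trans _ _ ((2 * (l * K) * \sum_(i <- s) S i x) ^+ 2)).
    by rewrite !expr2; apply: ler_pM.
  set t := \sum_(i <- s) S i x in h0 h1 *.
  have -> : (2 * (l * K) * t) ^+ 2 = 4 * (l * K) ^+ 2 * (t * t) by ring.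
  apply: ler_wpM2l; last by rewrite ler_piMr.
  by apply: mulr_ge0 => //; exact: sqr_ge0.
have [mms _ _] := nice_sum hd hX s nmm.
have nfC : nice (fun x => f x - (\1_C x)%:C * f x).
  by apply: (niceB hd hX) => //; exact: nice_restrict.
have [mfC _ _] := nfC.
apply: (le_trans (nint_sqr_normcD mu mms mfC)).
have t1 : (nint setT (fun x => normc (\sum_(i <- s) mm i x) ^+ 2) <=
    (4 * (l * K) ^+ 2)%:E * (l^-1 * I)%:E)%E.
  apply: (@le_trans _ _ (nint setT (fun x => 4 * (l * K) ^+ 2 * \sum_(i <- s) S i x))).
    by apply: nint_le_fun => x _; rewrite sqr_ge0 sm.
  have k0 : 0 <= 4 * (l * K) ^+ 2 by apply: mulr_ge0 => //; exact: sqr_ge0.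
  rewrite nintZ //; [|exact: measurable_sum|by move=> x; apply: sumr_ge0].
  apply: lee_wpmul2l; first by rewrite lee_fin.
  rewrite nint_sum // EFinM -[leLHS]mul1e -(@mulVf _ l) ?gt_eqF // EFinM -muleA.
  apply: lee_wpmul2l; first by rewrite lee_fin invr_ge0 ltW.
  rewrite (eq_big_seq (fun i => mu (bl i))) // ge0_sume_distrr; last by move=> i _; exact: measure_ge0.
  apply: (@le_trans _ _ (\sum_(i <- s) nint (bl i) u)%E).
    by rewrite big_seq [leRHS]big_seq; apply: lee_sum => i /sP[_ /ltW].
  by rewrite -nint_unions // -IE; apply: nint_le_set.
have t2 : (nint setT (fun x => normc (f x - (\1_C x)%:C * f x) ^+ 2) <=
    l%:E * I%:E + (l * e)%:E)%E.
  apply: (@le_trans _ _ (nint (~` C) (fun x => u x ^+ 2))).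
    rewrite -(setTI (~` C)) -nint_indic; apply: nint_le_fun => x _; rewrite sqr_ge0 /=.
    rewrite !indicE in_setC; case: (x \in C); rewrite /= ?mul1r ?mul0r ?subr0 ?mulr1 //.
    by rewrite subrr Normc.normc0 expr0n mulr0.
  apply: (le_trans (nint_below_sqr mfu uM l0 mC CO muC)); rewrite IE; apply: leeD => //.
  rewrite lee_fin /e1 mulrA ler_pdivrMr // mulrC.
  by apply: ler_wpM2l; [rewrite mulr_ge0 ?ltW|rewrite lerDl].
rewrite -/u IE; apply: (le_trans (leeD (lee_wpmul2l _ t1) (lee_wpmul2l _ t2))) => //.
rewrite -!(EFinM, EFinD) lee_fin.
have -> : 4 * (l * K) ^+ 2 * (l^-1 * I) = 4 * K ^+ 2 * l * I by field; rewrite gt_eqF.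
have z0 : 0 <= 8 * (K ^+ 2 * l * e) by rewrite !mulr_ge0 ?sqr_ge0 ?ltW.
rewrite -subr_ge0; move: z0; congr (_ <= _); ring.
Qed.

Variables (delta : R) (k : X -> X -> R[i]) (eps Ck : R).
Variables (T2 : (X -> R[i]) -> X -> R[i]) (C2 : R).
Hypothesis hk : kernel_operator d mu c delta k eps Ck T2 C2.

(** The good part is handled by the L^2 bound and Chebyshev at height [l / 2], the dilated stopping
    balls by their measure, and the bad part off them by the integral bound for atoms. These give
    the three terms of [Cw]. *)
Lemma weak_type11 : exists2 Cw : R, 0 < Cw & forall f (l : R), nice f -> 0 < l ->
  (mu [set x | (l < normc (T2 f x))%R] <= (Cw / l)%:E * nint setT (fun x => normc (f x)))%E.
Proof.
have [Ct Ct0 HCt] := atom_bound hd hX hk.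
have C20 := ko_C2 hk.
pose Cw := 4 * C2 * (2 + 8 * K ^+ 2) + (K ^+ 4 + 6 * Ct).
have Cw0 : 0 < Cw.
  have p1 : 0 <= 4 * C2 * (2 + 8 * K ^+ 2).
    by apply: mulr_ge0; [exact: mulr_ge0|apply: addr_ge0 => //; apply: mulr_ge0 => //; exact: sqr_ge0].
  have p2 : 0 < K ^+ 4 by exact: exprn_gt0.
  by rewrite /Cw; lra.
exists Cw => // f l nf l0.
have [mf [M fM] bf] := nf.
have If : nint setT (fun x => normc (f x)) \is a fin_num.
  by rewrite ge0_fin_numE ?nint_ge0 //; exact: (nice_L1 hd hX nf).
pose I := fine (nint setT (fun x => normc (f x))).
have IE : nint setT (fun x => normc (f x)) = I%:E by rewrite fineK.
have I0 : 0 <= I by apply: fine_ge0; exact: nint_ge0.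
apply/lee_addgt0Pr => e' e'0.
(* The error of the decomposition then contributes exactly [e'] to the bound. *)
pose e := e' * l / Cw; have e0 : 0 < e by rewrite divr_gt0 // mulr_gt0.
have [s [b [g [[ng nb] fE sP]]]] := calderon_zygmund_decomposition nf l0 e0.
rewrite IE => -[bI sI] gI.
have [mg _ _] := ng; have mT h : nice h -> cm (T2 h) := ko_measurable hk (f := h).
have l20 : 0 < l / 2 by lra.
(* Of the fourth power of [c], one factor is for the support of [b i], contained in a [c]-dilate,
   and three are for [atom_bound]. *)
pose U := unions s (fun i => B i.1 (c ^+ 4 * i.2)).
have mU : measurable (U : set (borel X)).
  by apply: measurable_unions => i /sP[i0 _ _]; apply: (measurable_qball hX); rewrite mulr_gt0 // exprn_gt0.
pose v x := normc (\sum_(i <- s) T2 (b i) x).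
have mv : measurable_fun setT (v : borel X -> R).
  by apply: measurable_normc; apply: cmeasurable_sum => i; exact: mT.
pose w x := normc (T2 g x).
have mw : measurable_fun setT (w : borel X -> R) by apply: measurable_normc; exact: mT.
pose E1 := [set x | l / 2 < w x]; pose E2 := ~` U `&` [set x | l / 2 < v x].
have mE1 : measurable (E1 : set (borel X)) by exact: measurable_gt.
have mE2 : measurable (E2 : set (borel X)).
  by apply: measurableI; [exact: measurableC|exact: measurable_gt].
have mE : measurable ([set x | l < normc (T2 f x)] : set (borel X)).
  by apply: measurable_gt; apply: measurable_normc; exact: mT.
have mUE2 : measurable (U `|` E2 : set (borel X)) by exact: measurableU.
have sub : {ae mu, forall x, (l < normc (T2 f x))%R -> (E1 `|` (U `|` E2)) x}.
  rewrite fE; apply: ae_mono (T2_sum hd hX hk s ng nb) => x -> h.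
  have [wl|lw] := ltP (l / 2) (w x); [by left|right].
  have [Ux|nUx] := pselect (U x); [by left|right; split => //=].
  have := lt_le_trans h (le_normcD _ _); rewrite -/(v x) -/(w x) => h'.
  rewrite ltNge; apply/negP => vl; have := lerD vl lw.
  by rewrite -splitr leNgt h'.
apply: (le_trans (le_measure_ae mE (measurableU _ _ mE1 mUE2) sub)).
apply: (le_trans (measureU2 mu mE1 mUE2)).
have t1 : (mu E1 <= (4 * C2 * (2 + 8 * K ^+ 2) / l * (I + e))%:E)%E.
  have := chebyshev mu measurableT (measurable_normc_sqr (mT g ng)) (fun x => sqr_ge0 _) (sqr_ge0 (l / 2)).
  rewrite setTI (_ : [set x | (l / 2) ^+ 2 < _] = E1); last first.
    by apply/seteqP; split => x; rewrite /E1 /= ltr_sqr ?nnegrE ?(ltW l20).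
  move=> h; have := le_trans (le_trans h (ko_L2 hk ng)) (lee_wpmul2l _ gI).
  rewrite lee_fin -EFinD => /(_ C20); rewrite -!EFinM => {}h.
  have q0 : 0 < ((l / 2) ^+ 2)^-1 by rewrite invr_gt0 exprn_gt0.
  have := lee_wpmul2l (ltW q0 : (0 <= (((l / 2) ^+ 2)^-1)%:E)%E) h.
  rewrite muleA -!EFinM mulVf ?gt_eqF ?exprn_gt0 // mul1e => /le_trans; apply.
  by rewrite lee_fin le_eqVlt; apply/orP; left; apply/eqP; field; rewrite gt_eqF.
have sI' : (\sum_(i <- s) mu (bl i) <= (l^-1 * I)%:E)%E.
  rewrite EFinM -[leLHS]mul1e -(@mulVf _ l) ?gt_eqF // EFinM -muleA.
  by apply: lee_wpmul2l; [rewrite lee_fin invr_ge0 ltW|exact: sI].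
have t2 : (mu U <= (K ^+ 4 / l * I)%:E)%E.
  apply: le_trans (measure_unions_dil hX 4 _) _; first by move=> i /sP[].
  apply: le_trans (lee_wpmul2l _ sI') _; first by rewrite lee_fin exprn_ge0 // ltW.
  by rewrite -EFinM mulrA.
have t3 : (mu E2 <= (6 * Ct / l * I)%:E)%E.
  have h := chebyshev mu (measurableC mU) mv (fun x => normc_ge0 _) (ltW l20).
  have h2 : (nint (~` U) v <= (Ct * (3 * I))%:E)%E.
    apply: (@le_trans _ _ (\sum_(i <- s) nint (~` U) (fun x => normc (T2 (b i) x)))%E).
      rewrite -nint_sum //; [|exact: measurableC|by move=> i; apply: measurable_normc; exact: mT].
      apply: nint_le_fun => x _; rewrite normc_ge0 /= /v.
      elim: (s) => [|i t IH]; first by rewrite !big_nil Normc.normc0.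
      by rewrite !big_cons; apply: (le_trans (le_normcD _ _)); rewrite lerD2l.
    apply: (@le_trans _ _ (\sum_(i <- s) Ct%:E * nint setT (fun x => normc (b i x)))%E).
      rewrite big_seq [leRHS]big_seq; apply: lee_sum => i iS; have [i0 bB b0] := sP i iS.
      have ci0 : 0 < c * i.2 by rewrite mulr_gt0.
      apply: le_trans (HCt i.1 (c * i.2) (b i) ci0 (nb i) bB b0).
      apply: nint_le_set => // x nU /= Bx; apply: nU; exists i => //.
      by move: Bx; congr (B _ _ _); ring.
    rewrite -ge0_sume_distrr; last by move=> i _; exact: nint_ge0.
    rewrite EFinM [(3 * I)%:E]EFinM; apply: lee_wpmul2l => //; first by rewrite lee_fin ltW.
  have {}h := le_trans h h2.
  have q0 : 0 < (l / 2)^-1 by rewrite invr_gt0.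
  have := lee_wpmul2l (ltW q0 : (0 <= ((l / 2)^-1)%:E)%E) h.
  rewrite muleA -!EFinM mulVf ?gt_eqF // mul1e => /le_trans; apply.
  by rewrite lee_fin le_eqVlt; apply/orP; left; apply/eqP; field; rewrite gt_eqF.
apply: (le_trans (leeD t1 (le_trans (measureU2 mu mU mE2) (leeD t2 t3)))).
rewrite -!(EFinM, EFinD) lee_fin.
have -> : e' = Cw / l * e by rewrite /e; field; rewrite !gt_eqF.
have P0 : 0 <= (K ^+ 4 + 6 * Ct) / l * e.
  apply: mulr_ge0; last exact: ltW.
  apply: divr_ge0; last exact: ltW.
  by apply: addr_ge0; [apply: exprn_ge0; exact: ltW|apply: mulr_ge0 => //; exact: ltW].
rewrite -subr_ge0; move: P0; congr (_ <= _); rewrite /Cw; field; rewrite gt_eqF //.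
Qed.

End Decomposition.

(** * Bounds on L^p *)

Section LpBounds.
Context (R : realType) (X : ptopologicalType) (d : X -> X -> R).
Context (mu : {measure set (borel X) -> \bar R}) (c K : R).
Hypothesis hd : quasi_metric d.
Hypothesis hX : homogeneous_type mu (qball d) c K.
Hypothesis hg : ball_growth mu (qball d) c.
Local Notation B := (qball d).
Local Notation vol := (vol mu B).
Local Notation nint A u := (nint mu A%classic u%R).
Local Notation cm f := (cmeasurable [set: borel X] f).
Local Notation nice := (nice d).
Local Notation Omega := (Omega mu B).
Let c0 : 0 < c := c_gt0 hX.
Let K0 : 0 < K := K_gt0 hX.
Let c1 : 1 < c := hom_c hX.
Implicit Types (f g h : X -> R[i]) (A E F W : set X).

Lemma measurable_normc_powR f (p : R) : cm f ->
  measurable_fun setT ((fun x => normc (f x) `^ p) : borel X -> R).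
Proof.
by move=> mf; apply: (measurableT_comp (measurable_powR p)); exact: measurable_normc.
Qed.

(** The q-th power maximal function of [u] is bounded on L^p for [q < p], with the level rescaled by
    [g]. *)
Lemma layer_Omega_powR (a p q g : R) : 1 < a -> 0 < q < p -> 0 < g ->
  exists2 C : R, 0 < C & forall (u : X -> R) s, 0 < s ->
    measurable_fun setT (u : borel X -> R) -> (forall x, 0 <= u x) ->
    (layer mu a p s (fun l => Omega (fun x => (u x `^ q)%R) ((g * l) `^ q)%R) <=
      C%:E * nint setT (fun x => u x `^ p))%E.
Proof.
move=> a1 /andP[q0 qp] g0; have pq : 1 < p / q by rewrite ltr_pdivlMr // mul1r.
have [C C0 HC] := layer_Omega hX (powR_gt1 a1 q0) pq.
exists (g `^ (- p) * C) => [|u s s0 mfu u0]; first by rewrite mulr_gt0 // powR_gt0.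
rewrite (layer_rescale mu p (Omega (fun x => (u x `^ q)%R)) s0 a1 q0 g0) EFinM -muleA.
apply: lee_wpmul2l; first by rewrite lee_fin powR_ge0.
have -> : nint setT (fun x => u x `^ p) = nint setT (fun x => (u x `^ q) `^ (p / q)).
  by apply: eq_nint => x _; rewrite -powRrM mulrC divfK ?gt_eqF.
apply: HC => [||x]; [by rewrite powR_gt0 // mulr_gt0| |exact: powR_ge0].
exact: (measurableT_comp (measurable_powR q)).
Qed.

Variables (delta : R) (k : X -> X -> R[i]) (eps Ck : R).
Variables (T2 : (X -> R[i]) -> X -> R[i]) (C2 : R).
Hypothesis hk : kernel_operator d mu c delta k eps Ck T2 C2.
Local Notation kernel_op := (kernel_op mu k).
Let mT h : nice h -> cm (T2 h) := ko_measurable hk (f := h).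
Let C20 : 0 <= C2 := ko_C2 hk.

Lemma T2_split f g : nice f -> nice g ->
  {ae mu, forall x, T2 f x = T2 g x + T2 (fun y => f y - g y) x}.
Proof.
move=> nf ng; have := ko_linear hk 1 ng (niceB hd hX nf ng).
apply: ae_mono => x; rewrite mul1r => <-; congr (T2 _ x).
by apply/funext => y; rewrite mul1r addrC subrK.
Qed.

Lemma weak_type22 g (s : R) : nice g -> 0 < s ->
  (mu [set x | (s < normc (T2 g x))%R] <=
   (C2 / s ^+ 2)%:E * nint setT (fun x => normc (g x) ^+ 2))%E.
Proof.
move=> ng s0.
have := chebyshev mu measurableT (measurable_normc_sqr (mT ng)) (fun x => sqr_ge0 _) (sqr_ge0 s).
rewrite setTI (_ : [set x | s ^+ 2 < _] = [set x | s < normc (T2 g x)]); last first.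
  by apply/seteqP; split => x; rewrite /= ltr_sqr ?nnegrE ?(ltW s0).
move=> h; have {}h := le_trans h (ko_L2 hk ng).
have s2 : 0 < (s ^+ 2)^-1 by rewrite invr_gt0 exprn_gt0.
have := lee_wpmul2l (ltW s2 : (0 <= ((s ^+ 2)^-1)%:E)%E) h.
by rewrite !muleA -!EFinM mulVf ?gt_eqF ?exprn_gt0 // mul1e [_ * C2]mulrC.
Qed.

(** For each level [l], split [f] at height [l] and apply weak type (1,1) to the large part and
    (2,2) to the small one, both at [l / 2]; hence the constants [2 * Cw] and [4 * C2]. *)
Lemma bounded_below2 (p : R) : 1 < p < 2 -> exists2 A : R, 0 < A & forall f, nice f ->
  (nint setT (fun x => normc (T2 f x) `^ p) <= A%:E * nint setT (fun x => normc (f x) `^ p))%E.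
Proof.
move=> p12; have /andP[p1 p2] := p12; have p0 : 0 < p by lra.
have [Cw Cw0 HCw] := weak_type11 hd hX hg hk.
have a1 : 1 < 2 :> R by rewrite ltr1n.
have [||C C0 HC] := @marcinkiewicz _ (borel X) R mu 2 p (2 * Cw) (4 * C2) a1 p12.
- by rewrite mulr_ge0 // ltW.
- by rewrite mulr_ge0.
exists (2 `^ p * C) => [|f nf]; first by rewrite mulr_gt0 // powR_gt0.
have [mf [M fM] bf] := nf.
have mfu : measurable_fun setT ((fun x => normc (f x)) : borel X -> R) by exact: measurable_normc.
have mTf : measurable_fun setT ((fun x => normc (T2 f x)) : borel X -> R).
  by apply: measurable_normc; exact: mT.
rewrite EFinM -muleA; apply: nint_powR_le_layer => // s s0.
apply: HC => // l l0; have l20 : 0 < l / 2 by lra.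
pose A := [set x | l < normc (f x)].
have mA : measurable (A : set (borel X)) by exact: measurable_gt.
pose f1 x : R[i] := (\1_A x)%:C * f x.
have n1 : nice f1 by exact: nice_restrict.
have n2 : nice (fun x => f x - f1 x) by exact: (niceB hd hX).
have m1 : measurable ([set x | l / 2 < normc (T2 f1 x)] : set (borel X)).
  by apply: measurable_gt; apply: measurable_normc; exact: mT.
have m2 : measurable ([set x | l / 2 < normc (T2 (fun x => f x - f1 x) x)] : set (borel X)).
  by apply: measurable_gt; apply: measurable_normc; exact: mT.
have sub : {ae mu, forall x, [set x | l < normc (T2 f x)] x ->
    ([set x | l / 2 < normc (T2 f1 x)] `|`
     [set x | l / 2 < normc (T2 (fun x => f x - f1 x) x)]) x}.
  apply: ae_mono (T2_split nf n1) => x /= -> h.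
  have [|h1] := ltP (l / 2) (normc (T2 f1 x)); [by left|right].
  rewrite ltNge; apply/negP => h2; have := lerD h1 h2.
  by rewrite -splitr leNgt (lt_le_trans h) // le_normcD.
apply: (le_trans (le_measure_ae (measurable_gt l mTf) (measurableU _ _ m1 m2) sub)).
apply: (le_trans (measureU2 mu m1 m2)); apply: leeD.
  apply: (le_trans (HCw _ _ n1 l20)).
  have -> : Cw / (l / 2) = 2 * Cw / l by field; rewrite gt_eqF.
  apply: lee_wpmul2l; first by rewrite lee_fin divr_ge0 ?mulr_ge0 // ltW.
  rewrite -/A -(setTI A) -nint_indic; apply: nint_le_fun => x _; rewrite normc_ge0 /=.
  by rewrite Normc.normcM normc_real ger0_norm // mulrC.
apply: (le_trans (weak_type22 n2 l20)).
have -> : C2 / (l / 2) ^+ 2 = 4 * C2 / l ^+ 2 by field; rewrite gt_eqF.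
apply: lee_wpmul2l; first by rewrite lee_fin; apply: divr_ge0; [exact: mulr_ge0|exact: sqr_ge0].
rewrite -(setTI [set x | _ <= l]) -nint_indic; apply: nint_le_fun => x _; rewrite sqr_ge0 /=.
rewrite /f1 /A !indic_bool; case: leP => /= h; rewrite ?mul0r ?subr0 ?mul1r ?mulr1 //.
by rewrite subrr Normc.normc0 expr0n mulr0.
Qed.

(** The part of [h] near the ball is controlled by the L^t bound. The far part is given by the
    kernel on the ball and varies little there, by smoothness; its modulus at the centre is the
    constant [a]. The means of [h] may grow with the dilation, at half the rate at which the kernel
    decays: for the commutator [h] carries a factor [b - beta]. *)
Lemma T2_oscillation (t A : R) : 1 < t -> 0 <= A ->
  (forall f, nice f -> (nint setT (fun x => normc (T2 f x) `^ t) <=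
    A%:E * nint setT (fun x => normc (f x) `^ t))%E) ->
  exists2 C : R, 0 < C & forall x0 (r D : R) h, nice h -> 0 < r -> 0 < D ->
    (forall m, (nint (B x0 (c ^+ m * r)) (fun x => normc (h x) `^ t) <=
       ((D * c `^ (m%:R * (eps / 2))) `^ t)%:E * mu (B x0 (c ^+ m * r)%R))%E) ->
    exists2 a : R, 0 <= a & (nint (B x0 r) (fun x => `|normc (T2 h x) - a|) <=
      (C * D)%:E * mu (B x0 r))%E.
Proof.
move=> t1 A0 HA; have t0 : 0 < t by lra.
have [Ct Ct0 HCt] := annuli_tail hX (ko_eps hk) (ko_Ck hk).
pose L := (c `^ (3%:R * (eps / 2))) `^ t; have L0 : 0 <= L by exact: powR_ge0.
pose C := 1 + A * L * K ^+ 3 + 4 * Ct.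
have K3 : 0 <= A * L * K ^+ 3 by rewrite !mulr_ge0 // ltW.
exists C => [|x0 r D h nh r0 D0 hD]; first by rewrite /C; lra.
have [mh _ _] := nh.
have cr0 : 0 < c * r by rewrite mulr_gt0.
have r3 : 0 < c ^+ 3 * r by rewrite mulr_gt0 // exprn_gt0.
have mB := measurable_qball hX x0 r0.
have mB3 := measurable_qball hX x0 r3.
pose h1 x : R[i] := (\1_(B x0 (c ^+ 3 * r)) x)%:C * h x.
pose h2 x := h x - h1 x.
have n1 : nice h1 by exact: nice_restrict.
have n2 : nice h2 by exact: (niceB hd hX).
have [m1 _ _] := n1; have [m2 _ _] := n2.
have h20 x : B x0 (c ^+ 3 * r) x -> h2 x = 0.
  by move=> Bx; rewrite /h2 /h1 indicE mem_set //= mul1r subrr.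
have sub3 : B x0 (c * r) `<=` B x0 (c ^+ 3 * r).
  apply: (hom_nested hX) => //; rewrite ler_pM2r // exprS ler_peMr ?(ltW c0) //.
  by rewrite exprn_ege1 // ltW.
have h2W : nonzero h2 `<=` ~` B x0 (c * r).
  by move=> x nz /sub3 /h20.
have h2h x : normc (h2 x) <= normc (h x).
  rewrite /h2 /h1 indicE; case: (_ \in _); rewrite ?mul1r ?mul0r ?subr0 //=.
  by rewrite subrr Normc.normc0.
pose a := normc (kernel_op h2 x0); exists a; first exact: normc_ge0.
have mT1 : measurable_fun setT ((fun x => normc (T2 h1 x)) : borel X -> R).
  by apply: measurable_normc; exact: mT.
(* Hölder's inequality in the form [v <= D + D^(1-t) v^t] *)
have b1 : (nint (B x0 r) (fun x => normc (T2 h1 x)) <=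
    ((1 + A * L * K ^+ 3) * D)%:E * mu (B x0 r))%E.
  apply: (le_trans (nint_powR_lty_above mu D0 (ltW t1) mB mT1 (fun x => normc_ge0 _))).
  have e1 : (nint (B x0 r) (fun x => normc (T2 h1 x) `^ t) <=
      (A * L * K ^+ 3 * D `^ t)%:E * mu (B x0 r))%E.
    apply: (@le_trans _ _ (nint setT (fun x => normc (T2 h1 x) `^ t))).
      by apply: nint_le_set => // x; exact: powR_ge0.
    apply: (le_trans (HA _ n1)).
    have e2 : (nint setT (fun x => normc (h1 x) `^ t) <= (D `^ t * L * K ^+ 3)%:E * mu (B x0 r))%E.
      apply: (@le_trans _ _ (nint (B x0 (c ^+ 3 * r)) (fun x => normc (h x) `^ t))).
        rewrite -(setTI (B x0 _)) -nint_indic; apply: nint_le_fun => x _; rewrite powR_ge0 /=.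
        rewrite /h1 indicE; case: (_ \in _); rewrite /= ?mul1r ?mulr1 ?mul0r ?mulr0 //.
        by rewrite Normc.normc0 powR0 ?gt_eqF.
      apply: (le_trans (hD 3%N)); rewrite powRM ?powR_ge0 ?(ltW D0) // -/L.
      rewrite !(volE hX) // -!EFinM lee_fin -[leRHS]mulrA.
      apply: ler_wpM2l; first by rewrite mulr_ge0 ?powR_ge0.
      exact: vol_dil.
    apply: le_trans (lee_wpmul2l _ e2) _; first by rewrite lee_fin.
    rewrite muleA -EFinM; apply: lee_wpmul2r => //; rewrite lee_fin le_eqVlt.
    by apply/orP; left; apply/eqP; ring.
  apply: le_trans (leeD (lexx _) (lee_wpmul2l _ e1)) _; first by rewrite lee_fin powR_ge0.
  rewrite (volE hX) // -!EFinM -EFinD lee_fin.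
  have e3 : D `^ (1 - t) * D `^ t = D.
    by rewrite -powRD ?subrK ?powRr1 ?(ltW D0) // (gt_eqF D0) implybT.
  rewrite (_ : D `^ (1 - t) * _ = A * L * K ^+ 3 * (D `^ (1 - t) * D `^ t) * vol x0 r); last by ring.
  by rewrite e3 le_eqVlt; apply/orP; left; apply/eqP; ring.
have b2 x : B x0 r x -> normc (kernel_op h2 x - kernel_op h2 x0) <= 4 * Ct * D.
  move=> Bx; have Bx0 : B x0 r x0 by exact: (hom_center hX).
  have [kap kap0 kapP] := kernel_bounded hd hX (ko_Ck hk) (ko_size hk)
    (@qbounded_ball _ _ d x0 r) (separated_dil hd hX x0 r0).
  have ki z : B x0 r z -> cintegrable mu setT (fun y => k z y * h2 y).
    move=> Bz; exact: (kernel_cintegrable hd hX (ko_measurable_kernel hk) kap0 kapP n2 h2W Bz).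
  have mkk : cm (fun y => k x y - k x0 y).
    by apply: cmeasurableB; exact: (kernel_section_cm hk).
  have mkh : cm (fun y => (k x y - k x0 y) * h2 y) by exact: cmeasurableM.
  (* The factor 2 comes from the inequality [v <= D + D ^ (1 - t) * v ^ t] on each dilate, both
     terms having mean at most [D]. *)
  have tail : (nint setT (fun y => normc ((k x y - k x0 y) * h2 y)) <= (Ct * (2 * D))%:E)%E.
    apply: (@le_trans _ _ (nint (~` B x0 (c * r)) (fun y => normc ((k x y - k x0 y) * h2 y)))).
      rewrite -(setTI (~` _)) -nint_indic; apply: nint_le_fun => y _; rewrite normc_ge0 /=.
      rewrite indicE; have [Wy|nWy] := pselect ((~` B x0 (c * r)) y).
        by rewrite mem_set // mulr1.
      rewrite [h2 y]h20 ?mulr0 ?Normc.normc0 ?mul0r //.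
      by apply: sub3; apply: contrapT.
    apply: (HCt x0 r (2 * D) (fun y => normc (h y))) => //.
    - by rewrite mulr_ge0 // ltW.
    - exact: measurable_normc.
    - exact: measurable_normc.
    - move=> y nBy; rewrite Normc.normcM.
      have dy : c * r <= d x0 y by rewrite leNgt; apply/negP.
      have dy0 : 0 < d x0 y by apply: lt_le_trans dy.
      have xy : x0 <> y by move=> e; move: dy0; rewrite e (distxx hd) ltxx.
      have L1 : 0 <= Ck / lambda mu d x0 y.
        rewrite divr_ge0 ?(ltW (ko_Ck hk)) // /lambda -/(vol x0 (d x0 y)).
        by rewrite (vol_ge0 hX).
      apply: ler_pM => //; have cd : c * d x0 x <= d x0 y.
        by apply: le_trans dy; rewrite ler_pM2l // ltW.
      have := ko_smooth hk xy cd; rewrite (normc_distC (k x y)).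
      have n0 := normc_ge0 (k y x0 - k y x).
      have : (d x0 x / d x0 y) `^ eps <= (r / d x0 y) `^ eps.
        apply: le_powR_base; [exact: ltW (ko_eps hk)|by rewrite divr_ge0 ?(dist_ge0 hd)|].
        by rewrite ler_pM2r ?invr_gt0 // ltW.
      move=> /(ler_wpM2r L1) h3 h4; apply: le_trans h3; apply: le_trans h4.
      by rewrite lerDl.
    - move=> m; have rm : 0 < c ^+ m * r by rewrite mulr_gt0 // exprn_gt0.
      have mBm := measurable_qball hX x0 rm.
      set Dm := D * c `^ (m%:R * (eps / 2)).
      have Dm0 : 0 < Dm by rewrite mulr_gt0 // powR_gt0.
      have mnh : measurable_fun setT ((fun y => normc (h y)) : borel X -> R).
        exact: measurable_normc.
      apply: (le_trans (nint_powR_lty_above mu Dm0 (ltW t1) mBm mnh (fun x => normc_ge0 _))).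
      apply: le_trans (leeD (lexx _) (lee_wpmul2l _ (hD m))) _; first by rewrite lee_fin powR_ge0.
      rewrite -/Dm (volE hX) // -!EFinM -EFinD lee_fin (mulrA (Dm `^ (1 - t))).
      rewrite -powRD ?(gt_eqF Dm0) ?implybT // subrK powRr1 ?(ltW Dm0) // le_eqVlt; apply/orP; left; apply/eqP.
      by rewrite /Dm; ring.
  have fin : (nint setT (fun y => normc ((k x y - k x0 y) * h2 y)) < +oo)%E.
    by apply: le_lt_trans tail _; rewrite ltry.
  have -> : kernel_op h2 x - kernel_op h2 x0 = cintegral mu setT (fun y => (k x y - k x0 y) * h2 y).
    rewrite /kernel_op -cintegralB //; [|exact: ki|exact: ki].
    by apply: eq_cintegral => y _; rewrite mulrBl.
  rewrite -lee_fin; apply: (le_trans (normc_cintegral_le _ mkh fin)) => //.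
  apply: le_trans (lee_wpmul2l _ tail) _ => //.
  by rewrite -EFinM lee_fin le_eqVlt; apply/orP; left; apply/eqP; ring.
apply: (@le_trans _ _ (nint (B x0 r) (fun x => normc (T2 h1 x) + 4 * Ct * D))).
  apply: nint_ae_le => //.
  - apply: (measurableT_comp (@normr_measurable R setT)); apply: measurable_funB => //.
    by apply: measurable_normc; exact: mT.
  - exact: measurable_funD.
  - by move=> x; rewrite addr_ge0 // !mulr_ge0 // ltW.
  apply: ae_mono (ae_and (T2_split nh n1) (kernel_near hd hX hk r0 n2 h20)) => x [e1 e2] Bx.
  rewrite /a e1 -/(T2 h2) (e2 Bx); apply: (le_trans (normc_dist_le _ _)).
  by rewrite -addrA; apply: (le_trans (le_normcD _ _)); rewrite lerD2l b2.
rewrite nintD //; last by move=> x; rewrite !mulr_ge0 // ltW.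
rewrite nint_cst //; apply: (le_trans (leeD b1 (lexx _))).
rewrite (volE hX) // -!EFinM -EFinD lee_fin le_eqVlt; apply/orP; left; apply/eqP.
by rewrite /C; ring.
Qed.

Lemma bounded_at2 f : nice f -> (nint setT (fun x => normc (T2 f x) `^ 2) <=
    C2%:E * nint setT (fun x => normc (f x) `^ 2))%E.
Proof.
move=> nf; apply: (@le_trans _ _ (nint setT (fun x => normc (T2 f x) ^+ 2))).
  by apply: nint_le_fun => x _; rewrite powR_ge0 powR_mulrn /=.
apply: (le_trans (ko_L2 hk nf)); apply: lee_wpmul2l; first by rewrite lee_fin.
by apply: nint_le_fun => x _; rewrite sqr_ge0 powR_mulrn /=.
Qed.

Lemma notin_Omega u l z y r : ~ Omega u l z -> 0 < r -> B y r z ->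
  (nint (B y r) u <= l%:E * mu (B y r))%E.
Proof. by move=> nO r0 Bz; rewrite leNgt; apply/negP => lt; apply: nO; exists y, r. Qed.

(** Sharp-function bound with [E'] a superlevel set of the square maximal function of [f]: a ball
    through a point outside it, and all its dilates, satisfy the hypothesis of [T2_oscillation]. The
    finiteness known beforehand is in L^2. *)
Lemma bounded_above2 (p : R) : 2 < p -> exists2 A : R, 0 < A & forall f, nice f ->
  (nint setT (fun x => normc (T2 f x) `^ p) <= A%:E * nint setT (fun x => normc (f x) `^ p))%E.
Proof.
move=> p2; have p1 : 1 < p by lra.
have K1 := hom_K hX.
have [g [C [/andP[g0 g1] C0 HC]]] := sharp_function_bound hX hg p1.
have [|Co Co0 HCo] := @T2_oscillation 2 C2 _ C20 bounded_at2; first by lra.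
(* Scaling the level by [gam] turns the oscillation bound [Co * (gam * l)] into the required
   [g * l]. *)
pose gam := g / Co; have gam0 : 0 < gam by rewrite divr_gt0.
have a1 : 1 < K + 3 by lra.
have [|CL CL0 HL] := @layer_Omega_powR (K + 3) p 2 gam a1 _ gam0; first by rewrite p2 andbT.
exists (C * CL) => [|f nf]; first exact: mulr_gt0.
have [mf _ _] := nf.
have mfu : measurable_fun setT ((fun x => normc (f x)) : borel X -> R) by exact: measurable_normc.
rewrite EFinM -muleA.
apply: (HC _ (fun l => Omega (fun x => (normc (f x) `^ 2)%R) ((gam * l) `^ 2)) 2).
- by apply: measurable_normc; exact: mT.
- by [].
- by apply/andP; split; lra.
- apply: le_lt_trans (bounded_at2 nf) _.
  have := nice_Lp hd hX (ltr0n R 2) nf.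
  have := nint_ge0 mu (A := setT) (fun x _ => powR_ge0 (normc (f x)) 2).
  by case: (nint _ _) => [v| |] // _ _; rewrite -?EFinM ltry.
- by move=> l; exact: (measurable_Omega hX).
- move=> l y r z l0 r0 Bz nO.
  have D0 : 0 < gam * l by rewrite mulr_gt0.
  have [m|a a0 ha] := HCo y r (gam * l) f nf r0 D0.
    have rm : 0 < c ^+ m * r by rewrite mulr_gt0 // exprn_gt0.
    have Bm : B y (c ^+ m * r) z.
      by apply: (hom_nested hX r0 _ Bz); rewrite ler_peMl ?(ltW r0) // exprn_ege1 // ltW.
    apply: (le_trans (notin_Omega nO rm Bm)); apply: lee_wpmul2r => //.
    rewrite lee_fin; apply: le_powR_base => //; first exact: ltW.
    rewrite ler_peMr ?(ltW D0) // -{1}(powRr0 c); apply: ler_powR; first exact: ltW.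
    by rewrite mulr_ge0 ?divr_ge0 ?(ltW (ko_eps hk)).
  exists a => //; apply: (le_trans ha); apply: lee_wpmul2r => //.
  by rewrite lee_fin /gam mulrA [Co * _]mulrC divfK ?gt_eqF.
- by move=> s s0; exact: HL.
Qed.

Lemma T2_bounded (p : R) : 1 < p -> exists2 A : R, 0 < A & forall f, nice f ->
  (nint setT (fun x => normc (T2 f x) `^ p) <= A%:E * nint setT (fun x => normc (f x) `^ p))%E.
Proof.
move=> p1; have [p2|p2|->] := ltgtP p 2.
- by apply: bounded_below2; rewrite p1.
- exact: bounded_above2.
- exists (C2 + 1) => [|f nf]; first by rewrite ltr_wpDl.
  apply: (le_trans (bounded_at2 nf)); apply: lee_wpmul2r; last by rewrite lee_fin lerDl.
  by apply: nint_ge0 => x _; exact: powR_ge0.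
Qed.

End LpBounds.

(** * The commutator with a bounded function *)

Section Commutator.
Context (R : realType) (X : ptopologicalType) (d : X -> X -> R).
Context (mu : {measure set (borel X) -> \bar R}) (c K : R).
Hypothesis hd : quasi_metric d.
Hypothesis hX : homogeneous_type mu (qball d) c K.
Hypothesis hg : ball_growth mu (qball d) c.
Local Notation B := (qball d).
Local Notation nint A u := (nint mu A%classic u%R).
Local Notation cm f := (cmeasurable [set: borel X] f).
Local Notation nice := (nice d).
Let c0 : 0 < c := c_gt0 hX.
Let K0 : 0 < K := K_gt0 hX.
Let c1 : 1 < c := hom_c hX.
Implicit Types (f g h b : X -> R[i]) (A E F W : set X) (beta : X -> R -> R[i]).

(** Young's inequality applied to [w] and [v / G], multiplied by [G]; this is Hölder's inequality
    for means when the t-th mean of [v] is at most [G]. *)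
Lemma nint_mul_average A (w v : X -> R) (t G P : R) : 1 < t -> 0 < G ->
  measurable (A : set (borel X)) -> measurable_fun setT (w : borel X -> R) ->
  measurable_fun setT (v : borel X -> R) ->
  (forall x, 0 <= w x) -> (forall x, 0 <= v x) -> 0 <= P ->
  (nint A (fun x => w x `^ (t / (t - 1))) <= P%:E * mu A)%E ->
  (nint A (fun x => v x `^ t) <= (G `^ t)%:E * mu A)%E ->
  (nint A (fun x => w x * v x) <= (G * (P + 1))%:E * mu A)%E.
Proof.
move=> t1 G0 mA mw mv w0 v0 P0 hw hv; have t0 : 0 < t by lra.
set q := t / (t - 1) in hw *; have q0 : 0 < q by rewrite divr_gt0 // subr_gt0.
have mwq : measurable_fun setT ((fun x => w x `^ q) : borel X -> R).
  exact: (measurableT_comp (measurable_powR q)).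
have mvt : measurable_fun setT ((fun x => v x `^ t) : borel X -> R).
  exact: (measurableT_comp (measurable_powR t)).
have G1 : 0 < G `^ (1 - t) by exact: powR_gt0.
apply: (@le_trans _ _ (nint A (fun x => G * w x `^ q + G `^ (1 - t) * v x `^ t))).
  apply: nint_le_fun => x _; rewrite mulr_ge0 //=.
  have vG : 0 <= v x / G by rewrite divr_ge0 // ltW.
  have qt : q^-1 + t^-1 = 1 by rewrite /q; field; rewrite !gt_eqF // subr_gt0.
  have := conjugate_powR (w0 x) vG q0 t0 qt.
  have e1 : (v x / G) `^ t = v x `^ t * G `^ (- t).
    by rewrite powR_div // ?(ltW G0) // powRN.
  rewrite e1 -(ler_pM2l G0).
  have -> : G * (w x * (v x / G)) = w x * v x by field; rewrite gt_eqF.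
  move=> /le_trans; apply; rewrite mulrDr; apply: lerD.
    apply: ler_wpM2l; first exact: ltW.
    rewrite ler_piMr ?powR_ge0 // invf_le1 // /q ler_pdivlMr ?subr_gt0 // mul1r.
    by rewrite gerBl.
  have -> : G `^ (1 - t) = G * G `^ (- t).
    by rewrite powRD ?powRr1 ?(ltW G0) // (gt_eqF G0) implybT.
  rewrite -(mulrA G) [G `^ (- t) * _]mulrC; apply: ler_wpM2l; first exact: ltW.
  by rewrite ler_piMr ?mulr_ge0 ?powR_ge0 // invf_le1 // ltW.
rewrite nintD //; last 4 first.
- by apply: measurable_funM.
- by apply: measurable_funM.
- by move=> x; rewrite mulr_ge0 ?powR_ge0 // ltW.
- by move=> x; rewrite mulr_ge0 ?powR_ge0 // ltW.
rewrite !nintZ ?(ltW G0) ?(ltW G1) //; [|by move=> x; exact: powR_ge0..].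
apply: (le_trans (leeD (lee_wpmul2l _ hw) (lee_wpmul2l _ hv))); rewrite ?lee_fin ?(ltW G0) ?(ltW G1) //.
have e2 : G `^ (1 - t) * G `^ t = G.
  by rewrite -powRD ?subrK ?powRr1 ?(ltW G0) // (gt_eqF G0) implybT.
rewrite !muleA -!EFinM e2 mulrDr mulr1 EFinD ge0_muleDl //.
- by rewrite lee_fin mulr_ge0 // ltW.
- by rewrite lee_fin ltW.
Qed.

(** Consecutive constants differ by at most [N * K + N], the larger ball being compared on the
    smaller one through doubling; the differences telescope. *)
Lemma oscillation_chain b beta (N : R) y r m : cm b -> 0 < r -> 0 <= N ->
  (forall y r, 0 < r ->
    (nint (B y r) (fun x => normc (b x - beta y r)) <= N%:E * mu (B y r))%E) ->
  normc (beta y (c ^+ m * r) - beta y r) <= m%:R * (N * (1 + K)).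
Proof.
move=> mb r0 N0 hN; elim: m => [|m IH].
  by rewrite expr0 mul1r subrr Normc.normc0 mul0r.
have rm : 0 < c ^+ m * r by rewrite mulr_gt0 // exprn_gt0.
have rm1 : 0 < c ^+ m.+1 * r by rewrite mulr_gt0 // exprn_gt0.
have mBm := measurable_qball hX y rm.
have pB : (0 < mu (B y (c ^+ m * r)) < +oo)%E.
  by rewrite (volE hX) // lte_fin (vol_gt0 hX) // ltry.
have h2 : (nint (B y (c ^+ m * r)) (fun x => normc (b x - beta y (c ^+ m.+1 * r))) <=
    (N * K)%:E * mu (B y (c ^+ m * r)))%E.
  apply: (@le_trans _ _ (nint (B y (c ^+ m.+1 * r)) (fun x => normc (b x - beta y (c ^+ m.+1 * r))))).
    by apply: nint_le_set => //; rewrite exprS -mulrA; exact: (subset_dil hX).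
  apply: (le_trans (hN _ _ rm1)); rewrite !(volE hX) // -!EFinM lee_fin -mulrA.
  by apply: ler_wpM2l => //; rewrite exprS -mulrA; exact: vol_doubling.
have h3 := oscillation_constants mBm pB mb h2 (hN _ _ rm).
apply: (le_trans (normc_triangle (beta y (c ^+ m * r)) _ _)).
apply: (le_trans (lerD h3 IH)); rewrite -natr1 le_eqVlt; apply/orP; left; apply/eqP; ring.
Qed.

(* The means of [b] over the dilates of a ball grow linearly in the exponent,
   which the geometric growth allowed in [annuli_tail] absorbs. *)
Lemma natr_powR_le (e q : R) : 0 < e -> 0 < q -> exists2 L : R, 0 < L &
  forall m : nat, m%:R `^ q <= L * c `^ (m%:R * e).
Proof.
move=> e0 q0; pose a := c `^ (e / q).
have a1 : 1 < a by apply: powR_gt1 => //; exact: divr_gt0.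
have a10 : 0 < a - 1 by rewrite subr_gt0.
exists ((a - 1)^-1 `^ q) => [|m]; first by rewrite powR_gt0 // invr_gt0.
have -> : c `^ (m%:R * e) = (a ^+ m) `^ q.
  rewrite /a -powR_mulrn ?powR_ge0 // -!powRrM; congr (_ `^ _).
  by field; rewrite gt_eqF.
have am : 0 <= a ^+ m by rewrite exprn_ge0 // ltW // (lt_trans ltr01).
rewrite -powRM ?invr_ge0 ?(ltW a10) //; apply: le_powR_base => //; first exact: ltW.
rewrite ler_pdivlMl //; apply: le_trans (bernoulli_ineq m (ltW a1)).
by rewrite mulrC lerDr.
Qed.

Variables (delta : R) (k : X -> X -> R[i]) (eps Ck : R).
Variables (T2 : (X -> R[i]) -> X -> R[i]) (C2 : R).
Hypothesis hk : kernel_operator d mu c delta k eps Ck T2 C2.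
Let mT h : nice h -> cm (T2 h) := ko_measurable hk (f := h).

(** A constant commutes with the operator, so the commutator does not change when [z] is subtracted
    from [b]. *)
Lemma commutator_shift b (M : R) (z : R[i]) f : cm b -> (forall x, normc (b x) <= M) ->
  nice f -> {ae mu, forall x, commutator b T2 f x =
    (b x - z) * T2 f x - T2 (fun y => (b y - z) * f y) x}.
Proof.
move=> mb bM nf; have nbf := niceMl mb bM nf.
apply: ae_mono (ko_linear hk (- z) nf nbf) => x.
rewrite (_ : (fun y => - z * f y + b y * f y) = (fun y => (b y - z) * f y)); last first.
  by apply/funext => y; rewrite mulrBl addrC mulNr.
by move=> ->; rewrite /commutator; ring.
Qed.

(** With [z = beta y r], the term [(b - z) * T2 f] is small in the mean by Hölder's inequality on
    the ball alone, and [T2 ((b - z) * f)] is nearly constant by [T2_oscillation]. Both use powers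
    of [b - z] bounded by the John-Nirenberg inequality, so [M] does not enter the constant. *)
Lemma commutator_oscillation (s N : R) : 1 < s -> 0 < N -> exists2 C : R, 0 < C &
  forall b beta (M : R) f y r (G : R), cm b -> (forall x, normc (b x) <= M) ->
  (forall y r, 0 < r ->
    (nint (B y r) (fun x => normc (b x - beta y r)) <= N%:E * mu (B y r))%E) ->
  nice f -> 0 < r -> 0 < G ->
  (forall m, (nint (B y (c ^+ m * r)) (fun x => normc (f x) `^ s) <=
     (G `^ s)%:E * mu (B y (c ^+ m * r)%R))%E) ->
  (nint (B y r) (fun x => normc (T2 f x) `^ s) <= (G `^ s)%:E * mu (B y r))%E ->
  exists2 a : R, 0 <= a &
    (nint (B y r) (fun x => `|normc (commutator b T2 f x) - a|) <=
     (C * G)%:E * mu (B y r))%E.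
Proof.
(* The square root of [s]: bounding the t-th power of [(b - z) * f] by Hölder's inequality with
   exponent [t] on [f] uses exactly the s-th power of [f]. *)
move=> s1 N0; pose t := s `^ 2^-1.
have t1 : 1 < t by apply: powR_gt1 => //; rewrite invr_gt0.
have t0 : 0 < t by lra. have s0 : 0 < s by lra.
have ts : t * t = s.
  rewrite /t -powRD; last by rewrite (gt_eqF s0) implybT.
  by rewrite (_ : 2^-1 + 2^-1 = 1) ?powRr1 ?(ltW s0) //; field.
pose q' := t / (t - 1); pose q := t * q'.
have q'1 : 1 <= q' by rewrite /q' ler_pdivlMr ?subr_gt0 // mul1r gerBl.
have q1 : 1 <= q by rewrite /q -[1]mulr1; apply: ler_pM => //; exact: ltW.
have q0 : 0 < q by lra.
pose s' := s / (s - 1).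
have s'1 : 1 <= s' by rewrite /s' ler_pdivlMr ?subr_gt0 // mul1r gerBl.
have [A A0 HA] := T2_bounded hd hX hg hk t1.
have [Co Co0 HCo] := T2_oscillation hd hX hk t1 (ltW A0) HA.
have [J1 J10 HJ1] := john_nirenberg hX hg q1 N0.
have [J2 J20 HJ2] := john_nirenberg hX hg s'1 N0.
have et0 : 0 < eps / 2 * t by rewrite !mulr_gt0 ?(ko_eps hk).
have [L L0 HL] := natr_powR_le et0 q0.
have NK : 0 < N * (1 + K) by rewrite mulr_gt0 ?addr_gt0.
(* On the m-th dilate the q-th mean of [b - z] grows like [m ^ q], from the drift of the constants;
   [L] absorbs this into the permitted geometric growth. *)
pose L1 := 2 `^ q * (J1 + (N * (1 + K)) `^ q * L) + 1.
have L10 : 0 < L1.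
  by rewrite /L1 ltr_wpDl // mulr_ge0 ?powR_ge0 // addr_ge0 ?(ltW J10) // mulr_ge0 ?powR_ge0 ?(ltW L0).
pose L2 := L1 `^ t^-1; have L20 : 0 < L2 by rewrite powR_gt0.
have L2t : L2 `^ t = L1 by rewrite /L2 -powRrM mulVf ?gt_eqF // powRr1 // ltW.
exists (J2 + 1 + Co * L2) => [|b beta M f y r G mb bM hN nf r0 G0 hf hTf].
  by rewrite !addr_gt0 ?mulr_gt0.
pose z := beta y r.
have mbz : cm (fun x => b x - z) by apply: cmeasurableB => //; exact: cmeasurable_cst.
have bzM x : normc (b x - z) <= M + normc z.
  by apply: (le_trans (normcB_le _ _)); rewrite lerD2r.
pose h x := (b x - z) * f x.
have nh : nice h by exact: niceMl mbz bzM nf.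
have [mf _ _] := nf.
have mB := measurable_qball hX y r0.
have hD m : (nint (B y (c ^+ m * r)) (fun x => normc (h x) `^ t) <=
    ((G * L2 * c `^ (m%:R * (eps / 2))) `^ t)%:E * mu (B y (c ^+ m * r)%R))%E.
  have rm : 0 < c ^+ m * r by rewrite mulr_gt0 // exprn_gt0.
  have mBm := measurable_qball hX y rm.
  pose Pm := 2 `^ q * (J1 + (m%:R * (N * (1 + K))) `^ q).
  have Pm0 : 0 <= Pm by rewrite mulr_ge0 ?powR_ge0 // addr_ge0 ?powR_ge0 // ltW.
  have bP : (nint (B y (c ^+ m * r)) (fun x => (normc (b x - z) `^ t) `^ q') <=
      Pm%:E * mu (B y (c ^+ m * r)))%E.
    apply: (@le_trans _ _ (nint (B y (c ^+ m * r)) (fun x => normc (b x - z) `^ q))).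
      by apply: nint_le_fun => x _; rewrite powR_ge0 -powRrM /=.
    have zz := oscillation_chain y m mb r0 (ltW N0) hN.
    apply: (le_trans (nint_osc_powR mu mBm mb (ltW q0) zz)).
    rewrite EFinM -muleA; apply: lee_wpmul2l; first by rewrite lee_fin powR_ge0.
    rewrite EFinD ge0_muleDl ?lee_fin ?powR_ge0 ?(ltW J10) //.
    by apply: leeD => //; exact: (HJ1 b beta M).
  have fP : (nint (B y (c ^+ m * r)) (fun x => (normc (f x) `^ t) `^ t) <=
      ((G `^ t) `^ t)%:E * mu (B y (c ^+ m * r)))%E.
    rewrite -powRrM ts; apply: le_trans (hf m).
    by apply: nint_le_fun => x _; rewrite powR_ge0 -powRrM ts /=.
  have := nint_mul_average t1 (powR_gt0 t G0) mBm (measurable_normc_powR t mbz)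
    (measurable_normc_powR t mf) (fun x => powR_ge0 _ _) (fun x => powR_ge0 _ _) Pm0 bP fP.
  rewrite (_ : nint _ (fun x => normc (b x - z) `^ t * normc (f x) `^ t) =
      nint (B y (c ^+ m * r)) (fun x => normc (h x) `^ t)); last first.
    by apply: eq_nint => x _; rewrite /h Normc.normcM powRM.
  move=> /le_trans; apply; apply: lee_wpmul2r => //; rewrite lee_fin.
  rewrite powRM ?powR_ge0 ?mulr_ge0 ?(ltW G0) ?(ltW L20) // powRM ?(ltW G0) ?(ltW L20) //.
  rewrite L2t -mulrA; apply: ler_wpM2l; first exact: powR_ge0.
  rewrite -powRrM -mulrA.
  set cm_ := c `^ _; have cm1 : 1 <= cm_.
    rewrite -{1}(powRr0 c); apply: ler_powR; first exact: ltW.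
    by rewrite mulr_ge0 // ltW.
  rewrite /L1 /Pm powRM // ?(ltW NK) // mulrDl mul1r; apply: lerD => //.
  rewrite -mulrA; apply: ler_wpM2l; first exact: powR_ge0.
  rewrite mulrDl; apply: lerD; first by rewrite ler_peMr // ltW.
  by rewrite mulrC -mulrA; apply: ler_wpM2l; [exact: powR_ge0|exact: HL].
have [a a0 ha] := HCo y r (G * L2) h nh r0 (mulr_gt0 G0 L20) hD.
exists a => //.
have mTf := mT nf; have mTh := mT nh.
have b1 : (nint (B y r) (fun x => normc (b x - z) * normc (T2 f x)) <=
    (G * (J2 + 1))%:E * mu (B y r))%E.
  apply: (nint_mul_average s1 G0 mB _ _ _ _ (ltW J20) _ hTf) => //.
  - exact: measurable_normc.
  - exact: measurable_normc.
  - exact: (HJ2 b beta M).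
have mF : cm (commutator b T2 f).
  by apply: cmeasurableB; [exact: cmeasurableM|apply: mT; exact: niceMl mb bM nf].
have m1 : measurable_fun setT ((fun x => normc (b x - z) * normc (T2 f x)) : borel X -> R).
  by apply: measurable_funM; exact: measurable_normc.
have m2 : measurable_fun setT ((fun x => `|normc (T2 h x) - a|) : borel X -> R).
  apply: (measurableT_comp (@normr_measurable R setT)); apply: measurable_funB => //.
  exact: measurable_normc.
apply: (@le_trans _ _ (nint (B y r) (fun x => normc (b x - z) * normc (T2 f x) +
    `|normc (T2 h x) - a|))).
  apply: nint_ae_le => //.
  - apply: (measurableT_comp (@normr_measurable R setT)); apply: measurable_funB => //.
    exact: measurable_normc.
  - exact: measurable_funD.
  - by move=> x; rewrite addr_ge0 // mulr_ge0.
  apply: ae_mono (commutator_shift z mb bM nf) => x -> _.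
  rewrite -/h -Normc.normcM; set u := _ * T2 f x; set v := T2 h x.
  have h1 : `|normc (u - v) - normc v| <= normc u.
    rewrite normc_distC; apply: (le_trans (normc_dist_le _ _)).
    by rewrite addrAC subrr add0r normcN.
  have := ler_normD (normc (u - v) - normc v) (normc v - a).
  by rewrite addrA subrK => /le_trans; apply; rewrite lerD2r.
rewrite nintD //; last by move=> x; rewrite mulr_ge0.
apply: (le_trans (leeD b1 ha)).
rewrite (volE hX) // -!EFinM -EFinD lee_fin le_eqVlt; apply/orP; left; apply/eqP; ring.
Qed.

End Commutator.

Lemma lee_add_multiple (R : realType) (C A : R) (x y : \bar R) : 0 <= C -> 0 <= A ->
  (0 <= x)%E -> (0 <= y)%E -> (y <= A%:E * x)%E ->
  (C%:E * x + C%:E * y <= (C * (1 + A))%:E * x)%E.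
Proof.
move=> C0 A0 x0 y0 yx.
rewrite -ge0_muleDr // EFinM -muleA; apply: lee_wpmul2l; first by rewrite lee_fin.
by rewrite EFinD ge0_muleDl ?lee_fin // mul1e; exact: leeD.
Qed.

Section CommutatorBound.
Context (R : realType) (X : ptopologicalType) (d : X -> X -> R).
Context (mu : {measure set (borel X) -> \bar R}) (c K : R).
Hypothesis hd : quasi_metric d.
Hypothesis hX : homogeneous_type mu (qball d) c K.
Hypothesis hg : ball_growth mu (qball d) c.
Local Notation B := (qball d).
Local Notation nint A u := (nint mu A%classic u%R).
Local Notation cm f := (cmeasurable [set: borel X] f).
Local Notation nice := (nice d).
Local Notation Omega := (Omega mu B).
Let c0 : 0 < c := c_gt0 hX.
Let K0 : 0 < K := K_gt0 hX.
Let c1 : 1 < c := hom_c hX.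
Implicit Types (f g h b : X -> R[i]) (A E F W : set X) (beta : X -> R -> R[i]).
Variables (delta : R) (k : X -> X -> R[i]) (eps Ck : R).
Variables (T2 : (X -> R[i]) -> X -> R[i]) (C2 : R).
Hypothesis hk : kernel_operator d mu c delta k eps Ck T2 C2.
Let mT h : nice h -> cm (T2 h) := ko_measurable hk (f := h).

(** Only the finiteness matters; the bound behind it depends on [M]. *)
Lemma commutator_lty b (M p : R) f : 1 < p -> cm b -> (forall x, normc (b x) <= M) ->
  nice f -> (nint setT (fun x => normc (commutator b T2 f x) `^ p) < +oo)%E.
Proof.
move=> p1 mb bM nf; have p0 : 0 <= p by lra.
have nbf := niceMl mb bM nf.
have M0 : 0 <= M by apply: le_trans (bM point).
have [A A0 HA] := T2_bounded hd hX hg hk p1.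
have fin h : nice h -> (nint setT (fun x => normc (T2 h x) `^ p) < +oo)%E.
  move=> nh; apply: le_lt_trans (HA h nh) _.
  have p0' : 0 < p by lra.
  have := nice_Lp hd hX p0' nh.
  have := nint_ge0 mu (A := setT) (fun x _ => powR_ge0 (normc (h x)) p).
  by case: (nint _ _) => [v| |] // _ _; rewrite -?EFinM ltry.
have m1 := measurable_normc_powR p (mT nf).
have m2 := measurable_normc_powR p (mT nbf).
apply: (@le_lt_trans _ _ (nint setT (fun x =>
    2 `^ p * (M `^ p * normc (T2 f x) `^ p + normc (T2 (fun y => b y * f y) x) `^ p)))).
  apply: nint_le_fun => x _; rewrite powR_ge0 -powRM //.
  apply: le_trans (powRD_le p0 (mulr_ge0 M0 (normc_ge0 _)) (normc_ge0 _)).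
  apply: le_powR_base => //; apply: (le_trans (normcB_le _ _)).
  by rewrite lerD2r Normc.normcM ler_wpM2r.
have m3 : measurable_fun setT ((fun x => M `^ p * normc (T2 f x) `^ p) : borel X -> R).
  exact: measurable_funM.
rewrite nintZ ?powR_ge0 //; last 2 first.
- exact: measurable_funD.
- by move=> x; rewrite addr_ge0 ?mulr_ge0 ?powR_ge0.
rewrite nintD //; [|by move=> x; rewrite mulr_ge0 ?powR_ge0|by move=> x; exact: powR_ge0].
rewrite nintZ ?powR_ge0 //; last by move=> x; exact: powR_ge0.
have := fin _ nf; have := nint_ge0 mu (A := setT) (fun x _ => powR_ge0 (normc (T2 f x)) p).
have := fin _ nbf; have := nint_ge0 mu (A := setT) (fun x _ => powR_ge0 (normc (T2 (fun y => b y * f y) x)) p).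
case: (nint _ (fun x => normc (T2 (fun y => b y * f y) x) `^ p)) => [v1| |] // _ _.
case: (nint _ _) => [v2| |] // _ _.
by rewrite -!(EFinM, EFinD) ltry.
Qed.

(** Sharp-function bound for the commutator, with [E'] built from the s-th power maximal functions
    of both [f] and [T2 f]. The constants [beta] need not be means of [b], and [C] is chosen before
    [b] and [M]: this allows truncations of an unbounded function. *)
Lemma bounded_commutator (p N : R) : 1 < p -> 0 < N -> exists2 C : R, 0 < C &
  forall b beta (M : R) f, cm b -> (forall x, normc (b x) <= M) ->
  (forall y r, 0 < r ->
    (nint (B y r) (fun x => normc (b x - beta y r)) <= N%:E * mu (B y r))%E) ->
  nice f -> (nint setT (fun x => normc (commutator b T2 f x) `^ p) <=
    C%:E * nint setT (fun x => normc (f x) `^ p))%E.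
Proof.
move=> p1 N0; have p0 : 0 < p by lra.
(* Any exponent strictly between 1 and [p] would do; the square root is a convenient one. *)
pose s := p `^ 2^-1; have s1 : 1 < s by apply: powR_gt1 => //; rewrite invr_gt0.
have s0 : 0 < s by lra.
have sp : s < p.
  have e : s * s = p.
    rewrite /s -powRD; last by rewrite (gt_eqF p0) implybT.
    by rewrite (_ : 2^-1 + 2^-1 = 1) ?powRr1 ?(ltW p0) //; field.
  by rewrite -e ltr_pMr.
have K1 := hom_K hX; have a1 : 1 < K + 3 by lra.
have [g [C [/andP[g0 g1] C0 HC]]] := sharp_function_bound hX hg p1.
have [Co Co0 HCo] := commutator_oscillation hd hX hg hk s1 N0.
have [A A0 HA] := T2_bounded hd hX hg hk p1.
pose gam := g / Co; have gam0 : 0 < gam by rewrite divr_gt0.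
have sp' : 0 < s < p by rewrite s0.
have [CL CL0 HL] := layer_Omega_powR hX a1 sp' gam0.
exists (C * (CL * (1 + A))) => [|b beta M f mb bM hN nf].
  by rewrite !mulr_gt0 // addr_gt0.
have [mf _ _] := nf; have mTf := mT nf.
have mF : cm (commutator b T2 f).
  by apply: cmeasurableB; [exact: cmeasurableM|apply: mT; exact: niceMl mb bM nf].
pose E1 l := Omega (fun x => normc (f x) `^ s) ((gam * l) `^ s).
pose E2 l := Omega (fun x => normc (T2 f x) `^ s) ((gam * l) `^ s).
have mE1 l : measurable (E1 l : set (borel X)) by exact: (measurable_Omega hX).
have mE2 l : measurable (E2 l : set (borel X)) by exact: (measurable_Omega hX).
rewrite EFinM -muleA.
apply: (HC _ (fun l => E1 l `|` E2 l) p).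
- exact: measurable_normc.
- by [].
- by rewrite p1 lexx.
- exact: (commutator_lty p1 mb bM).
- move=> l; exact: (measurableU _ _ (mE1 l) (mE2 l)).
- move=> l y r z l0 r0 Bz /not_orP[nO1 nO2].
  have D0 : 0 < gam * l by rewrite mulr_gt0.
  have [m||a a0 ha] := HCo b beta M f y r (gam * l) mb bM hN nf r0 D0.
  + have rm : 0 < c ^+ m * r by rewrite mulr_gt0 // exprn_gt0.
    have Bm : B y (c ^+ m * r) z.
      by apply: (hom_nested hX r0 _ Bz); rewrite ler_peMl ?(ltW r0) // exprn_ege1 // ltW.
    exact: notin_Omega nO1 rm Bm.
  + exact: notin_Omega nO2 r0 Bz.
  exists a => //; apply: (le_trans ha); apply: lee_wpmul2r => //.
  by rewrite lee_fin /gam mulrA [Co * _]mulrC divfK ?gt_eqF.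
- move=> s' s'0; apply: (@le_trans _ _ (layer mu (K + 3) p s' E1 + layer mu (K + 3) p s' E2)%E).
    apply: (layerU p _ s'0 a1) => l _; exact: (measureU2 mu (mE1 l) (mE2 l)).
  have h1 := HL (fun x => normc (f x)) s' s'0 (measurable_normc mf) (fun x => normc_ge0 _).
  have h2 := HL (fun x => normc (T2 f x)) s' s'0 (measurable_normc mTf) (fun x => normc_ge0 _).
  apply: (le_trans (leeD h1 h2) (lee_add_multiple (ltW CL0) (ltW A0) _ _ (HA f nf))).
  - by apply: nint_ge0 => x _; exact: powR_ge0.
  - by apply: nint_ge0 => x _; exact: powR_ge0.
Qed.

End CommutatorBound.

(** * Passage to the limit *)

Section Limits.
Context d (T : measurableType d) (R : realType) (mu : {measure set T -> \bar R}).
Implicit Types (A : set T) (v : T -> R) (u : nat -> T -> R).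
Local Notation nint A u := (nint mu A%classic u%R).

Lemma le_limn_einf (a : nat -> \bar R) (x : \bar R) n0 :
  (forall n, (n0 <= n)%N -> (x <= a n)%E) -> (x <= limn_einf a)%E.
Proof.
move=> H; rewrite limn_einf_lim.
apply: (@le_trans _ _ (einfs a n0)).
  by apply: le_ereal_inf_tmp => _ [n /= n0n <-]; exact: H.
rewrite (cvg_lim _ (@cvg_einfs_sup _ a)) //.
by apply: ereal_sup_ubound; exists n0.
Qed.

Lemma limn_einf_le (a : nat -> \bar R) (M : \bar R) :
  (forall n, (a n <= M)%E) -> (limn_einf a <= M)%E.
Proof.
move=> H; rewrite limn_einf_lim (cvg_lim _ (@cvg_einfs_sup _ a)) //.
apply: ge_ereal_sup => _ [n _ <-]; apply: le_trans (H n).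
by apply: ereal_inf_lbound; exists n => //=.
Qed.

(** The almost-everywhere hypothesis says that [v] is at most the lower limit of the [u n], phrased
    in real numbers: every value below [v x] is eventually exceeded. *)
Lemma nint_fatou u v (M : \bar R) : (forall n, measurable_fun setT (u n)) ->
  (forall n x, 0 <= u n x) -> measurable_fun setT v -> (forall x, 0 <= v x) ->
  {ae mu, forall x w, w < v x -> exists n0, forall n, (n0 <= n)%N -> w < u n x} ->
  (forall n, (nint setT (u n) <= M)%E) -> (nint setT v <= M)%E.
Proof.
move=> mfu u0 mv v0 uv uM.
have me n : measurable_fun setT (fun x => (u n x)%:E) by exact/measurable_EFinP.
apply: (@le_trans _ _ (\int[mu]_x limn_einf (fun n => (u n x)%:E))%E).
  apply: ae_ge0_le_integral => //.
  - by move=> x _; rewrite lee_fin.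
  - exact/measurable_EFinP.
  - by move=> x _; apply: (@le_limn_einf _ _ 0%N) => n _; rewrite lee_fin.
  - apply: (measurableT_comp (@oppe_measurable R setT)); apply: measurable_fun_limn_esup => n.
    exact: (measurableT_comp (@oppe_measurable R setT)).
  apply: ae_mono uv => x H _.
  apply/lee_addgt0Pr => e e0; rewrite -leeBlDr //.
  have [|n0 hn] := H (v x - e); first by rewrite ltrBlDr ltrDl.
  by apply: (@le_limn_einf _ _ n0) => n /hn h; rewrite -EFinB lee_fin ltW.
apply: le_trans (fatou mu measurableT me _) _; first by move=> n x _; rewrite lee_fin.
exact: limn_einf_le.
Qed.

(** If every tail exceeded [e], the integrals over the sets [A n] would stay below that of [v] by
    [e], and Fatou's lemma would contradict this. *)
Lemma nint_tail (A : nat -> set T) v : (forall n, measurable (A n)) ->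
  (forall n m, (n <= m)%N -> A n `<=` A m) -> (forall x, exists n, A n x) ->
  measurable_fun setT v -> (forall x, 0 <= v x) -> (nint setT v < +oo)%E ->
  forall e : R, 0 < e -> exists n, forall m, (n <= m)%N -> (nint (~` A m) v <= e%:E)%E.
Proof.
move=> mA ndA cA mv v0 vfin e e0.
have If : nint setT v \is a fin_num by rewrite ge0_fin_numE ?nint_ge0.
suff [n hn] : exists n, (nint (~` A n) v <= e%:E)%E.
  exists n => m nm; apply: le_trans hn; apply: nint_le_set => // x nA /(ndA _ _ nm).
  exact: nA.
apply: contrapT => /forallNP H.
have : (nint setT v <= nint setT v - e%:E)%E.
  apply: (@nint_fatou (fun n x => v x * \1_(A n) x)) => //.
  - by move=> n; apply: measurable_funM => //; exact: measurable_indic.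
  - by move=> n x; rewrite mulr_ge0.
  - apply: aeW => x w wv; have [n0 An0] := cA x; exists n0 => n n0n.
    by rewrite indicE mem_set ?mulr1 //; exact: ndA An0.
  - move=> n; rewrite nint_indic setTI leeBrDr //.
    have := @nint_setU _ _ _ mu (A n) (~` A n) v (mA n) (measurableC (mA n)) mv v0 (setICr _).
    rewrite setUCr => ->; apply: leeD => //; apply/ltW; rewrite ltNge; apply/negP; exact: H.
by rewrite leNgt lteBlDr // lteDl // lte_fin e0.
Qed.

(** The series of the [u n] has finite integral, so it converges almost everywhere and its terms
    tend to zero. *)
Lemma ae_cvg0 u : (forall n, measurable_fun setT (u n)) -> (forall n x, 0 <= u n x) ->
  (forall n, (nint setT (u n) <= (2^-1 ^+ n)%:E)%E) ->
  {ae mu, forall x, (u^~ x) @ \oo --> (0 : R)}.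
Proof.
move=> mfu u0 uM.
have me n : measurable_fun setT (fun x => (u n x)%:E) by exact/measurable_EFinP.
have i0 : (\int[mu]_x (\sum_(0 <= n <oo) (u n x)%:E) <= 2%:E)%E.
  rewrite integral_nneseries //; last by move=> n x _; rewrite lee_fin.
  apply: nneseries_le_bound => [n|n]; first exact: nint_ge0.
  apply: (@le_trans _ _ (\sum_(0 <= i < n) (2^-1 ^+ i)%:E)%E).
    by apply: lee_sum => i _; exact: uM.
  rewrite sumEFin big_mkord lee_fin.
  rewrite [leRHS](_ : 2 = (1 - 2^-1)^-1); last by field.
  by apply: geometric_partial_sum; apply/andP; split; lra.
have S0 x : (0 <= \sum_(0 <= n <oo) (u n x)%:E)%E.
  by apply: nneseries_ge0 => n _ _; rewrite lee_fin.
have : mu.-integrable setT (fun x => \sum_(0 <= n <oo) (u n x)%:E)%E.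
  apply/integrableP; split.
    by apply: ge0_emeasurable_sum => // n x _ _; rewrite lee_fin.
  under eq_integral do rewrite gee0_abs //.
  by apply: le_lt_trans i0 _; rewrite ltry.
move=> /integrable_ae => /(_ measurableT); apply: ae_mono => x /(_ I) Sf.
apply: cvg_series_cvg_0; apply: nondecreasing_is_cvgn.
  by apply/nondecreasing_seqP => n; rewrite /series /= big_nat_recr //= lerDl.
exists (fine (\sum_(0 <= n <oo) (u n x)%:E)%E) => _ [n _ <-].
rewrite -lee_fin fineK // /series /= -sumEFin.
by apply: nneseries_lim_ge => k _ _; rewrite lee_fin.
Qed.

End Limits.

(** * Norms in L^p and integrals of p-th powers *)

Section LpNorm.
Context d (T : measurableType d) (R : realType) (mu : {measure set T -> \bar R}).
Implicit Types (f g : T -> R[i]) (p C : R).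
Local Notation "''I_' p f" := (nint mu [set: T] (fun x => normc (f x) `^ p)%R)
  (at level 2, p at level 1, f at level 1).

Lemma nint_normc_ge0 p f : (0 <= 'I_p f)%E.
Proof. by apply: nint_ge0 => x _; exact: powR_ge0. Qed.

Lemma Lp_normE p f : (Lp_norm mu p f = ('I_p f) `^ p^-1)%E.
Proof.
rewrite /Lp_norm unlock; apply: (congr1 (fun z => (z `^ p^-1)%E)).
by apply: eq_integral => x _; rewrite gee0_abs ?lee_fin // poweR_EFin.
Qed.

Lemma Lp_norm_lty p f : 0 < p -> (Lp_norm mu p f < +oo)%E <-> ('I_p f < +oo)%E.
Proof.
move=> p0; rewrite Lp_normE; split; last exact: poweR_lty.
by apply: lty_poweRy; rewrite invr_eq0 gt_eqF.
Qed.

Lemma le_poweR (x y : \bar R) p : 0 <= p -> (0 <= x)%E -> (x <= y)%E -> (x `^ p <= y `^ p)%E.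
Proof.
move=> p0 x0 xy; apply: gt0_ler_poweR => //; rewrite in_itv /= ?leey ?andbT //.
exact: le_trans xy.
Qed.

Lemma poweRVK (x : \bar R) p : 0 < p -> (0 <= x)%E -> ((x `^ p^-1) `^ p = x)%E.
Proof. by move=> p0 x0; rewrite -poweRrM mulVf ?gt_eqF // poweRe1. Qed.

Lemma Lp_norm_le p C f g : 0 < p -> 0 <= C -> ('I_p f <= C%:E * 'I_p g)%E ->
  (Lp_norm mu p f <= (C `^ p^-1)%:E * Lp_norm mu p g)%E.
Proof.
move=> p0 C0 h; rewrite !Lp_normE -poweR_EFin -poweRM ?lee_fin ?nint_normc_ge0 //.
by apply: le_poweR; rewrite ?nint_normc_ge0 // invr_ge0 ltW.
Qed.

Lemma le_of_poweRV (x y : \bar R) p C : 0 < p -> 0 <= C -> (0 <= x)%E -> (0 <= y)%E ->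
  (x `^ p^-1 <= C%:E * y `^ p^-1)%E -> (x <= (C `^ p)%:E * y)%E.
Proof.
move=> p0 C0 x0 y0 h; have := le_poweR (ltW p0) (poweR_ge0 _ _) h.
by rewrite poweRM ?lee_fin ?poweR_ge0 // !poweRVK // poweR_EFin.
Qed.

Lemma nint_le_of_Lp_norm p C f g : 0 < p -> 0 <= C ->
  (Lp_norm mu p f <= C%:E * Lp_norm mu p g)%E -> ('I_p f <= (C `^ p)%:E * 'I_p g)%E.
Proof.
move=> p0 C0; rewrite !Lp_normE.
exact: (le_of_poweRV p0 C0 (nint_normc_ge0 p f) (nint_normc_ge0 p g)).
Qed.

Lemma Lp_norm_lt p (e : R) f : 0 < p -> 0 < e -> ('I_p f <= (e `^ p)%:E)%E ->
  (Lp_norm mu p f <= e%:E)%E.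
Proof.
move=> p0 e0 h; rewrite Lp_normE.
have := @le_poweR _ _ p^-1 _ (nint_normc_ge0 p f) h; rewrite invr_ge0 ltW // => /(_ isT).
by rewrite poweR_EFin -powRrM mulfV ?gt_eqF // powRr1 // ltW.
Qed.

Lemma nint_powR2 f : 'I_2 f = nint mu [set: T] (fun x => normc (f x) ^+ 2)%R.
Proof. by apply: eq_nint => x _; rewrite powR_mulrn. Qed.

End LpNorm.

(** * The given operator satisfies the kernel estimates *)

Section Instance.
Context (R : realType) (X : ptopologicalType) (d : X -> X -> R).
Context (mu : {measure set (borel X) -> \bar R}) (c K : R).
Hypothesis hd : quasi_metric d.
Hypothesis hX : homogeneous_type mu (qball d) c K.
Local Notation nint A u := (nint mu A%classic u%R).
Local Notation cm f := (cmeasurable [set: borel X] f).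
Local Notation nice := (nice d).
Let c0 : 0 < c := c_gt0 hX.
Let c1 : 1 < c := hom_c hX.

(* The kernel is measurable only off the diagonal, on which it is arbitrary. *)
Definition off_diagonal (k : X -> X -> R[i]) x y : R[i] :=
  if pselect (x = y) then 0 else k x y.

Lemma off_diagonalE k x y : x <> y -> off_diagonal k x y = k x y.
Proof. by rewrite /off_diagonal; case: pselect. Qed.

Lemma cmeasurable_off_diagonal k :
  cmeasurable [set z : borel X * borel X | z.1 <> z.2] (fun z => k z.1 z.2) ->
  cmeasurable [set: borel X * borel X] (fun z => off_diagonal k z.1 z.2).
Proof.
have mD := measurable_off_diagonal hd hX.
move=> [/(measurable_restrictT _ mD) h1 /(measurable_restrictT _ mD) h2]; split.
- move: h1; congr measurable_fun; apply/funext => -[x y]; rewrite patchE /off_diagonal /=.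
  by case: pselect => xy; [rewrite memNset //=; exact|rewrite mem_set].
- move: h2; congr measurable_fun; apply/funext => -[x y]; rewrite patchE /off_diagonal /=.
  by case: pselect => xy; [rewrite memNset //=; exact|rewrite mem_set].
Qed.

Lemma nice_in_Lp (p : R) f : 0 < p -> nice f -> in_Lp mu p f.
Proof.
move=> p0 nf; split; first by have [] := nf.
by apply/Lp_norm_lty => //; exact: (nice_Lp hd hX).
Qed.

Lemma bounded_operator_nint (T2 : (X -> R[i]) -> X -> R[i]) : bounded_operator mu 2 T2 ->
  exists2 C : R, 0 <= C & forall f, in_Lp mu 2 f ->
    (nint setT (fun x => normc (T2 f x) ^+ 2) <= C%:E * nint setT (fun x => normc (f x) ^+ 2))%E.
Proof.
(* The constant of a bounded operator is not assumed nonnegative. *)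
move=> [hS _ [C hC]]; exists (Num.max C 0 `^ 2) => [|f hf]; first exact: powR_ge0.
have m0 : 0 <= Num.max C 0 by rewrite le_max lexx orbT.
have := @nint_le_of_Lp_norm _ (borel X) R mu 2 (Num.max C 0) (T2 f) f (ltr0n R 2) m0.
rewrite !nint_powR2; apply; apply: (le_trans (hC f hf)).
by apply: lee_wpmul2r; [exact: Lnorm_ge0|rewrite lee_fin le_max lexx].
Qed.

Lemma calderon_zygmund_kernel_operator (delta : R) k T T2 :
  calderon_zygmund mu d c delta k T -> bounded_on_L2 mu d delta T T2 ->
  exists eps Ck C2, kernel_operator d mu c delta (off_diagonal k) eps Ck T2 C2.
Proof.
move=> [[delta0 hadm] [eps [Ck [eps0 Ck0 ksize ksmooth]]] _ [[mk _] hass]] [hB hT2].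
have [C2 C20 hC2] := bounded_operator_nint hB.
have [hS hL _] := hB.
have L2 f : nice f -> in_Lp mu 2 f by apply: nice_in_Lp.
exists eps, Ck, C2; split.
- exact: delta0.
- exact: hadm.
- exact: Ck0.
- exact: eps0.
- exact: cmeasurable_off_diagonal.
- by move=> x y xy; rewrite off_diagonalE //; exact: ksize.
- move=> x x' y xy hxy.
  have x'y : x' <> y.
    move=> e; move: hxy; rewrite e leNgt => /negP; apply.
    by rewrite ltr_pMl // (dist_gt0 hd).
  have yx : y <> x by move=> e; apply: xy.
  have yx' : y <> x' by move=> e; apply: x'y.
  by rewrite !off_diagonalE //; exact: ksmooth.
- exact: C20.
- by move=> f /L2 /hS [].
- by move=> a f g nf ng; apply: hL; exact: L2.
- by move=> f /L2; exact: hC2.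
- move=> f g hf hg hfg; apply: (etrans (esym (hT2 f g hf hg))).
  apply: (etrans (hass f g hf hg hfg)).
  apply: eq_cintegral => x _; apply: eq_cintegral => y _.
  (* On the diagonal the original kernel is arbitrary, but [f x * g x] vanishes because the supports
     are separated. *)
  rewrite /off_diagonal; case: pselect => // xy; rewrite mul0r mul0r -xy -mulrA.
  have [fx|fx] := pselect (f x = 0); first by rewrite fx mul0r mulr0.
  have [gx|gx] := pselect (g x = 0); first by rewrite gx !mulr0.
  by have [e e0 /(_ x x fx gx)] := hfg; rewrite (distxx hd) leNgt e0.
Qed.

End Instance.

(** * Truncation of real and complex values *)

Section Clamp.
Context (R : realType).
Implicit Types (n s t : R) (z w : R[i]).

Definition clamp n t : R := Num.max (- n) (Num.min n t).

Lemma clamp_le n t : 0 <= n -> `|clamp n t| <= n.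
Proof.
move=> n0; rewrite /clamp ler_norml le_max lexx /= ge_max ge_min lexx /= andbT.
by rewrite (le_trans _ n0) // oppr_le0.
Qed.

Lemma clamp_dist n s t : 0 <= n -> `|clamp n s - clamp n t| <= `|s - t|.
Proof.
move=> n0; rewrite /clamp; case: (leP n s); case: (leP n t) => ? ?; rewrite ?maxEle;
  repeat case: ifP => //= ?; rewrite ?subrr ?normr0 //;
  repeat match goal with |- context [`|?x|] => case: (ger0P x) => ? end; lra.
Qed.

Lemma clamp_id n t : `|t| <= n -> clamp n t = t.
Proof.
rewrite ler_norml => /andP[h1 h2]; rewrite /clamp (min_idPr h2).
exact: max_idPr.
Qed.

(** Real and imaginary parts are truncated separately; the price is a Lipschitz constant 2, which
    doubles the oscillation bound. *)
Definition cclamp n z : R[i] := clamp n (complex.Re z) +i* clamp n (complex.Im z).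

Lemma cclamp_le n z : 0 <= n -> normc (cclamp n z) <= 2 * n.
Proof.
move=> n0; apply: (le_trans (normc_le_ReIm _)) => /=.
by have := clamp_le (complex.Re z) n0; have := clamp_le (complex.Im z) n0; lra.
Qed.

Lemma cclamp_dist n z w : 0 <= n -> normc (cclamp n z - cclamp n w) <= 2 * normc (z - w).
Proof.
move=> n0; apply: (le_trans (normc_le_ReIm _)); rewrite ReB ImB /=.
have := clamp_dist (complex.Re z) (complex.Re w) n0.
have := clamp_dist (complex.Im z) (complex.Im w) n0.
have := Re_le_normc (z - w); have := Im_le_normc (z - w); rewrite ReB ImB; lra.
Qed.

Lemma cclamp_id n z : normc z <= n -> cclamp n z = z.
Proof.
move=> zn; rewrite /cclamp !clamp_id; first by case: z zn.
- exact: le_trans (Im_le_normc _) zn.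
- exact: le_trans (Re_le_normc _) zn.
Qed.

Lemma cmeasurable_cclamp d (T : measurableType d) n (b : T -> R[i]) :
  cmeasurable setT b -> cmeasurable setT (fun x => cclamp n (b x)).
Proof.
have h (u : T -> R) : measurable_fun setT u -> measurable_fun setT (fun x => clamp n (u x)).
  move=> mfu; apply: measurable_maxr; first exact: measurable_cst.
  by apply: measurable_minr => //; exact: measurable_cst.
by move=> [b1 b2]; split; exact: h.
Qed.

End Clamp.

(** * Truncation of [b] and [f] *)

Section Main.
Context (R : realType) (X : ptopologicalType) (d : X -> X -> R).
Context (mu : {measure set (borel X) -> \bar R}) (c K : R).
Hypothesis hd : quasi_metric d.
Hypothesis hX : homogeneous_type mu (qball d) c K.
Local Notation B := (qball d).
Local Notation vol := (vol mu B).
Local Notation nint A u := (nint mu A%classic u%R).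
Local Notation cm f := (cmeasurable [set: borel X] f).
Local Notation nice := (nice d).
Let c0 : 0 < c := c_gt0 hX.
Let c1 : 1 < c := hom_c hX.
Implicit Types (b f g : X -> R[i]).

(** Measurability on the whole space comes from integrability on an exhausting sequence of balls. *)
Lemma BMO_oscillation b : BMO mu d b -> cm b /\ exists2 N : R, 0 < N &
  forall y r, 0 < r ->
    (nint (B y r) (fun x => normc (b x - mean mu (B y r) b)) <= N%:E * mu (B y r))%E.
Proof.
move=> [bi bN]; have x0 : X := point; split.
  have cover : [set: X] = \bigcup_n B x0 (c ^+ n * 1).
    apply/seteqP; split => // x _; have [n Bx] := mem_qball_pow hX x0 x ltr01.
    by exists n.
  have mB n : measurable (B x0 (c ^+ n * 1) : set (borel X)).
    by apply: (measurable_qball hX); rewrite mulr1 exprn_gt0.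
  have r0 n : 0 < c ^+ n * 1 by rewrite mulr1 exprn_gt0.
  split; rewrite cover; apply/(measurable_fun_bigcup _ mB) => n; apply/measurable_EFinP.
  - by have [/integrableP[]] := bi x0 _ (r0 n).
  - by have [_ /integrableP[]] := bi x0 _ (r0 n).
have osc y r : 0 < r -> (mean_oscillation mu b (B y r) <= bmo_norm mu d b)%E.
  by move=> r0; apply: ereal_sup_ubound; exists (y, r).
have vi y r : 0 < r -> (0 <= (vol y r)^-1%:E)%E.
  by move=> r0; rewrite lee_fin invr_ge0 (vol_ge0 hX).
have b0 : (0 <= bmo_norm mu d b)%E.
  apply: le_trans (osc x0 1 ltr01); apply: mule_ge0; first exact: vi.
  by apply: nint_ge0.
have bf : bmo_norm mu d b \is a fin_num by rewrite ge0_fin_numE.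
have N0 : 0 <= fine (bmo_norm mu d b) by exact: fine_ge0.
exists (fine (bmo_norm mu d b) + 1) => [|y r r0]; first by rewrite ltr_wpDl.
have v0 := vol_gt0 hX y r0.
have := lee_wpmul2l (ltW v0 : (0 <= (vol y r)%:E)%E) (osc y r r0).
rewrite /mean_oscillation muleA -EFinM mulfV ?gt_eqF // mul1e => /le_trans; apply.
by rewrite -(fineK bf) (volE hX) // -!EFinM lee_fin mulrC ler_pM2r // lerDl.
Qed.

Section Truncation.
Variables b f : X -> R[i].
Hypotheses (mb : cm b) (mf : cm f).
Let x0 : X := point.

(** [b] is bounded by [n] here as well, so that on the support of the truncated function [b] agrees
    with its own truncation. *)
Definition core n : set X :=
  [set x | normc (f x) <= n%:R] `&` [set x | normc (b x) <= n%:R] `&` B x0 (c ^+ n * 1).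

Lemma measurable_core n : measurable (core n : set (borel X)).
Proof.
apply: measurableI; last by apply: (measurable_qball hX); rewrite mulr1 exprn_gt0.
by apply: measurableI; apply: measurable_le; exact: measurable_normc.
Qed.

Lemma core_nondecreasing n m : (n <= m)%N -> core n `<=` core m.
Proof.
move=> nm x [[/= h1 h2]]; rewrite mulr1 => h3.
have h : n%:R <= m%:R :> R by rewrite ler_nat.
split; first by split => /=; [exact: le_trans h|exact: le_trans h].
by rewrite mulr1; apply: (qball_pow hX nm).
Qed.

Lemma core_exhausts x : exists n, core n x.
Proof.
have [n Bx] := mem_qball_pow hX x0 x (@ltr01 R).
pose m := maxn n (maxn (Num.truncn (normc (f x))).+1 (Num.truncn (normc (b x))).+1).
exists m; have h (z : R) l : 0 <= z -> ((Num.truncn z).+1 <= l)%N -> z <= l%:R.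
  move=> z0 zl; have /andP[_ /ltW] := truncn_itv z0.
  by move=> /le_trans; apply; rewrite ler_nat.
split; last first.
  by rewrite mulr1; apply: (qball_pow hX (leq_maxl _ _)); move: Bx; rewrite mulr1.
by split => /=; apply: h => //; rewrite /m !leq_max leqnn !orbT.
Qed.

Definition trunc n x : R[i] := (\1_(core n) x)%:C * f x.

Lemma trunc_nice n : nice (trunc n).
Proof.
split; first by apply: cmeasurableM => //; apply: cmeasurable_indic; exact: measurable_core.
- exists n%:R => x; rewrite /trunc; have [Ax|nAx] := pselect (core n x).
    by rewrite indicE mem_set //= mul1r; have [[]] := Ax.
  by rewrite indicE memNset //= mul0r Normc.normc0.
- apply: (qboundedS _ (@qbounded_ball _ _ d x0 (c ^+ n * 1))) => x nz.
  have [[_ //]|nAx] := pselect (core n x).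
  by exfalso; apply: nz; rewrite /trunc indicE memNset //= mul0r.
Qed.

Lemma mul_trunc n : (fun y => b y * trunc n y) = (fun y => (\1_(core n) y)%:C * (b y * f y)).
Proof. by apply/funext => y; rewrite /trunc mulrCA. Qed.

Lemma mul_trunc_nice n : nice (fun y => b y * trunc n y).
Proof.
have [mt [M tM] bt] := trunc_nice n; split.
- exact: cmeasurableM.
- exists (n%:R * M) => x; rewrite /trunc; have [Ax|nAx] := pselect (core n x).
    rewrite Normc.normcM; apply: ler_pM => //; first by have [[]] := Ax.
    exact: tM.
  rewrite indicE memNset //= mul0r mulr0 Normc.normc0 mulr_ge0 //.
  exact: le_trans (tM point).
- by apply: qboundedS bt => x nz t0; apply: nz; rewrite t0 mulr0.
Qed.

Lemma clamp_trunc n : (fun y => cclamp n%:R (b y) * trunc n y) = (fun y => b y * trunc n y).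
Proof.
apply/funext => y; rewrite /trunc; have [[[_ /= h] _]|nAx] := pselect (core n y).
  by rewrite cclamp_id.
by rewrite indicE memNset //= mul0r !mulr0.
Qed.

End Truncation.

Lemma restrict_powR (A : set X) f (p : R) x : 0 < p ->
  normc ((\1_A x)%:C * f x - f x) `^ p = normc (f x) `^ p * \1_(~` A) x.
Proof.
move=> p0; rewrite !indicE in_setC; case: (x \in A); rewrite /= ?mul1r ?mul0r ?mulr0 ?mulr1.
  by rewrite subrr Normc.normc0 powR0 ?gt_eqF.
by rewrite sub0r normcN.
Qed.

Lemma nint_restrict_powR (A : set X) f (p : R) : 0 < p ->
  nint setT (fun x => normc ((\1_A x)%:C * f x - f x) `^ p) =
  nint (~` A) (fun x => normc (f x) `^ p).
Proof.
move=> p0; rewrite -(setTI (~` A)) -nint_indic; apply: eq_nint => x _.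
exact: restrict_powR.
Qed.

Lemma commutator_domain_dense b (p e : R) f : 1 < p -> cm b -> in_Lp mu p f -> 0 < e ->
  exists g, [/\ commutator_domain mu b g, in_Lp mu p g &
    (Lp_norm mu p (fun x => f x - g x)%R < e%:E)%E].
Proof.
move=> p1 mb [mf fp] e0; have p0 : 0 < p by lra.
have fin : (nint setT (fun x => normc (f x) `^ p) < +oo)%E by apply/Lp_norm_lty.
have e2 : 0 < e / 2 by lra.
have [n /(_ n (leqnn n)) hn] := nint_tail (measurable_core mb mf)
  (@core_nondecreasing b f) (core_exhausts b f)
  (measurable_normc_powR p mf) (fun x => powR_ge0 _ _) fin (powR_gt0 p e2).
exists (trunc b f n); split.
- by split; apply: (nice_in_Lp hd hX) => //; [exact: trunc_nice|exact: mul_trunc_nice].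
- by apply: (nice_in_Lp hd hX) => //; exact: trunc_nice.
apply: (@le_lt_trans _ _ (e / 2)%:E); last by rewrite lte_fin; lra.
apply: Lp_norm_lt => //; apply: le_trans hn; rewrite -nint_restrict_powR //.
by apply: nint_le_fun => x _; rewrite powR_ge0 normc_distC /=.
Qed.

Variable T2 : (X -> R[i]) -> X -> R[i].
Hypothesis hT2 : bounded_operator mu 2 T2.

(** The operator is linear only almost everywhere, so the difference is compared with the operator
    applied to the difference, to which the L^2 bound applies. *)
Lemma T2_restrict (C : R) (A : set X) f : measurable (A : set (borel X)) -> in_Lp mu 2 f ->
  (forall f, in_Lp mu 2 f -> (nint setT (fun x => normc (T2 f x) ^+ 2) <=
    C%:E * nint setT (fun x => normc (f x) ^+ 2))%E) -> 0 <= C ->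
  (nint setT (fun x => normc (T2 (fun y => (\1_A y)%:C * f y)%R x - T2 f x) ^+ 2) <=
    C%:E * nint (~` A) (fun x => normc (f x) `^ 2))%E.
Proof.
move=> mA hf hC C0; have [hS hL _] := hT2; have [mf f2] := hf.
have fin : (nint setT (fun x => normc (f x) `^ 2) < +oo)%E.
  by apply/(Lp_norm_lty mu f (ltr0n R 2)).
pose fA y := (\1_A y)%:C * f y.
have mfA : cm fA by apply: cmeasurableM => //; exact: cmeasurable_indic.
have hA : in_Lp mu 2 fA.
  split => //; apply/(Lp_norm_lty mu fA (ltr0n R 2)); apply: le_lt_trans fin.
  apply: nint_le_fun => x _; rewrite powR_ge0 /=; apply: le_powR_base => //.
  by rewrite Normc.normcM normc_real ger0_norm // ler_piMl.
have hD : in_Lp mu 2 (fun y => -1 * f y + fA y).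
  split; first by apply: cmeasurableD => //; apply: cmeasurableM => //; exact: cmeasurable_cst.
  apply/(Lp_norm_lty mu _ (ltr0n R 2)); apply: le_lt_trans fin.
  apply: nint_le_fun => x _; rewrite powR_ge0 mulN1r addrC /= restrict_powR //.
  by rewrite ler_piMr ?powR_ge0 // indicE; case: (_ \in _).
rewrite -nint_restrict_powR //.
apply: (@le_trans _ _ (nint setT (fun x => normc (T2 (fun y => -1 * f y + fA y)%R x) ^+ 2))).
  have [m1 _] := hS _ hf; have [m2 _] := hS _ hA; have [m3 _] := hS _ hD.
  apply: nint_ae_le => //.
  - by apply: measurable_normc_sqr; exact: cmeasurableB.
  - exact: measurable_normc_sqr.
  - by move=> x; exact: sqr_ge0.
  - by move=> x; exact: sqr_ge0.
  by apply: ae_mono (hL (-1) f fA hf hA) => x -> _; rewrite mulN1r addrC.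
apply: (le_trans (hC _ hD)); apply: lee_wpmul2l; first by rewrite lee_fin.
by apply: nint_le_fun => x _; rewrite sqr_ge0 mulN1r addrC powR_mulrn /=.
Qed.

End Main.

(** * The commutator with an unbounded function *)

Section Final.
Context (R : realType) (X : ptopologicalType) (d : X -> X -> R).
Context (mu : {measure set (borel X) -> \bar R}) (c K : R).
Hypothesis hd : quasi_metric d.
Hypothesis hX : homogeneous_type mu (qball d) c K.
Hypothesis hg : ball_growth mu (qball d) c.
Local Notation B := (qball d).
Local Notation nint A u := (nint mu A%classic u%R).
Local Notation cm f := (cmeasurable [set: borel X] f).
Local Notation nice := (nice d).
Let c0 : 0 < c := c_gt0 hX.
Implicit Types (b f g : X -> R[i]).
Variables (delta : R) (k : X -> X -> R[i]) (eps Ck : R).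
Variables (T2 : (X -> R[i]) -> X -> R[i]) (C2 : R).
Hypothesis hk : kernel_operator d mu c delta k eps Ck T2 C2.
Hypothesis hT2 : bounded_operator mu 2 T2.

(* Truncating f at level m, where m grows fast enough, makes both T2 f_m and
   T2 (b f_m) converge almost everywhere. *)
Lemma truncation_subsequence b f : cm b -> in_Lp mu 2 f -> in_Lp mu 2 (fun x => b x * f x) ->
  exists m : nat -> nat, (forall j, (j <= m j)%N) /\ {ae mu, forall x,
    (fun j => normc (T2 (trunc d c b f (m j)) x - T2 f x) ^+ 2) @ \oo --> (0 : R) /\
    (fun j => normc (T2 (fun y => b y * trunc d c b f (m j) y) x -
      T2 (fun y => b y * f y) x) ^+ 2) @ \oo --> (0 : R)}.
Proof.
move=> mb hf hbf; have [mf f2] := hf; have [mbf bf2] := hbf.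
have [C C0 hC] := bounded_operator_nint hT2.
have [hS _ _] := hT2; have C1 : 0 < C + 1 by lra.
have mC := measurable_core hX mb mf.
have tail h : cm h -> (Lp_norm mu 2 h < +oo)%E -> forall e : R, 0 < e ->
    exists n, forall m, (n <= m)%N -> (nint (~` core d c b f m) (fun x => normc (h x) `^ 2) <= e%:E)%E.
  move=> mh h2; apply: nint_tail => //.
  - exact: (core_nondecreasing hX).
  - exact: (core_exhausts hX).
  - exact: measurable_normc_powR.
  - by move=> x; exact: powR_ge0.
  - exact/(Lp_norm_lty mu h (ltr0n R 2)).
(* After applying the L^2 bound the errors are at most [2 ^- j], hence summable, and
   almost-everywhere convergence follows. *)
have e0 j : 0 < 2^-1 ^+ j / (C + 1) :> R by rewrite divr_gt0 // exprn_gt0.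
have /choice [m hm] : forall j, exists m, (j <= m)%N /\
    (nint (~` core d c b f m) (fun x => normc (f x) `^ 2) <= (2^-1 ^+ j / (C + 1))%:E)%E /\
    (nint (~` core d c b f m) (fun x => normc (b x * f x) `^ 2) <= (2^-1 ^+ j / (C + 1))%:E)%E.
  move=> j; have [n1 h1] := tail f mf f2 _ (e0 j); have [n2 h2] := tail _ mbf bf2 _ (e0 j).
  exists (maxn j (maxn n1 n2)); split; first exact: leq_maxl.
  by split; [apply: h1|apply: h2]; rewrite !leq_max leqnn !orbT.
have small h j : in_Lp mu 2 h ->
    (nint (~` core d c b f (m j)) (fun x => normc (h x) `^ 2) <= (2^-1 ^+ j / (C + 1))%:E)%E ->
    (nint setT (fun x => normc (T2 (fun y => (\1_(core d c b f (m j)) y)%:C * h y)%R x - T2 h x) ^+ 2)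
      <= (2^-1 ^+ j)%:E)%E.
  move=> hh hj; apply: (le_trans (T2_restrict hT2 (mC (m j)) hh hC C0)).
  apply: le_trans (lee_wpmul2l _ hj) _; first by rewrite lee_fin.
  rewrite -EFinM lee_fin mulrCA ler_piMr ?exprn_ge0 // ler_pdivrMr // mul1r; lra.
exists m; split; first by move=> j; have [] := hm j.
have mT h : nice h -> cm (T2 h) := ko_measurable hk (f := h).
have [mTf _] := hS _ hf; have [mTbf _] := hS _ hbf.
apply: ae_and; apply: ae_cvg0.
- move=> j; apply: measurable_normc_sqr; apply: cmeasurableB => //; apply: mT.
  exact: (trunc_nice hX).
- by move=> j x; exact: sqr_ge0.
- by move=> j; have [_ [h _]] := hm j; exact: (small f).
- move=> j; apply: measurable_normc_sqr; apply: cmeasurableB => //; apply: mT.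
  exact: (mul_trunc_nice hX).
- by move=> j x; exact: sqr_ge0.
- move=> j; have [_ [_ h]] := hm j; rewrite mul_trunc; exact: (small (fun y => b y * f y)).
Qed.

(** The bounded case is applied to the truncations of [b] and [f] at level [m j]. Its constant is
    the same for all [j], and Fatou's lemma passes to the limit. *)
Lemma commutator_estimate b (p : R) : BMO mu d b -> 1 < p -> exists2 C : R, 0 < C &
  forall f, commutator_domain mu b f -> in_Lp mu p f ->
    cm (commutator b T2 f) /\
    (nint setT (fun x => normc (commutator b T2 f x) `^ p) <=
      C%:E * nint setT (fun x => normc (f x) `^ p))%E.
Proof.
move=> hb p1; have p0 : 0 < p by lra.
have [mb [N N0 hN]] := BMO_oscillation hX hb.
(* The oscillation bound of the truncated functions, around the truncated means. *)
have N20 : 0 < 2 * N by rewrite mulr_gt0.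
have [C C0 HC] := bounded_commutator hd hX hg hk p1 N20.
exists C => // f [hf hbf] [mf fp].
have [hS _ _] := hT2; have [mTf _] := hS _ hf; have [mTbf _] := hS _ hbf.
have mF : cm (commutator b T2 f) by apply: cmeasurableB => //; exact: cmeasurableM.
split => //.
have [m [mj hm]] := truncation_subsequence mb hf hbf.
pose bn j x := cclamp (m j)%:R (b x).
pose fn j := trunc d c b f (m j).
have mT h : nice h -> cm (T2 h) := ko_measurable hk (f := h).
have nfn j : nice (fn j) by exact: (trunc_nice hX).
have mbn j : cm (bn j) by exact: cmeasurable_cclamp.
have bnM j x : normc (bn j x) <= 2 * (m j)%:R by exact: cclamp_le.
have bfE j : (fun y => bn j y * fn j y) = (fun y => b y * fn j y) by exact: clamp_trunc.
have mg j : cm (commutator (bn j) T2 (fn j)).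
  apply: cmeasurableB; first by apply: cmeasurableM => //; exact: mT.
  by apply: mT; exact: niceMl (mbn j) (bnM j) (nfn j).
apply: (@nint_fatou _ (borel X) R mu (fun j x => normc (commutator (bn j) T2 (fn j) x) `^ p)).
- by move=> j; exact: measurable_normc_powR.
- by move=> j x; exact: powR_ge0.
- exact: measurable_normc_powR.
- by move=> x; exact: powR_ge0.
- apply: ae_mono hm => x [cv1 cv2] w wv.
  have [w0|w0] := ltP w 0.
    by exists 0%N => j _; apply: lt_le_trans w0 _; exact: powR_ge0.
  pose w' := w `^ p^-1; have w'0 : 0 <= w' by exact: powR_ge0.
  have w'p : w' `^ p = w by rewrite /w' -powRrM mulVf ?gt_eqF // powRr1.
  set V := commutator b T2 f x in wv.
  have wV : w' < normc V.
    rewrite ltNge; apply/negP => h; move: wv; rewrite -w'p ltNge => /negP; apply.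
    by apply: le_powR_base => //; exact: ltW.
  pose eta := (normc V - w') / (normc (b x) + 1).
  have b1 : 0 < normc (b x) + 1 by rewrite ltr_wpDl.
  have eta0 : 0 < eta by rewrite divr_gt0 // subr_gt0.
  have eta2 : 0 < eta ^+ 2 by rewrite exprn_gt0.
  have [n1 _ h1] := cvgr_lt _ cv1 _ eta2; have [n2 _ h2] := cvgr_lt _ cv2 _ eta2.
  exists (maxn (Num.truncn (normc (b x))).+1 (maxn n1 n2)) => j.
  rewrite !geq_max => /andP[j0 /andP[j1 j2]].
  (* For large [j] the truncation of [b] is inactive at the point [x]. *)
  have bx : bn j x = b x.
    apply: cclamp_id; have /andP[_ /ltW h] := truncn_itv (normc_ge0 (b x)).
    by apply: (le_trans h); rewrite ler_nat; exact: leq_trans (mj j).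
  have {}h1 := h1 j j1; have {}h2 := h2 j j2.
  move: h1 h2; rewrite /= !ltr_sqr ?nnegrE ?(ltW eta0) // => h1 h2.
  rewrite -w'p; apply: lt_powR_base => //.
  have -> : commutator (bn j) T2 (fn j) x = b x * T2 (fn j) x - T2 (fun y => b y * fn j y) x.
    by rewrite /commutator bx bfE.
  set g := _ - _; have gV : normc (V - g) < normc V - w'.
    have -> : V - g = - (b x * (T2 (fn j) x - T2 f x)) +
        (T2 (fun y => b y * fn j y) x - T2 (fun y => b y * f y) x).
      by rewrite /V /g /commutator; ring.
    apply: (le_lt_trans (le_normcD _ _)); rewrite normcN Normc.normcM.
    have -> : normc V - w' = normc (b x) * eta + eta.
      by rewrite /eta; field; rewrite gt_eqF.
    by apply: ler_ltD => //; apply: ler_wpM2l => //; exact: ltW.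
  have := normc_le_dist V g; rewrite -lerBlDl => h; move: gV.
  by rewrite ltrBrDl -ltrBrDr => /lt_le_trans; apply.
- move=> j; apply: (@le_trans _ _ (C%:E * nint setT (fun x => normc (fn j x) `^ p))%E).
    apply: (HC _ (fun y r => cclamp (m j)%:R (mean mu (B y r) b)) (2 * (m j)%:R)) => //.
    move=> y r r0; have mB := measurable_qball hX y r0.
    apply: (@le_trans _ _ (nint (B y r) (fun x => 2 * normc (b x - mean mu (B y r) b)))).
      by apply: nint_le_fun => x _; rewrite normc_ge0 cclamp_dist.
    rewrite nintZ //; last first.
      by apply: measurable_normc; apply: cmeasurableB => //; exact: cmeasurable_cst.
    by rewrite EFinM -muleA; apply: lee_wpmul2l => //; exact: hN.
  apply: lee_wpmul2l; first by rewrite lee_fin ltW.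
  apply: nint_le_fun => x _; rewrite powR_ge0 /=; apply: le_powR_base => //; first exact: ltW.
  by rewrite /fn /trunc Normc.normcM normc_real ger0_norm // ler_piMl.
Qed.

End Final.

Theorem corollary6p3 (R : realType) (X : ptopologicalType)
    (d : X -> X -> R) (mu : {measure set (borel X) -> \bar R}) (c K : R)
    (hd : quasi_metric d)
    (hX : homogeneous_type mu (qball d) c K)
    (hgrowth : ball_growth mu (qball d) c)
    (delta : R) (k : X -> X -> R[i])
    (T : (X -> R[i]) -> (X -> R[i]) -> R[i])
    (T2 : (X -> R[i]) -> X -> R[i])
    (hT : calderon_zygmund mu d c delta k T)
    (hT2 : bounded_on_L2 mu d delta T T2)
    (b : X -> R[i]) (hb : BMO mu d b) :
  forall p : R, 1 < p ->
    bounded_on_Lp mu p (commutator_domain mu b) (commutator b T2).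
Proof.
move=> p p1; have p0 : 0 < p by lra.
have [eps [Ck [C2 hk]]] := calderon_zygmund_kernel_operator hd hX hT hT2.
have [hB _] := hT2; have [mb _] := BMO_oscillation hX hb.
split => [f hf e e0|]; first exact: (commutator_domain_dense hd hX).
have [C C0 HC] := commutator_estimate hd hX hgrowth hk hB hb p1.
exists (C `^ p^-1) => f df hf; have [mF FC] := HC f df hf.
have h := Lp_norm_le p0 (ltW C0) FC; split => //; split => //.
apply: le_lt_trans h _; have [_ fp] := hf; move: fp (Lnorm_ge0 mu p%:E (fun x => (normc (f x))%:E)).
by rewrite -/(Lp_norm mu p f); case: (Lp_norm mu p f) => [v| |] // _ _; rewrite -EFinM ltry.
Qed.
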